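(* Let $d\in\mathbb{N}$, $d \ge 1$, and let $J=J_{a,b}$ be a periodic Jacobi operator on $\ell^2(\mathbb{Z}^d)$. Then there exist bounded self-adjoint operators $Q_k$ on $\ell^2(\mathbb{Z}^d)$, $1\le k\le d$, such that for every $1\le k\le d$ $$\lim_{t\to\infty}\frac{X_k(t)}{t}=Q_k$$ in the strong sense, i.e. $\lim_{t\to\infty}\left\|\tfrac1t X_k(t)\psi-Q_k\psi\right\|=0$ for every $\psi\in D(X_k)$, and $\ker(Q_k)=\{0\}$. In particular, with $\mathbf{Q}:\ell^2(\mathbb{Z}^d)\to\ell^2(\mathbb{Z}^d)\otimes\mathbb{C}^d$ the bounded operator $\mathbf{Q}\psi=(Q_1\psi,\ldots,Q_d\psi)$, one has $$\mathbf{Q}=\lim_{t\to\infty}\frac{\mathbf{X}(t)}{t}$$ in the strong sense, i.e. $\tfrac1t\mathbf{X}(t)\psi\to\mathbf{Q}\psi$ for every $\psi\in D(\mathbf{X})$, and $\ker(\mathbf{Q})=\{0\}$.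
   Context: For $\mathbf{x},\mathbf{y}\in\mathbb{Z}^d$ write $\mathbf{x}\sim\mathbf{y}$ if $\|\mathbf{x}-\mathbf{y}\|_1=1$. A Jacobi operator $J=J_{a,b}$ on $\ell^2(\mathbb{Z}^d)$ is $$[Ju]_{\mathbf{x}}=\sum_{\mathbf{y}\sim\mathbf{x}}a_{\mathbf{x},\mathbf{y}}u_{\mathbf{y}}+b_{\mathbf{x}}u_{\mathbf{x}},\quad u\in\ell^2(\mathbb{Z}^d),\ \mathbf{x}\in\mathbb{Z}^d,$$ where $a=(a_{\mathbf{x},\mathbf{y}})_{\mathbf{x}\sim\mathbf{y}}$ (complex-valued) and $b=(b_{\mathbf{x}})_{\mathbf{x}\in\mathbb{Z}^d}$ are bounded, $b$ is real-valued, and $a_{\mathbf{y},\mathbf{x}}=\overline{a_{\mathbf{x},\mathbf{y}}}\neq0$ for all $\mathbf{x}\sim\mathbf{y}$. It is a bounded self-adjoint operator. $J$ is periodic if there is a full-rank subgroup $\mathbb{L}\subseteq\mathbb{Z}^d$ such that $a_{\mathbf{x}+\boldsymbol{\ell},\mathbf{y}+\boldsymbol{\ell}}=a_{\mathbf{x},\mathbf{y}}$ and $b_{\mathbf{x}+\boldsymbol{\ell}}=b_{\mathbf{x}}$ for all $\mathbf{x}\sim\mathbf{y}$ in $\mathbb{Z}^d$ and all $\boldsymbol{\ell}\in\mathbb{L}$. For $1\le k\le d$ the position operator $X_k$ is the (unbounded) multiplication operator $(X_k\psi)_{\mathbf{x}}=x_k\psi_{\mathbf{x}}$ with domain $D(X_k)=\{\psi\in\ell^2(\mathbb{Z}^d):X_k\psi\in\ell^2(\mathbb{Z}^d)\}$.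 The vector position operator is $\mathbf{X}:D(\mathbf{X})=\bigcap_{k=1}^dD(X_k)\to\ell^2(\mathbb{Z}^d)\otimes\mathbb{C}^d$, $\mathbf{X}\psi=(X_1\psi,\ldots,X_d\psi)$. Time evolution: $X_k(t)=e^{itJ}X_ke^{-itJ}$ with its natural domain $D(X_k(t))=\{\psi: e^{-itJ}\psi\in D(X_k)\}$ (which equals $D(X_k)$ for every $t \in \mathbb{R}$), and $\mathbf{X}(t)\psi=(X_1(t)\psi,\ldots,X_d(t)\psi)$. *)

(* Defs.v *)
From HB Require Import structures.
From mathcomp Require Import all_boot all_order all_algebra finmap.
From mathcomp Require Import all_classical all_reals all_analysis.
From mathcomp Require Import complex zify ring lra.
From mathcomp.analysis.showcase Require summability.

Set Implicit Arguments.
Unset Strict Implicit.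
Unset Printing Implicit Defensive.

Import Order.TTheory GRing.Theory Num.Theory.
Import numFieldNormedType.Exports.
Import ComplexField.Normc.

Local Open Scope classical_set_scope.
Local Open Scope ring_scope.
Local Open Scope complex_scope.

(* [numFieldNormedType.Exports] only covers abstract field structures: the
   concrete type [R[i]] has to be given its normed topology explicitly. *)
HB.instance Definition _ (R : realType) := NormedModule.copy R[i] R[i]^o.

Section ell2_def.
Variables (R : realType) (I : choiceType).
Implicit Types u v : I -> R[i].

Definition sqsum u : \bar R := (\esum_(i in [set: I]) (normc (u i) ^+ 2)%:E)%E.

Definition square_summable : {pred I -> R[i]} :=
  mem [set u | (sqsum u < +oo)%E].

Record ell2 := Ell2 { ell2_fun :> I -> R[i] ; _ : ell2_fun \in square_summable }.

HB.instance Definition _ := [isSub for ell2_fun].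
HB.instance Definition _ := [Choice of ell2 by <:].

Lemma normc_ge0 (z : R[i]) : 0 <= normc z.
Proof. by case: z => x y /=; rewrite sqrtr_ge0. Qed.

Lemma sqsum_ge0 u : (0 <= sqsum u)%E.
Proof. by apply: esum_ge0 => i _; rewrite lee_fin sqr_ge0. Qed.

Lemma sqsum_fset u (F : set I) : finite_set F ->
  ((\sum_(i <- fset_set F) normc (u i) ^+ 2)%:E <= sqsum u)%E.
Proof.
move=> finF; apply: ereal_sup_ubound; exists F; first by split.
by rewrite fsbig_finite// -sumEFin.
Qed.

Lemma sqsum_le u (M : \bar R) :
  (forall F : set I, finite_set F ->
     ((\sum_(i <- fset_set F) normc (u i) ^+ 2)%:E <= M)%E) ->
  (sqsum u <= M)%E.
Proof.
move=> h; apply: ge_ereal_sup => _ [F [finF _] <-].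
by rewrite fsbig_finite// sumEFin; exact: h.
Qed.

Lemma square_summableP u :
  (u \in square_summable) <-> (sqsum u < +oo)%E.
Proof. by rewrite inE. Qed.

Lemma square_summable_fin u : u \in square_summable -> sqsum u \is a fin_num.
Proof. by move=> /square_summableP h; rewrite ge0_fin_numE// sqsum_ge0. Qed.

Lemma square_summableW u (M : R) :
  (forall F : set I, finite_set F ->
     \sum_(i <- fset_set F) normc (u i) ^+ 2 <= M) ->
  u \in square_summable.
Proof.
move=> h; apply/square_summableP; apply: (@le_lt_trans _ _ M%:E); last exact: ltry.
by apply: sqsum_le => F finF; rewrite lee_fin; exact: h.
Qed.

Lemma square_summable_fset u (F : set I) :
  u \in square_summable -> finite_set F ->
  \sum_(i <- fset_set F) normc (u i) ^+ 2 <= fine (sqsum u).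
Proof.
move=> su finF; rewrite -lee_fin fineK ?square_summable_fin//.
exact: sqsum_fset.
Qed.

Lemma square_summable_bounded u v (M : R) :
  u \in square_summable -> (forall i, normc (v i) <= M * normc (u i)) ->
  v \in square_summable.
Proof.
move=> su vu; apply: (@square_summableW _ (M ^+ 2 * fine (sqsum u))) => F finF.
apply: (@le_trans _ _ (M ^+ 2 * \sum_(i <- fset_set F) normc (u i) ^+ 2)).
  rewrite mulr_sumr; apply: ler_sum => i _.
  by rewrite -exprMn lerXn2r// nnegrE ?normc_ge0// (le_trans _ (vu i))// normc_ge0.
by rewrite ler_wpM2l ?sqr_ge0// square_summable_fset.
Qed.

Lemma square_summable_closed : submod_closed square_summable.
Proof.
split.
  apply: (@square_summableW _ 0) => F finF.
  by rewrite big1// => i _; rewrite normc0 expr0n.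
move=> a u v su sv.
apply: (@square_summableW _
  (2 * normc a ^+ 2 * fine (sqsum u) + 2 * fine (sqsum v))) => F finF.
apply: (@le_trans _ _ (\sum_(i <- fset_set F)
   (2 * normc a ^+ 2 * normc (u i) ^+ 2 + 2 * normc (v i) ^+ 2))).
  apply: ler_sum => i _.
  have := le_normcD (a *: u i) (v i).
  rewrite normcM => h.
  apply: (@le_trans _ _ ((normc a * normc (u i) + normc (v i)) ^+ 2)).
    by rewrite lerXn2r// nnegrE ?addr_ge0 ?mulr_ge0 ?normc_ge0.
  rewrite -subr_ge0 [leRHS](_ : _ = (normc a * normc (u i) - normc (v i)) ^+ 2).
    exact: sqr_ge0.
  by rewrite sqrrB sqrrD exprMn !mulr_natl -!mulrnAl; ring.
rewrite big_split /= -!mulr_sumr lerD//.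
  by apply: ler_wpM2l; [rewrite mulr_ge0 ?sqr_ge0|exact: square_summable_fset].
by apply: ler_wpM2l => //; exact: square_summable_fset.
Qed.

HB.instance Definition _ :=
  GRing.isSubmodClosed.Build _ _ square_summable square_summable_closed.
HB.instance Definition _ := [SubChoice_isSubLmodule of ell2 by <:].


Implicit Types f g : ell2.

Lemma ell2P f : (f : I -> R[i]) \in square_summable. Proof. exact: valP. Qed.

Lemma ell2_inj f g : (forall i, f i = g i) -> f = g.
Proof. by move=> fg; apply: val_inj; exact/funext. Qed.

Lemma ell2D f g i : (f + g) i = f i + g i. Proof. by []. Qed.

Lemma ell2Z (a : R[i]) f i : (a *: f) i = a * f i. Proof. by []. Qed.

Definition ell2_rnorm f : R := Num.sqrt (fine (sqsum f)).

Definition ell2_norm f : R[i] := (ell2_rnorm f)%:C.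

Lemma fine_sqsum_ge0 f : 0 <= fine (sqsum f).
Proof. by rewrite fine_ge0// sqsum_ge0. Qed.

Lemma ell2_rnorm_ge0 f : 0 <= ell2_rnorm f.
Proof. exact: sqrtr_ge0. Qed.

Lemma ell2_rnorm_sqr f : ell2_rnorm f ^+ 2 = fine (sqsum f).
Proof. by rewrite sqr_sqrtr// fine_sqsum_ge0. Qed.

Lemma ell2_rnorm_fset f (F : set I) : finite_set F ->
  \sum_(i <- fset_set F) normc (f i) ^+ 2 <= ell2_rnorm f ^+ 2.
Proof.
by move=> finF; rewrite ell2_rnorm_sqr square_summable_fset// ell2P.
Qed.

Lemma ell2_rnorm_le f (M : R) : 0 <= M ->
  (forall F : set I, finite_set F ->
     \sum_(i <- fset_set F) normc (f i) ^+ 2 <= M ^+ 2) ->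
  ell2_rnorm f <= M.
Proof.
move=> M0 h; rewrite -(@ler_pXn2r _ 2)// ?nnegrE ?ell2_rnorm_ge0//.
rewrite ell2_rnorm_sqr -lee_fin fineK ?square_summable_fin ?ell2P//.
by apply: sqsum_le => F finF; rewrite lee_fin h.
Qed.

Lemma normc_le_ell2_rnorm f i : normc (f i) <= ell2_rnorm f.
Proof.
rewrite -(@ler_pXn2r _ 2)// ?nnegrE ?ell2_rnorm_ge0 ?normc_ge0//.
have := ell2_rnorm_fset f (finite_set1 i).
by rewrite fset_set1 big_seq_fset1.
Qed.

Lemma ell2_rnorm_eq0 f : ell2_rnorm f = 0 -> f = 0.
Proof.
move=> f0; apply: ell2_inj => i; apply: eq0_normc; apply/eqP.
by rewrite eq_le normc_ge0 andbT -f0 normc_le_ell2_rnorm.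
Qed.

Lemma ell2_rnormD f g : ell2_rnorm (f + g) <= ell2_rnorm f + ell2_rnorm g.
Proof.
have [f0|f0] := eqVneq (ell2_rnorm f) 0.
  by rewrite f0 (ell2_rnorm_eq0 f0) !add0r.
have [g0|g0] := eqVneq (ell2_rnorm g) 0.
  by rewrite g0 (ell2_rnorm_eq0 g0) !addr0.
have {}f0 : 0 < ell2_rnorm f by rewrite lt_neqAle eq_sym f0 ell2_rnorm_ge0.
have {}g0 : 0 < ell2_rnorm g by rewrite lt_neqAle eq_sym g0 ell2_rnorm_ge0.
apply: ell2_rnorm_le => [|F finF]; first by rewrite addr_ge0// ltW.
have hf := ell2_rnorm_fset f finF; have hg := ell2_rnorm_fset g finF.
set A := ell2_rnorm f in f0 hf *; set B := ell2_rnorm g in g0 hg *.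
apply: (@le_trans _ _ (\sum_(i <- fset_set F)
   ((1 + B / A) * normc (f i) ^+ 2 + (1 + A / B) * normc (g i) ^+ 2))).
  apply: ler_sum => i _.
  have fg := le_normcD (f i) (g i).
  apply: (@le_trans _ _ ((normc (f i) + normc (g i)) ^+ 2)).
    by rewrite lerXn2r// nnegrE ?addr_ge0 ?normc_ge0.
  set x := normc (f i); set y := normc (g i).
  rewrite -subr_ge0.
  have -> : (1 + B / A) * x ^+ 2 + (1 + A / B) * y ^+ 2 - (x + y) ^+ 2 =
      (B * x - A * y) ^+ 2 / (A * B).
    by field; rewrite !gt_eqF.
  by rewrite divr_ge0 ?sqr_ge0// mulr_ge0// ltW.
rewrite big_split /= -!mulr_sumr.
have -> : (A + B) ^+ 2 = (1 + B / A) * A ^+ 2 + (1 + A / B) * B ^+ 2.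
  by field; rewrite !gt_eqF.
by rewrite lerD// ler_wpM2l// addr_ge0// divr_ge0// ltW.
Qed.

Lemma ell2_rnormZ (a : R[i]) f : ell2_rnorm (a *: f) = normc a * ell2_rnorm f.
Proof.
have le (b : R[i]) h : ell2_rnorm (b *: h) <= normc b * ell2_rnorm h.
  apply: ell2_rnorm_le => [|F finF].
    by rewrite mulr_ge0// ?normc_ge0 ?ell2_rnorm_ge0.
  rewrite exprMn (eq_bigr (fun i => normc b ^+ 2 * normc (h i) ^+ 2)).
    by rewrite -mulr_sumr ler_wpM2l ?sqr_ge0// ell2_rnorm_fset.
  by move=> i _; rewrite ell2Z normcM exprMn.
apply/eqP; rewrite eq_le le /=.
have [->|a0] := eqVneq a 0; first by rewrite normc0 mul0r ell2_rnorm_ge0.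
have na : 0 < normc a.
  by rewrite lt_neqAle normc_ge0 andbT eq_sym; apply: contra_neq a0 => /eq0_normc.
rewrite mulrC -ler_pdivlMr// mulrC -normcV.
by apply: le_trans (le _ _); rewrite scalerA mulVf// scale1r.
Qed.

Lemma ell2_normD f g : ell2_norm (f + g) <= ell2_norm f + ell2_norm g.
Proof. by rewrite /ell2_norm -rmorphD lecR ell2_rnormD. Qed.

Lemma ell2_normZ (a : R[i]) f : ell2_norm (a *: f) = `|a| * ell2_norm f.
Proof. by rewrite /ell2_norm ell2_rnormZ rmorphM. Qed.

Lemma ell2_norm_eq0 f : ell2_norm f = 0 -> f = 0.
Proof. by case=> /ell2_rnorm_eq0. Qed.

HB.instance Definition _ := Lmodule_isNormed.Build R[i] ell2
  ell2_normD ell2_normZ ell2_norm_eq0.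

Lemma ell2_normE f : `|f| = (ell2_rnorm f)%:C. Proof. by []. Qed.

(* Unordered sum over the index set: the limit of the finite partial sums
   along the directed set of finite subsets of [I]. *)
Definition inner f g : R[i] :=
  summability.sum (fun i => (f i)^* * g i : R[i]).

Lemma inner_self f : inner f f = (ell2_rnorm f ^+ 2)%:C.
Proof.
have FF := @summability.totally_filter I.
apply: cvg_lim; first exact: norm_hausdorff.
apply/cvgrPdist_le => -[e e'] /andP[/= /eqP -> {e'} e0].
rewrite ell2_rnorm_sqr.
have [_ [F [finF _] <-] hF] := @ub_ereal_sup_adherent _ _ e e0
  (square_summable_fin (ell2P f)).
exists (fset_set F) => //= A FA.
have -> : summability.partial_sum (fun i => (f i)^* * f i) A =
    (\sum_(i <- A) normc (f i) ^+ 2)%:C.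
  rewrite /summability.partial_sum (rmorph_sum (real_complex R)) /= big_seq_fsetE /=.
  by apply: eq_bigr => i _; rewrite mulrC -sqr_normc -rmorphXn.
rewrite -rmorphB normc_def /= expr0n addr0 sqrtr_sqr lecR.
move: hF; rewrite -/(sqsum f) fsbig_finite// sumEFin.
have sf := fineK (square_summable_fin (ell2P f)).
rewrite -[ereal_sup _]/(sqsum f) -[in (_ - _)%E]sf -EFinB lte_fin => hF.
have hA : \sum_(i <- A) normc (f i) ^+ 2 <= fine (sqsum f).
  have := square_summable_fset (ell2P f) (finite_fset A).
  by rewrite set_fsetK.
rewrite ger0_norm ?subr_ge0// lerBlDr addrC -lerBlDr.
apply: (le_trans (ltW hF)).
pose G i := if i \in fset_set F then normc (f i) ^+ 2 else 0.
rewrite [leLHS](_ : _ = \sum_(i <- A) G i).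
  by apply: ler_sum => i _; rewrite /G; case: ifP => // _; exact: sqr_ge0.
rewrite -(@big_fset_incl _ _ _ _ _ _ G FA); last by move=> i _; rewrite /G => /negPf ->.
by apply: eq_big_seq => i iF; rewrite /G iF.
Qed.

End ell2_def.
Arguments ell2 : clear implicits.
Arguments square_summable {R I}.

Section lattice.
Variables (R : realType) (d : nat).
Local Notation Zd := 'rV[int]_d.
Implicit Types (x y : Zd).

Definition l1norm x : int := \sum_(k < d) `|x 0 k|.

Definition adjacent x y : Prop := l1norm (x - y) = 1.

Definition full_rank_subgroup (L : set Zd) : Prop :=
  [/\ L 0, forall x y, L x -> L y -> L (x - y) &
      exists M : 'M[int]_d,
        (forall k, L (row k M)) /\ \rank (map_mx intr M : 'M[rat]_d) = d].

(* [a x y] is a total function of [x] and [y]; its values on non-adjacent pairs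
   are never used. *)
Record jacobi_coeffs (a : Zd -> Zd -> R[i]) (b : Zd -> R) : Prop := {
  jacobi_a_bounded : exists M : R, forall x y, adjacent x y -> normc (a x y) <= M;
  jacobi_b_bounded : exists M : R, forall x, `|b x| <= M;
  jacobi_a_herm : forall x y, adjacent x y -> a y x = (a x y)^*;
  jacobi_a_neq0 : forall x y, adjacent x y -> a x y != 0 }.

Definition periodic_coeffs (a : Zd -> Zd -> R[i]) (b : Zd -> R) : Prop :=
  exists L : set Zd, full_rank_subgroup L /\
    (forall l, L l ->
       (forall x y, adjacent x y -> a (x + l) (y + l) = a x y) /\
       (forall x, b (x + l) = b x)).

(* A [\sum_(y \in A)] is [0] by convention on infinite supports; here the range
   is finite, see [finite_adjacent] and [jacobi_funE]. *)
Definition jacobi_fun (a : Zd -> Zd -> R[i]) (b : Zd -> R) (u : Zd -> R[i])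
    (x : Zd) : R[i] :=
  \sum_(y \in [set y | adjacent x y]) (a x y * u y) + (b x)%:C * u x.

Lemma l1norm_ge x k : `|x 0 k| <= l1norm x.
Proof.
rewrite /l1norm (bigD1 k)//= lerDl; apply: sumr_ge0 => j _; exact: normr_ge0.
Qed.

Lemma l1normN x : l1norm (- x) = l1norm x.
Proof. by apply: eq_bigr => k _; rewrite mxE normrN. Qed.

Definition unit_steps : set Zd := [set e | l1norm e = 1].

Lemma finite_unit_steps : finite_set unit_steps.
Proof.
pose h (f : {ffun 'I_d -> 'I_3}) : Zd := \row_k ((f k : nat)%:Z - 1).
apply: (@sub_finite_set _ _ (h @` [set: {ffun 'I_d -> 'I_3}])); last first.
  by apply: finite_image; exact: finite_finset.
move=> e /= e1; exists [ffun k => inord (absz (e 0 k + 1))] => //.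
apply/rowP => k; rewrite mxE ffunE.
have := l1norm_ge e k; rewrite e1 => ek.
rewrite inordK; last by lia.
lia.
Qed.

Lemma adjacentE x : [set y | adjacent x y] = (fun e => x + e) @` unit_steps.
Proof.
apply/seteqP; split => [y /= xy|_ /= [e e1 <-]].
  by exists (y - x); rewrite /unit_steps/= ?subrKC// -l1normN opprB.
by rewrite /adjacent opprD addNKr l1normN.
Qed.

Lemma finite_adjacent x : finite_set [set y | adjacent x y].
Proof. by rewrite adjacentE; apply: finite_image; exact: finite_unit_steps. Qed.

Lemma jacobi_funE a b u x : jacobi_fun a b u x =
  \sum_(e <- fset_set unit_steps) (a x (x + e) * u (x + e)) + (b x)%:C * u x.
Proof.
rewrite /jacobi_fun adjacentE; congr (_ + _).
rewrite fsbig_image; last by move=> e1 e2 _ _ /addrI.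
by rewrite fsbig_finite//; exact: finite_unit_steps.
Qed.

Lemma square_summable_shift (u : Zd -> R[i]) (e : Zd) :
  u \in square_summable -> (fun x => u (x + e)) \in square_summable.
Proof.
move=> /square_summableP su; apply/square_summableP; apply: le_lt_trans su.
rewrite /sqsum [leRHS](@reindex_esum _ _ _ setT setT (fun x : Zd => x + e))//.
split => // [x y _ _ /addIr//|x _]; exists (x - e) => //; exact: subrK.
Qed.

Lemma jacobi_fun_square_summable a b (u : Zd -> R[i]) : jacobi_coeffs a b ->
  u \in square_summable -> jacobi_fun a b u \in square_summable.
Proof.
move=> [[Ma aM] [Mb bM] _ _] su.
have -> : jacobi_fun a b u =
    \sum_(e <- fset_set unit_steps) (fun x => a x (x + e) * u (x + e)) +
    (fun x => (b x)%:C * u x).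
  by apply/funext => x; rewrite jacobi_funE addrfctE fct_sumE.
apply: rpredD.
  rewrite big_seq; apply: rpred_sum => e; rewrite in_fset_set; last exact: finite_unit_steps.
  rewrite inE => e1.
  apply: (square_summable_bounded (M := Ma) (square_summable_shift e su)) => x.
  rewrite normcM ler_wpM2r ?normc_ge0// aM//.
  by rewrite /adjacent opprD addNKr l1normN.
apply: (square_summable_bounded (M := Mb) su) => x.
rewrite normcM ler_wpM2r ?normc_ge0//.
by rewrite /normc/= expr0n addr0 sqrtr_sqr.
Qed.

Definition jacobi a b (hJ : jacobi_coeffs a b) (u : ell2 R Zd) : ell2 R Zd :=
  Ell2 (jacobi_fun_square_summable hJ (ell2P u)).

Definition position_fun (k : 'I_d) (u : Zd -> R[i]) (x : Zd) : R[i] :=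
  (x 0 k)%:~R * u x.

Definition dom_position (k : 'I_d) : set (ell2 R Zd) :=
  [set psi | position_fun k psi \in square_summable].

(* Junk value [0] outside [dom_position k]. *)
Definition position (k : 'I_d) (psi : ell2 R Zd) : ell2 R Zd :=
  insubd 0 (position_fun k psi).

Lemma positionE k psi x : dom_position k psi ->
  position k psi x = (x 0 k)%:~R * psi x.
Proof.
by move=> hpsi; rewrite -[LHS]/(val (insubd 0 _) x) insubdK.
Qed.

End lattice.

Section exponential.
Variables (R : realType) (V : normedModType R[i]).

(* [exp(A) v], the sum in [V] of the exponential series of [A] applied to [v]. *)
Definition op_exp (A : V -> V) (v : V) : V :=
  limn (series (fun n => (n`!%:R : R[i])^-1 *: iter n A v)).

(* [exp(i s A)] *)
Definition unitary_group (A : V -> V) (s : R) : V -> V :=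
  op_exp (fun v => (0 +i* s) *: A v).

End exponential.

Section time_evolution.
Variables (R : realType) (d : nat).
Local Notation H := (ell2 R 'rV[int]_d).
Variable J : H -> H.

Definition dom_heisenberg (k : 'I_d) (t : R) : set H :=
  [set psi | dom_position k (unitary_group J (- t) psi)].

(* [X_k(t) = exp(itJ) X_k exp(-itJ)]; only meaningful on [dom_heisenberg k t]. *)
Definition heisenberg (k : 'I_d) (t : R) (psi : H) : H :=
  unitary_group J t (position k (unitary_group J (- t) psi)).

Definition dom_vposition : set H := [set psi | forall k, dom_position k psi].

Definition dom_vheisenberg (t : R) : set H :=
  [set psi | forall k, dom_heisenberg k t psi].

(* [l^2(Z^d) (x) C^d] is represented by ['I_d -> H]. *)
Definition vheisenberg (t : R) (psi : H) : 'I_d -> H :=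
  fun k => heisenberg k t psi.

Definition tensor_norm (v : 'I_d -> H) : R :=
  Num.sqrt (\sum_(k < d) ell2_rnorm (v k) ^+ 2).

End time_evolution.
Arguments dom_vposition {R d}.

Definition bounded_selfadjoint (R : realType) (I : choiceType)
    (T : ell2 R I -> ell2 R I) : Prop :=
  [/\ linear T,
      exists M : R, forall u, `|T u| <= M%:C * `|u| &
      forall u v, inner (T u) v = inner u (T v)].

(* Main.v *)
Require Import Defs.
From HB Require Import structures.
From mathcomp Require Import all_boot all_order all_algebra finmap.
From mathcomp Require Import all_classical all_reals all_analysis.
From mathcomp Require Import complex zify ring lra.
From mathcomp.analysis.showcase Require summability.
From mathcomp Require mpoly.
Import -(notations) mpoly.

Set Implicit Arguments.
Unset Strict Implicit.
Unset Printing Implicit Defensive.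

Import Order.TTheory GRing.Theory Num.Theory.
Import numFieldNormedType.Exports.
Import ComplexField.Normc.

Local Open Scope classical_set_scope.
Local Open Scope ring_scope.
Local Open Scope complex_scope.

(** In the classical picture, [J] is fibered over the torus of quasimomenta [z], its
    energies are the branches of the algebraic function [lambda(z)] defined by an
    equation [p(z, lambda) = 0], and [Q_k] is the multiplication by the group
    velocity, which by implicit differentiation is the quotient of
    [z_k dp/dz_k] by [dp/dlambda], up to a constant. Its kernel is trivial because
    no branch is constant in [z_k]. The proof keeps this picture and replaces the
    direct integral by algebra.

    Let [J] commute with the translations by [N] times the lattice vectors. Through
    these translations the polynomials in [d] variables act as scalars ([act]), and
    the polynomials in one more variable act by the insertion of [J] ([ev]). Three
    facts carry the argument.
    - A nonzero scalar acts with dense range and trivial kernel ([act_dense],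
      [act_inj]), so one may divide by it, as one divides by a function on the
      torus that vanishes on a null set only. The density comes from counting
      dimensions in large boxes.
    - By Cayley-Hamilton some nonzero polynomial annihilates [J]
      ([exists_annihilator]). One of minimal degree, [p], is squarefree because the
      operators [ev P] are normal, hence coprime to [p'] ([minpoly_separable]).
    - [p] is coprime to [eulerp k p], the polynomial [z_k dp/dz_k]
      ([minpoly_euler_coprime]). For a common factor [q] would be independent of
      [z_k], up to a scalar; as the hopping amplitudes do not vanish, [J] moves the
      outermost layer of a finitely supported function in direction [k] without
      killing it, and so does [ev q], which is thus injective on such functions;
      then the cofactor of [q] would already annihilate [J].

    The commutator with the position [X] differentiates polynomials in the
    translations and [J] ([ev_commutator]). Applied to [p], and multiplied by a
    polynomial [v] such that [v p'] is a nonzero scalar [r] modulo [p], it provides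
    bounded operators [W] and [A] with
      [J (r X + W) - (r X + W) J = A = N v (eulerp k p)],
    where [A] commutes with [J]. Hence the evolution adds [i t A] to [r X + W], and
    [X(t) / t] converges on the range of [r]. As the limsup of the norm of
    [X(t) u / t] is at most a constant times the norm of [u], it converges on the
    whole domain, to an operator [Q] with [r Q = i A] ([asymptotic_velocity]). If
    [Q u = 0], then [A u = 0], so [eulerp k p] annihilates [u]; being coprime to
    [p], it forces [u = 0] ([jacobi_velocity]). *)

(** * Convergence and completeness of square summable functions *)

Section ell2_basics.
Variables (R : realType) (I : choiceType).
Local Notation H := (ell2 R I).
Local Notation C := R[i].
Implicit Types (u v w : H) (x y : I).

Local Notation rn := (@ell2_rnorm R I).

Lemma rnormN u : rn (- u) = rn u.
Proof.
rewrite -scaleN1r ell2_rnormZ (_ : normc (-1) = 1) ?mul1r//.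
by rewrite -(normcN (-1)) opprK normc1.
Qed.

Lemma rnorm0 : rn 0 = 0.
Proof. by rewrite -(scale0r (0 : H)) ell2_rnormZ normc0 mul0r. Qed.

Lemma rnormB u v : rn (u - v) <= rn u + rn v.
Proof. by rewrite -(rnormN v) ell2_rnormD. Qed.

Lemma rnorm_distC u v : rn (u - v) = rn (v - u).
Proof. by rewrite -rnormN opprB. Qed.

Lemma rnorm_sum (T : Type) (s : seq T) (P : pred T) (f : T -> H) :
  rn (\sum_(i <- s | P i) f i) <= \sum_(i <- s | P i) rn (f i).
Proof.
elim/big_ind2: _ => [|u a v b ha hb|//]; first by rewrite rnorm0.
exact: le_trans (ell2_rnormD _ _) (lerD ha hb).
Qed.

Lemma rnorm_dist_triangle w u v : rn (u - v) <= rn (u - w) + rn (w - v).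
Proof. by apply: le_trans (ell2_rnormD _ _); rewrite addrA subrK. Qed.

Lemma rnorm_eq0P u : (forall e : R, 0 < e -> rn u <= e) -> u = 0.
Proof.
move=> h; apply: ell2_rnorm_eq0; apply/eqP; rewrite eq_le ell2_rnorm_ge0 andbT.
by apply/ler_addgt0Pl => e e0; rewrite addr0 h.
Qed.

Lemma ell2_sumE (T : Type) (s : seq T) (P : pred T) (f : T -> H) x :
  (\sum_(i <- s | P i) f i) x = \sum_(i <- s | P i) f i x.
Proof. by elim/big_rec2: _ => // i a b _ <-. Qed.

Lemma ell2N u x : (- u) x = - u x. Proof. by []. Qed.
Lemma ell2B u v x : (u - v) x = u x - v x. Proof. by []. Qed.
Lemma ell20 x : (0 : H) x = 0. Proof. by []. Qed.

(** The norm of [ell2] is valued in the complex numbers; real epsilons make it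
    possible to compare norms with real expressions. [tends_cvg] is the link. *)
Definition tends (T : Type) (F : set_system T) (f : T -> H) (l : H) :=
  forall e : R, 0 < e -> \forall t \near F, rn (f t - l) <= e.

Lemma tends_cvg (T : Type) (F : set_system T) {FF : Filter F} (f : T -> H) l :
  tends F f l <-> f @ F --> l.
Proof.
split=> [h|/cvgrPdist_le h].
  apply/cvgrPdist_le => -[e e'] /andP[/= /eqP -> {e'} e0].
  apply: filterS (h _ e0) => t.
  by rewrite ell2_normE lecR rnorm_distC.
move=> e e0; have e0' : 0 < e%:C by rewrite ltcR.
apply: filterS (h _ e0') => t.
by rewrite ell2_normE lecR rnorm_distC.
Qed.

Section tends_theory.
Variables (T : Type) (F : set_system T).
Context {FF : ProperFilter F}.
Implicit Types (f g : T -> H).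

Lemma tends_unique f l l' : tends F f l -> tends F f l' -> l = l'.
Proof.
move=> h h'; apply/eqP; rewrite -subr_eq0; apply/eqP/rnorm_eq0P => e e0.
have e2 : 0 < e / 2 by rewrite divr_gt0.
have [t [ht ht']] := filter_ex (filterI (h _ e2) (h' _ e2)).
apply: le_trans (rnorm_dist_triangle (f t) _ _) _.
by rewrite [leRHS](splitr e) lerD// rnorm_distC.
Qed.

Lemma tendsD f g l l' : tends F f l -> tends F g l' ->
  tends F (fun t => f t + g t) (l + l').
Proof.
move=> h h' e e0; have e2 : 0 < e / 2 by rewrite divr_gt0.
apply: filterS2 (h _ e2) (h' _ e2) => t ht ht'.
rewrite opprD addrACA; apply: le_trans (ell2_rnormD _ _) _.
by rewrite [leRHS](splitr e) lerD.
Qed.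

Lemma tends_bounded (A : H -> H) M f l :
  (forall u v, A (u - v) = A u - A v) -> (forall u, rn (A u) <= M * rn u) ->
  tends F f l -> tends F (fun t => A (f t)) (A l).
Proof.
move=> Alin AM h e e0.
have M0 : 0 < `|M| + 1 by rewrite ltr_pwDr.
have eM : 0 < e / (`|M| + 1) by rewrite divr_gt0.
apply: filterS (h _ eM) => t ht.
rewrite -Alin; apply: le_trans (AM _) _.
apply: (@le_trans _ _ ((`|M| + 1) * rn (f t - l))).
  by rewrite ler_wpM2r ?ell2_rnorm_ge0// (le_trans (ler_norm _))// lerDl.
by rewrite mulrC -ler_pdivlMr.
Qed.

Lemma tendsZ (c : C) f l : tends F f l -> tends F (fun t => c *: f t) (c *: l).
Proof.
apply: (@tends_bounded (fun u => c *: u) (normc c)) => [u v|u].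
  by rewrite scalerBr.
by rewrite ell2_rnormZ.
Qed.

Lemma tendsB f g l l' : tends F f l -> tends F g l' ->
  tends F (fun t => f t - g t) (l - l').
Proof.
move=> h h'; rewrite -scaleN1r; under eq_fun do rewrite -scaleN1r.
exact/tendsD/tendsZ.
Qed.

Lemma tends_rnorm_le f l M : tends F f l ->
  (\forall t \near F, rn (f t) <= M) -> rn l <= M.
Proof.
move=> h hM; apply/ler_addgt0Pr => e e0.
have [t [ht ht']] := filter_ex (filterI (h _ e0) hM).
have -> : l = f t - (f t - l) by rewrite subKr.
by apply: le_trans (rnormB _ _) _; rewrite lerD.
Qed.

Lemma tends_squeeze f l (g : T -> R) : (\forall t \near F, rn (f t - l) <= g t) ->
  g @ F --> (0 : R) -> tends F f l.
Proof.
move=> fg /cvgrPdist_le g0 e e0.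
apply: filterS2 fg (g0 _ e0) => t h; rewrite sub0r normrN => h'.
by rewrite (le_trans h)// (le_trans (ler_norm _)).
Qed.

Lemma eq_tends f g l : f =1 g -> tends F f l -> tends F g l.
Proof. by move=> /funext ->. Qed.

End tends_theory.

(** Fatou's lemma. The coordinatewise limit [v] is not known to be square summable
    yet, hence the conclusion about finite partial sums. *)
Lemma ell2_fatou (T : Type) (G : set_system T) {FG : ProperFilter G}
  (f : T -> H) (v : I -> C) (M : R) :
  (forall x, normc (f t x - v x) @[t --> G] --> (0 : R)) ->
  (\forall t \near G, rn (f t) <= M) ->
  forall F : set I, finite_set F ->
    \sum_(i <- fset_set F) normc (v i) ^+ 2 <= M ^+ 2.
Proof.
move=> fv fM F finF.
have h x : normc (f t x) @[t --> G] --> normc (v x).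
  have /cvgrPdist_le hx := fv x; apply/cvgrPdist_le => e /hx.
  apply: filterS => n; rewrite sub0r normrN => hn.
  apply: le_trans hn; rewrite (ger0_norm (normc_ge0 _)).
  have h1 := le_normcD (f n x - v x) (v x).
  have h2 := le_normcD (v x - f n x) (f n x).
  rewrite subrK in h1; rewrite subrK -opprB normcN in h2.
  by rewrite ler_norml; lra.
have hs (s : seq I) : \sum_(i <- s) normc (f t i) ^+ 2 @[t --> G] -->
    \sum_(i <- s) normc (v i) ^+ 2.
  elim: s => [|x s IH].
    by rewrite big_nil; under eq_fun do rewrite big_nil; exact: cvg_cst.
  rewrite big_cons; under eq_fun do rewrite big_cons.
  apply: cvgD IH; rewrite expr2; under eq_fun do rewrite expr2.
  exact: cvgM.
apply: (cvgr_to_le (hs _)); apply: filterS fM => n hn.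
apply: le_trans (ell2_rnorm_fset _ finF) _.
by rewrite lerXn2r// nnegrE ?(le_trans _ hn)// ell2_rnorm_ge0.
Qed.

Lemma tends_shiftS (f : nat -> H) (l : H) :
  tends \oo f l -> tends \oo (fun n => f n.+1) l.
Proof.
move=> h e e0; have [N _ hN] := h e e0.
exists N; first by [].
by move=> n Nn; exact: (hN n.+1 (leqW Nn)).
Qed.

Lemma normc_Re (z : C) : `|complex.Re z| <= normc z.
Proof.
case: z => a b /=; rewrite -sqrtr_sqr ler_wsqrtr// lerDl; exact: sqr_ge0.
Qed.

Lemma normc_Im (z : C) : `|complex.Im z| <= normc z.
Proof.
case: z => a b /=; rewrite -sqrtr_sqr ler_wsqrtr// lerDr; exact: sqr_ge0.
Qed.

Lemma normc_le_ReIm (z : C) : normc z <= `|complex.Re z| + `|complex.Im z|.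
Proof.
case: z => a b /=.
rewrite -[leRHS]ger0_norm ?addr_ge0// -[leRHS]sqrtr_sqr ler_wsqrtr//.
rewrite sqrrD !real_normK ?num_real// lerD2r lerDl mulrn_wge0// mulr_ge0//.
Qed.

(** Completeness of [ell2]: the limit is built coordinatewise, and [ell2_fatou]
    shows that it is square summable and close to every approximant [w]. *)
Lemma ell2_complete (T : Type) (G : set_system T) {FG : ProperFilter G}
  (f : T -> H) :
  (forall e : R, 0 < e -> exists w : H, \forall t \near G, rn (f t - w) <= e) ->
  exists l, tends G f l.
Proof.
move=> hf.
have coord (g : C -> R) (gB : forall z z', g (z - z') = g z - g z')
    (gn : forall z, `|g z| <= normc z) x : cvg (g (f t x) @[t --> G]).
  apply/cauchy_cvgP/cauchy_exP => e e0.
  have e2 : 0 < e / 2 by rewrite divr_gt0.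
  have [w hw] := hf _ e2; exists (g (w x)).
  apply: filterS hw => t ht; rewrite /ball/= distrC -gB.
  apply: le_lt_trans (gn _) _; apply: le_lt_trans (normc_le_ell2_rnorm (f t - w) x) _.
  by apply: le_lt_trans ht _; rewrite ltr_pdivrMr// ltr_pMr// ltr1n.
have ReB (z z' : C) : complex.Re (z - z') = complex.Re z - complex.Re z'.
  by case: z; case: z'.
have ImB (z z' : C) : complex.Im (z - z') = complex.Im z - complex.Im z'.
  by case: z; case: z'.
have cRe := coord _ ReB normc_Re; have cIm := coord _ ImB normc_Im.
pose v x : C := lim (complex.Re (f t x) @[t --> G]) +i*
  lim (complex.Im (f t x) @[t --> G]).
have hv x : normc (f t x - v x) @[t --> G] --> (0 : R).
  apply/cvgrPdist_le => e e0; have e2 : 0 < e / 2 by rewrite divr_gt0.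
  have /cvgrPdist_le/(_ _ e2) h1 := cRe x.
  have /cvgrPdist_le/(_ _ e2) h2 := cIm x.
  apply: filterS2 h1 h2 => t ht ht'.
  rewrite sub0r normrN ger0_norm ?normc_ge0//.
  apply: le_trans (normc_le_ReIm _) _.
  by rewrite ReB ImB distrC (distrC (complex.Im _)) [leRHS](splitr e) lerD.
have key (w : H) (M : R) : (\forall t \near G, rn (f t - w) <= M) ->
    forall F : set I, finite_set F ->
    \sum_(i <- fset_set F) normc (v i - w i) ^+ 2 <= M ^+ 2.
  move=> hw; apply: (ell2_fatou (v := fun i => v i - w i) _ hw) => x.
  have hx := hv x; apply: cvg_trans hx; apply: near_eq_cvg.
  by apply: nearW => t; rewrite ell2B opprB addrA subrK.
have sv : v \in square_summable.
  have [w hw] := hf _ ltr01.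
  rewrite (_ : v = (v - w) + w); last by rewrite subrK.
  rewrite rpredD ?ell2P//.
  exact: (square_summableW (key _ _ hw)).
exists (Ell2 sv) => e e0; have e2 : 0 < e / 2 by rewrite divr_gt0.
have [w hw] := hf _ e2.
apply: filterS (hw) => t ht.
apply: le_trans (rnorm_dist_triangle w _ _) _.
rewrite [leRHS](splitr e) lerD// rnorm_distC.
by apply: ell2_rnorm_le; [exact: ltW|exact: key].
Qed.

End ell2_basics.

(** * Inner products and bounded operators *)

Section ell2_inner.
Variables (R : realType) (I : choiceType).
Local Notation H := (ell2 R I).
Local Notation C := R[i].
Local Notation rn := (@ell2_rnorm R I).
Implicit Types (u v w f g : H) (x y : I).

Lemma restr_subproof (P : pred I) (u : H) :
  (fun x => if P x then u x else 0) \in square_summable.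
Proof.
apply: (square_summable_bounded (M := 1) (ell2P u)) => x.
by rewrite mul1r; case: ifP => // _; rewrite normc0 normc_ge0.
Qed.

Definition restr (P : pred I) u : H := Ell2 (restr_subproof P u).

Lemma restrE P u x : restr P u x = if P x then u x else 0. Proof. by []. Qed.

Lemma delta_subproof x : (fun y => (y == x)%:R : C) \in square_summable.
Proof.
apply: (square_summableW (M := 1)) => F finF.
have [xF|xF] := boolP (x \in fset_set F).
  rewrite (bigD1_seq x)//= eqxx normc1 expr1n big1 ?addr0//.
  by move=> y /negPf ->; rewrite normc0 expr0n.
rewrite big1_seq// => y /= yF; have [yx|] := eqVneq y x.
  by rewrite -yx yF in xF.
by rewrite normc0 expr0n.
Qed.

Definition delta x : H := Ell2 (delta_subproof x).

Lemma deltaE x y : delta x y = (y == x)%:R. Proof. by []. Qed.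

Lemma sqsum_approx u (e : R) : 0 < e -> exists s : {fset I},
  forall A : {fset I}, (s `<=` A)%fset ->
    `|rn u ^+ 2 - \sum_(i <- A) normc (u i) ^+ 2| <= e.
Proof.
move=> e0; have fu := square_summable_fin (ell2P u).
have [_ [F [finF _] <-] hF] := ub_ereal_sup_adherent e0 fu.
exists (fset_set F) => A FA.
have hA : \sum_(i <- A) normc (u i) ^+ 2 <= rn u ^+ 2.
  by have := ell2_rnorm_fset u (finite_fset A); rewrite set_fsetK.
rewrite ger0_norm ?subr_ge0// lerBlDr addrC -lerBlDr.
move: hF; have fuE := fineK fu.
rewrite fsbig_finite// sumEFin -[ereal_sup _]/(sqsum u) -[in (_ - _)%E]fuE -EFinB lte_fin.
rewrite -ell2_rnorm_sqr => /ltW/le_trans; apply.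
pose h i := if i \in fset_set F then normc (u i) ^+ 2 else 0.
rewrite (eq_big_seq h); last by move=> i iF; rewrite /h iF.
rewrite (@big_fset_incl _ _ _ _ _ _ h FA); last by move=> i _ /negPf; rewrite /h => ->.
by apply: ler_sum => i _; rewrite /h; case: ifP => // _; exact: sqr_ge0.
Qed.

Lemma delta_expansion u : tends (@summability.totally I)
  (fun A : {fset I} => \sum_(x <- A) u x *: delta x) u.
Proof.
move=> e e0; have [s hs] := sqsum_approx u (exprn_gt0 2 e0).
exists s => //= A sA; apply: ell2_rnorm_le => [|F finF]; first exact: ltW.
set w := _ - u.
have wE i : normc (w i) = if i \in A then 0 else normc (u i).
  rewrite ell2B ell2_sumE; case: ifPn => is_.
    rewrite (bigD1_seq i)// ell2Z deltaE eqxx mulr1 big1.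
      by rewrite /= addr0 subrr normc0.
    by move=> y yi; rewrite ell2Z deltaE eq_sym (negPf yi) mulr0.
  rewrite big1_seq ?sub0r ?normcN// => y /andP[_ ys]; rewrite ell2Z deltaE.
  by case: eqP ys => [<-|_ _]; [rewrite (negPf is_)|rewrite mulr0].
have : \sum_(i <- fset_set F) normc (w i) ^+ 2 <=
    \sum_(i <- (A `|` fset_set F)%fset) normc (w i) ^+ 2.
  pose h i := if i \in fset_set F then normc (w i) ^+ 2 else 0.
  rewrite (eq_big_seq h); last by move=> i iF; rewrite /h iF.
  rewrite (@big_fset_incl _ _ _ _ _ _ h (fsubsetUr A _)).
    by apply: ler_sum => i _; rewrite /h; case: ifP => // _; exact: sqr_ge0.
  by move=> i _ /negPf; rewrite /h => ->.
move=> /le_trans; apply.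
have := hs _ sA; rewrite ler_norml => /andP[_].
have : \sum_(i <- (A `|` fset_set F)%fset) normc (u i) ^+ 2 <= rn u ^+ 2.
  by have := ell2_rnorm_fset u (finite_fset (A `|` fset_set F)%fset); rewrite set_fsetK.
rewrite (_ : \sum_(i <- (A `|` _)%fset) normc (u i) ^+ 2 =
  \sum_(i <- (A `|` fset_set F)%fset) normc (w i) ^+ 2 +
  \sum_(i <- A) normc (u i) ^+ 2); first by lra.
pose h i := if i \in A then normc (u i) ^+ 2 else 0.
rewrite [in X in _ = _ + X](eq_big_seq h); last by move=> i iF; rewrite /h iF.
rewrite (@big_fset_incl _ _ _ _ _ _ h (fsubsetUl A (fset_set F))); last first.
  by move=> i _ /negPf; rewrite /h => ->.
rewrite -big_split; apply: eq_bigr => i _; rewrite wE /h.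
by case: ifP; rewrite ?expr0n /= ?add0r ?addr0.
Qed.

Lemma delta_dense u (e : R) : 0 < e -> exists s : {fset I},
  rn (u - \sum_(x <- s) u x *: delta x) <= e.
Proof.
move=> /(delta_expansion u)[s _ hs]; exists s.
by rewrite rnorm_distC; apply: hs => /=.
Qed.

(** The convergence behind [inner], with real epsilons. *)
Definition psum_to (h : I -> C) (z : C) := forall e : R, 0 < e ->
  exists s : {fset I}, forall A : {fset I}, (s `<=` A)%fset ->
    normc (z - \sum_(i <- A) h i) <= e.

Lemma psum_to_lim h z : psum_to h z -> summability.sum (h : I -> R[i]) = z.
Proof.
move=> hz; have FF := @summability.totally_filter I.
apply: cvg_lim; first exact: norm_hausdorff.
apply/cvgrPdist_le => -[e e'] /andP[/= /eqP -> {e'} e0].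
have [s hs] := hz _ e0; exists s => //= A sA.
have -> : summability.partial_sum h A = \sum_(i <- A) h i.
  by rewrite /summability.partial_sum big_seq_fsetE.
by rewrite lecR; exact: hs.
Qed.

Lemma psum_toD h k z z' : psum_to h z -> psum_to k z' ->
  psum_to (fun i => h i + k i) (z + z').
Proof.
move=> hz kz e e0; have e2 : 0 < e / 2 by rewrite divr_gt0.
have [s hs] := hz _ e2; have [t ht] := kz _ e2.
exists (s `|` t)%fset => A; rewrite fsubUset => /andP[sA tA].
rewrite big_split/= opprD addrACA; apply: le_trans (le_normcD _ _) _.
by rewrite [leRHS](splitr e) lerD ?hs ?ht.
Qed.

Lemma psum_toZ h c z : psum_to h z -> psum_to (fun i => c * h i) (c * z).
Proof.
move=> hz e e0; have c1 : 0 < normc c + 1 by rewrite ltr_pwDr// normc_ge0.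
have [s hs] := hz _ (divr_gt0 e0 c1).
exists s => A /hs; rewrite ler_pdivlMr// => hA.
rewrite -mulr_sumr -mulrBr normcM; apply: le_trans hA.
by rewrite mulrC ler_wpM2l ?normc_ge0// lerDl.
Qed.

Lemma normc_conj (z : C) : normc z^*%R = normc z.
Proof. by case: z => a b /=; rewrite sqrrN. Qed.

Lemma conj_real (r : R) : r%:C^*%R = r%:C.
Proof. exact: (conjc_real r). Qed.

Lemma psum_to_conj h z : psum_to h z -> psum_to (fun i => (h i)^*%R) z^*%R.
Proof.
move=> hz e /hz[s hs]; exists s => A /hs.
by rewrite -rmorph_sum -rmorphB normc_conj.
Qed.

Lemma psum_to_self u : psum_to (fun i => (u i)^*%R * u i) (rn u ^+ 2)%:C.
Proof.
move=> e /(sqsum_approx u)[s hs]; exists s => A /hs.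
rewrite (_ : \sum_(i <- A) _ = (\sum_(i <- A) normc (u i) ^+ 2)%:C).
  by rewrite -rmorphB /normc/= expr0n addr0 sqrtr_sqr.
rewrite (rmorph_sum (real_complex R)); apply: eq_bigr => i _.
by rewrite mulrC -sqr_normc -rmorphXn.
Qed.

(** By polarization the sum is a combination of the four square sums of
    [u + v], [u - v], [u + i v] and [u - i v], which converge. *)
Lemma inner_psum u v : psum_to (fun i => (u i)^*%R * v i) (inner u v).
Proof.
suff [z hz] : exists z, psum_to (fun i => (u i)^*%R * v i) z.
  by rewrite /inner (psum_to_lim hz).
have h1 := psum_to_self (u + v); have h2 := psum_to_self (u - v).
have h3 := psum_to_self (u + 'i *: v); have h4 := psum_to_self (u - 'i *: v).
have := psum_toD (psum_toZ (4^-1)%:C (psum_toD h1 (psum_toZ (-1) h2)))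
  (psum_toZ (0 -i* 4^-1) (psum_toD h3 (psum_toZ (-1) h4))).
set z := (X in psum_to _ X) => hz; exists z.
move: hz; congr psum_to; apply/funext => x.
rewrite !(ell2B, ell2D, ell2Z).
case: (u x) => a b; case: (v x) => c d.
by apply/eqP; rewrite eq_complex /=; apply/andP; split; apply/eqP; field.
Qed.

Lemma inner_unique u v z : psum_to (fun i => (u i)^*%R * v i) z -> inner u v = z.
Proof. exact: psum_to_lim. Qed.

Lemma innerDr u v w : inner u (v + w) = inner u v + inner u w.
Proof.
apply: inner_unique; have := psum_toD (inner_psum u v) (inner_psum u w).
by congr psum_to; apply/funext => x; rewrite ell2D mulrDr.
Qed.

Lemma innerZr c u v : inner u (c *: v) = c * inner u v.
Proof.
apply: inner_unique; have := psum_toZ c (inner_psum u v).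
by congr psum_to; apply/funext => x; rewrite ell2Z mulrCA.
Qed.

Lemma innerC u v : inner v u = (inner u v)^*%R.
Proof.
apply: inner_unique; have := psum_to_conj (inner_psum u v).
by congr psum_to; apply/funext => x; rewrite rmorphM /= conjCK mulrC.
Qed.

Lemma innerNr u v : inner u (- v) = - inner u v.
Proof. by rewrite -scaleN1r innerZr mulN1r. Qed.

Lemma innerBr u v w : inner u (v - w) = inner u v - inner u w.
Proof. by rewrite innerDr innerNr. Qed.

Lemma innerDl u v w : inner (v + w) u = inner v u + inner w u.
Proof. by rewrite innerC innerDr rmorphD /= -!innerC. Qed.

Lemma inner0l u : inner 0 u = 0.
Proof. by rewrite -(subrr (0 : H)) innerC innerBr subrr rmorph0. Qed.

Lemma innerZl c u v : inner (c *: u) v = c^*%R * inner u v.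
Proof. by rewrite innerC innerZr rmorphM /= -!innerC. Qed.

Lemma innerBl u v w : inner (v - w) u = inner v u - inner w u.
Proof. by rewrite innerC innerBr rmorphB /= -!innerC. Qed.

Lemma inner_suml (T : Type) (s : seq T) (f : T -> H) v :
  inner (\sum_(k <- s) f k) v = \sum_(k <- s) inner (f k) v.
Proof.
by elim/big_rec2: _ => [|k y1 y2 _ <-]; rewrite ?inner0l ?innerDl.
Qed.

Lemma inner_sumr (T : Type) (s : seq T) (f : T -> H) v :
  inner v (\sum_(k <- s) f k) = \sum_(k <- s) inner v (f k).
Proof.
rewrite innerC inner_suml rmorph_sum /=.
by apply: eq_bigr => k _; rewrite -innerC.
Qed.

Lemma inner_delta x v : inner (delta x) v = v x.
Proof.
apply: inner_unique => e e0; exists [fset x]%fset => A; rewrite fsub1set => xA.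
rewrite (bigD1_seq x)// deltaE eqxx conjC_nat mul1r big1.
  by rewrite /= addr0 subrr normc0 ltW.
by move=> y yx; rewrite deltaE (negPf yx) conjC_nat mul0r.
Qed.

Lemma inner_eq0 u : inner u u = 0 -> u = 0.
Proof.
rewrite inner_self => -[] /eqP; rewrite expf_eq0/= => /eqP.
exact: ell2_rnorm_eq0.
Qed.

Lemma Cauchy_Schwarz u v : normc (inner u v) <= rn u * rn v.
Proof.
have [->|v0] := eqVneq v 0.
  by rewrite -(scale0r 0) innerZr mul0r normc0 mulr_ge0 ?ell2_rnorm_ge0.
have b0 : 0 < rn v.
  by rewrite lt_neqAle ell2_rnorm_ge0 andbT eq_sym; apply: contra_neq v0 => /ell2_rnorm_eq0.
rewrite -(@ler_pXn2r _ 2)// ?nnegrE ?normc_ge0 ?mulr_ge0 ?ell2_rnorm_ge0//.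
set z := inner u v; set b := rn v ^+ 2.
have b20 : 0 < b by rewrite exprn_gt0.
have : 0 <= rn (b%:C *: u - z^*%R *: v) ^+ 2 by exact: sqr_ge0.
rewrite -lecR -inner_self !(innerBl, innerBr, innerZl, innerZr) !inner_self.
rewrite (innerC u v) -/z -/b conjCK conj_real.
have zz : z * z^*%R = (normc z ^+ 2)%:C by rewrite -sqr_normc -rmorphXn.
have -> : b%:C * (b%:C * (rn u ^+ 2)%:C) - b%:C * (z^*%R * z) -
    (z * (b%:C * z^*%R) - z * (z^*%R * b%:C)) =
    b%:C * (b%:C * (rn u ^+ 2)%:C - z * z^*%R) by ring.
rewrite zz -!(rmorphM, rmorphB) lecR pmulr_rge0// subr_ge0.
by rewrite exprMn mulrC.
Qed.

Definition blin (A : H -> H) :=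
  linear A /\ exists M : R, 0 <= M /\ forall u, rn (A u) <= M * rn u.

Lemma blinB A : blin A -> forall u v, A (u - v) = A u - A v.
Proof.
by move=> [lA _] u v; rewrite -scaleN1r addrC lA scaleN1r addrC.
Qed.

Lemma blinD A : blin A -> forall u v, A (u + v) = A u + A v.
Proof. move=> [lA _] u v. by have := lA 1 u v; rewrite !scale1r. Qed.

Lemma blin0 A : blin A -> A 0 = 0.
Proof. by move=> bA; have := blinB bA 0 0; rewrite !subrr. Qed.

Lemma blinZ A : blin A -> forall c u, A (c *: u) = c *: A u.
Proof.
by move=> bA c u; have [lA _] := bA; rewrite -[c *: u]addr0 lA (blin0 bA) addr0.
Qed.

Lemma blinN A : blin A -> forall u, A (- u) = - A u.
Proof. by move=> bA u; rewrite -scaleN1r (blinZ bA) scaleN1r. Qed.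

Lemma blin_sum A (T : Type) (s : seq T) (P : pred T) (f : T -> H) : blin A ->
  A (\sum_(i <- s | P i) f i) = \sum_(i <- s | P i) A (f i).
Proof.
move=> bA; elim/big_rec2: _ => [|i y1 y2 _ <-]; first exact: blin0.
by rewrite (blinD bA).
Qed.

Lemma blin_tends (T : Type) (F : set_system T) {FF : ProperFilter F} A
    (f : T -> H) l : blin A -> tends F f l -> tends F (fun t => A (f t)) (A l).
Proof.
move=> bA; have [_ [M [_ hM]]] := bA.
by apply: (tends_bounded (M := M)) hM; exact: blinB.
Qed.

Lemma blin_id : blin (fun u => u).
Proof. by split=> //; exists 1; split=> // u; rewrite mul1r. Qed.

Lemma blin_zero : blin (fun=> 0).
Proof.
split=> [a u v|]; first by rewrite scaler0 addr0.
by exists 0; split=> // u; rewrite mul0r rnorm0.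
Qed.

Lemma blin_add A B : blin A -> blin B -> blin (fun u => A u + B u).
Proof.
move=> [lA [M [M0 hM]]] [lB [N [N0 hN]]]; split=> [a u v|].
  by rewrite lA lB scalerDr addrACA.
exists (M + N); split=> [|u]; first by rewrite addr_ge0.
by apply: le_trans (ell2_rnormD _ _) _; rewrite mulrDl lerD.
Qed.

Lemma blin_scale c A : blin A -> blin (fun u => c *: A u).
Proof.
move=> [lA [M [M0 hM]]]; split=> [a u v|].
  by rewrite lA scalerDr !scalerA mulrC.
exists (normc c * M); split=> [|u]; first by rewrite mulr_ge0 ?normc_ge0.
by rewrite ell2_rnormZ -mulrA ler_wpM2l ?normc_ge0.
Qed.

Lemma blin_comp A B : blin A -> blin B -> blin (fun u => A (B u)).
Proof.
move=> [lA [M [M0 hM]]] [lB [N [N0 hN]]]; split=> [a u v|]; first by rewrite lB lA.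
exists (M * N); split=> [|u]; first by rewrite mulr_ge0.
by apply: le_trans (hM _) _; rewrite -mulrA ler_wpM2l.
Qed.

Lemma blin_opp A : blin A -> blin (fun u => - A u).
Proof.
by move=> /(blin_scale (-1)); under eq_fun do rewrite scaleN1r.
Qed.

Lemma blin_sub A B : blin A -> blin B -> blin (fun u => A u - B u).
Proof. by move=> bA /blin_opp; exact: blin_add. Qed.

Lemma blin_bigsum (T : Type) (s : seq T) (P : pred T) (A : T -> H -> H) :
  (forall i, P i -> blin (A i)) -> blin (fun u => \sum_(i <- s | P i) A i u).
Proof.
move=> bA; elim: s => [|i s IH].
  by under eq_fun do rewrite big_nil; exact: blin_zero.
case Pi: (P i); under eq_fun do rewrite big_cons Pi; last exact: IH.
exact: blin_add (bA _ Pi) IH.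
Qed.

Lemma blin_iter A n : blin A -> blin (iter n A).
Proof. by move=> bA; elim: n => [|n IH]; [exact: blin_id|exact: blin_comp]. Qed.

Lemma blin_restr P : blin (restr P).
Proof.
split=> [a u v|]; first apply: ell2_inj => x.
  by rewrite ell2D ell2Z !restrE; case: ifP => // _; rewrite mulr0 addr0.
exists 1; split=> // u; rewrite mul1r; apply: ell2_rnorm_le => [|F finF].
  exact: ell2_rnorm_ge0.
apply: le_trans (ell2_rnorm_fset u finF); apply: ler_sum => i _.
by rewrite restrE; case: ifP => // _; rewrite normc0 expr0n sqr_ge0.
Qed.

(** The basis vectors span a dense subspace, on which [F] vanishes. *)
Lemma functional_eq0 (F : H -> C) (M : R) :
  (forall u v, F (u + v) = F u + F v) -> (forall c u, F (c *: u) = c * F u) ->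
  (forall u, normc (F u) <= M * rn u) -> (forall x, F (delta x) = 0) ->
  forall u, F u = 0.
Proof.
move=> FD FZ FM F0 u; apply: eq0_normc; apply/eqP.
rewrite eq_le normc_ge0 andbT; apply/ler_addgt0Pl => e e0; rewrite addr0.
have M1 : 0 < `|M| + 1 by rewrite ltr_pwDr.
have [s hs] := delta_dense u (divr_gt0 e0 M1).
have Fs : F (\sum_(x <- s) u x *: delta x) = 0.
  have F00 : F 0 = 0 by have := FZ 0 0; rewrite scale0r mul0r.
  elim/big_rec: _ => // i v _ hv.
  by rewrite FD FZ F0 mulr0 add0r.
have -> : F u = F (u - \sum_(x <- s) u x *: delta x).
  by rewrite FD -scaleN1r FZ Fs mulr0 addr0.
apply: le_trans (FM _) _; move: hs; rewrite ler_pdivlMr// => /(le_trans _); apply.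
by rewrite mulrC ler_wpM2l ?ell2_rnorm_ge0// (le_trans (ler_norm _))// lerDl.
Qed.

Lemma blin_ext A B : blin A -> blin B ->
  (forall x, A (delta x) = B (delta x)) -> forall u, A u = B u.
Proof.
move=> bA bB AB u; apply: ell2_inj => x.
have bAB := blin_sub bA bB; have [_ [M [_ hM]]] := bAB.
suff : A u x - B u x = 0 by move/eqP; rewrite subr_eq0 => /eqP.
apply: (functional_eq0 (F := fun u => A u x - B u x) (M := M)) => [v w|c v|v|y].
- by rewrite (blinD bA) (blinD bB) !ell2D opprD addrACA.
- by rewrite (blinZ bA) (blinZ bB) !ell2Z mulrBr.
- exact: le_trans (normc_le_ell2_rnorm (A v - B v) x) (hM v).
- by rewrite AB subrr.
Qed.

(** Both sides are bounded functionals of [v] for a basis vector [u], and then of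
    [u] for any [v]; so [functional_eq0] applies twice. *)
Lemma adjoint_entries A B : blin A -> blin B ->
  (forall x y, A (delta y) x = (B (delta x) y)^*%R) ->
  forall u v, inner (A u) v = inner u (B v).
Proof.
move=> bA bB AB u v.
have [_ [M [M0 hM]]] := bA; have [_ [N [N0 hN]]] := bB.
have h1 y w : inner (A (delta y)) w = inner (delta y) (B w).
  apply/eqP; rewrite -subr_eq0; apply/eqP.
  apply: (functional_eq0 (F := fun w => inner (A (delta y)) w - inner (delta y) (B w))
    (M := M * rn (delta y) + rn (delta y) * N)) => [w1 w2|c w1|w1|x].
  - by rewrite (blinD bB) !innerDr opprD addrACA.
  - by rewrite (blinZ bB) !innerZr mulrBr.
  - apply: le_trans (le_normcD _ _) _; rewrite normcN mulrDl; apply: lerD.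
      apply: le_trans (Cauchy_Schwarz _ _) _.
      by rewrite ler_wpM2r ?ell2_rnorm_ge0.
    apply: le_trans (Cauchy_Schwarz _ _) _.
    by rewrite -mulrA ler_wpM2l ?ell2_rnorm_ge0.
  - by rewrite inner_delta innerC inner_delta AB conjCK subrr.
have : inner v (A u) - inner (B v) u = 0.
  apply: (functional_eq0 (F := fun u => inner v (A u) - inner (B v) u)
    (M := rn v * M + rn (B v))) => [w1 w2|c w1|w1|x].
  - by rewrite (blinD bA) !innerDr opprD addrACA.
  - by rewrite (blinZ bA) !innerZr mulrBr.
  - apply: le_trans (le_normcD _ _) _; rewrite normcN mulrDl; apply: lerD.
      apply: le_trans (Cauchy_Schwarz _ _) _.
      by rewrite -mulrA ler_wpM2l ?ell2_rnorm_ge0.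
    exact: Cauchy_Schwarz.
  - by rewrite innerC h1 -innerC subrr.
move/eqP; rewrite subr_eq0 => /eqP h.
by rewrite innerC h -innerC.
Qed.

End ell2_inner.
Arguments delta {R I} x.
Arguments blin_restr {R I} P.

(** * The unitary group of a bounded operator *)

(** The Cauchy product: a square of index pairs is cut along the antidiagonal, and
    the part below it is summed by diagonals. *)
Lemma sum_square_triangle (V : zmodType) (G : nat -> nat -> V) (n : nat) :
  \sum_(0 <= j < n) \sum_(0 <= l < n) G j l =
  \sum_(0 <= k < n) \sum_(0 <= j < k.+1) G j (k - j)%N +
  \sum_(0 <= j < n) \sum_(n - j <= l < n) G j l.
Proof.
have -> : \sum_(0 <= k < n) \sum_(0 <= j < k.+1) G j (k - j)%N =
    \sum_(0 <= j < n) \sum_(0 <= l < n - j) G j l.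
  transitivity (\sum_(0 <= k < n) \sum_(0 <= j < n | (j <= k)%N) G j (k - j)%N).
    by apply: eq_big_nat => k /andP[_ kn]; rewrite (@big_nat_widen _ _ _ 0 k.+1 n predT)//=.
  rewrite (exchange_big_dep_nat predT)//=; apply: eq_big_nat => j /andP[_ jn].
  rewrite -(@big_nat_widenl _ _ _ j 0 n predT)// -[X in \sum_(X <= _ < _) _]add0n.
  by rewrite big_addn; apply: eq_bigr => i _; rewrite addnK.
rewrite -big_split /=; apply: eq_big_nat => j /andP[_ jn].
by rewrite -big_cat_nat// leq_subr.
Qed.

Lemma exp_coeffD (F : numFieldType) (x y : F) (k : nat) :
  (x + y) ^+ k / k`!%:R =
  \sum_(0 <= j < k.+1) (x ^+ j / j`!%:R) * (y ^+ (k - j) / (k - j)`!%:R).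
Proof.
rewrite addrC exprDn mulr_suml big_mkord; apply: eq_bigr => -[j /= jk] _.
have f0 m : (m`!%:R : F) != 0 by rewrite pnatr_eq0 -lt0n fact_gt0.
have b0 : ('C(k, j)%:R : F) != 0 by rewrite pnatr_eq0 -lt0n bin_gt0.
have jk' : (j <= k)%N by [].
rewrite -(bin_fact jk') !natrM -mulr_natr; field.
by rewrite !f0 b0.
Qed.

Section operator_exponential.
Variables (R : realType) (I : choiceType).
Local Notation H := (ell2 R I).
Local Notation C := R[i].
Local Notation rn := (@ell2_rnorm R I).
Implicit Types (u v w : H) (s t : R).

Lemma exp_coeff_ge0 (y : R) n : 0 <= y -> 0 <= exp_coeff y n.
Proof. by move=> y0; rewrite /exp_coeff/= divr_ge0// exprn_ge0. Qed.

Lemma series_exp_le (y : R) n : 0 <= y -> series (exp_coeff y) n <= expR y.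
Proof.
move=> y0; apply: nondecreasing_cvgn_le; last exact: is_cvg_series_exp_coeff.
apply/nondecreasing_seqP => k.
by rewrite /series/= big_nat_recr//= lerDl exp_coeff_ge0.
Qed.

Lemma series_exp_cvg (y : R) : series (exp_coeff y) @ \oo --> expR y.
Proof. exact: is_cvg_series_exp_coeff. Qed.

Lemma series_tends (f : nat -> H) (K y : R) : 0 <= y -> 0 <= K ->
  (forall n, rn (f n) <= K * exp_coeff y n) ->
  exists l, tends \oo (series f) l.
Proof.
move=> y0 K0 fK; apply: ell2_complete => e e0.
have K1 : 0 < K + 1 by rewrite ltr_pwDr.
have /cvgrPdist_le/(_ _ (divr_gt0 e0 K1))[N _ hN] := @series_exp_cvg y.
exists (series f N); exists N => //= n /= Nn.
rewrite sub_series_geq//; apply: le_trans (rnorm_sum _ _ _) _.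
apply: (@le_trans _ _ (\sum_(N <= k < n) K * exp_coeff y k)).
  by apply: ler_sum => k _; exact: fK.
rewrite -mulr_sumr -sub_series_geq//.
have := hN N (leqnn N) => /=; rewrite ler_pdivlMr// ger0_norm; last first.
  by rewrite subr_ge0 series_exp_le.
apply: le_trans; rewrite [leLHS]mulrC; apply: ler_pM.
- rewrite subr_ge0; apply: (nondecreasing_seqP (series (exp_coeff y))).1 => // k.
  by rewrite /series/= big_nat_recr//= lerDl exp_coeff_ge0.
- exact: K0.
- by rewrite lerD2r series_exp_le.
- by rewrite lerDl.
Qed.

Variables (J : H -> H).
Hypothesis bJ : blin J.
Variable M : R.
Hypothesis M1 : 1 <= M.
Hypothesis JM : forall u, rn (J u) <= M * rn u.

Let M0 : 0 <= M. Proof. exact: le_trans M1. Qed.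

Local Notation U := (unitary_group J).

Definition expsum (t : R) (n : nat) (v : H) : H :=
  \sum_(0 <= k < n) ((0 +i* t) ^+ k / k`!%:R) *: iter k J v.

Lemma expsumE t n v : expsum t n v =
  series (fun n => (n`!%:R : C)^-1 *: iter n (fun v => (0 +i* t) *: J v) v) n.
Proof.
apply: eq_bigr => k _; rewrite mulrC -scalerA; congr (_ *: _).
elim: k => [|k IH]; first by rewrite expr0 scale1r.
by rewrite !iterS -IH (blinZ bJ) scalerA -exprS.
Qed.

Lemma rnorm_iter n v : rn (iter n J v) <= M ^+ n * rn v.
Proof.
elim: n => [|n IH]; first by rewrite mul1r.
by rewrite iterS exprS -mulrA; apply: le_trans (JM _) _; rewrite ler_wpM2l.
Qed.

Lemma normc_expcoef t n : normc ((0 +i* t) ^+ n / n`!%:R) = `|t| ^+ n / n`!%:R.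
Proof.
rewrite normcM normcV; congr (_ / _).
  elim: n => [|n IH]; first by rewrite !expr0 normc1.
  rewrite !exprS normcM IH; congr (_ * _).
  by rewrite /normc/= expr0n add0r sqrtr_sqr.
by rewrite -[n`!%:R]mulr1n -mulrnA normcMn normc1 mulrnA mulr1n.
Qed.

Lemma rnorm_expterm t n v : rn (((0 +i* t) ^+ n / n`!%:R) *: iter n J v) <=
  rn v * exp_coeff (`|t| * M) n.
Proof.
rewrite ell2_rnormZ normc_expcoef /exp_coeff/= exprMn.
apply: le_trans (ler_wpM2l _ (rnorm_iter n v)) _.
  by rewrite divr_ge0// exprn_ge0.
rewrite le_eqVlt; apply/orP; left; apply/eqP; ring.
Qed.

Lemma expsum_tends t v : tends \oo (fun n => expsum t n v) (U t v).
Proof.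
have [l hl] := series_tends (mulr_ge0 (normr_ge0 t) M0) (ell2_rnorm_ge0 v)
  (rnorm_expterm t ^~ v).
suff -> : U t v = l by [].
apply: cvg_lim; first exact: norm_hausdorff.
apply/tends_cvg => e /hl; apply: filterS => n.
by rewrite -expsumE.
Qed.

Lemma rnorm_expsum t n v : rn (expsum t n v) <= expR (`|t| * M) * rn v.
Proof.
apply: le_trans (rnorm_sum _ _ _) _.
apply: le_trans (ler_sum _ (fun k _ => rnorm_expterm t k v)) _.
rewrite -mulr_sumr mulrC ler_wpM2r ?ell2_rnorm_ge0// series_exp_le//.
by rewrite mulr_ge0.
Qed.

Lemma blin_expsum t n : blin (expsum t n).
Proof. by apply: blin_bigsum => k _; apply: blin_scale; exact: blin_iter. Qed.

Lemma blin_U t : blin (U t).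
Proof.
split=> [a u v|].
  apply: (@tends_unique _ _ _ \oo _ (fun n => expsum t n (a *: u + v))).
    exact: expsum_tends.
  have lS n : linear (expsum t n) by have [] := blin_expsum t n.
  under eq_fun => n do rewrite lS.
  by apply: tendsD; [apply: tendsZ|]; exact: expsum_tends.
exists (expR (`|t| * M)); split=> [|u]; first exact: expR_ge0.
apply: tends_rnorm_le (expsum_tends t u) _.
by apply: nearW => n; exact: rnorm_expsum.
Qed.

Lemma U_comm A t v : blin A -> (forall u, A (J u) = J (A u)) ->
  A (U t v) = U t (A v).
Proof.
move=> bA AJ; apply: (@tends_unique _ _ _ \oo _ (fun n => A (expsum t n v))).
  exact: blin_tends bA (expsum_tends t v).
suff -> : (fun n => A (expsum t n v)) = expsum t ^~ (A v) by exact: expsum_tends.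
apply/funext => n; rewrite (blin_sum _ _ _ bA); apply: eq_bigr => k _.
rewrite (blinZ bA); congr (_ *: _).
by elim: k => //= k IH; rewrite AJ IH.
Qed.

Lemma iter_comm_expsum t n u k : iter k J (expsum t n u) =
  \sum_(0 <= l < n) ((0 +i* t) ^+ l / l`!%:R) *: iter (k + l) J u.
Proof.
rewrite (blin_sum _ _ _ (blin_iter k bJ)); apply: eq_bigr => l _.
by rewrite (blinZ (blin_iter k bJ)) -iterD.
Qed.

(** The difference of the product of two partial sums and of the partial sum of
    the product is the part of the Cauchy product above the antidiagonal. Its
    terms are bounded by those for the scalars [`|t| * M] and [`|s| * M], for
    which the difference is known to tend to zero. *)
Lemma expsum_mul_dist s t n u : rn (expsum t n (expsum s n u) - expsum (t + s) n u) <=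
  (series (exp_coeff (`|t| * M)) n * series (exp_coeff (`|s| * M)) n -
   series (exp_coeff (`|t| * M + `|s| * M)) n) * rn u.
Proof.
pose G j l := (((0 +i* t) ^+ j / j`!%:R) * ((0 +i* s) ^+ l / l`!%:R)) *: iter (j + l) J u.
have -> : expsum t n (expsum s n u) = \sum_(0 <= j < n) \sum_(0 <= l < n) G j l.
  apply: eq_bigr => j _; rewrite iter_comm_expsum scaler_sumr.
  by apply: eq_bigr => l _; rewrite scalerA.
have -> : expsum (t + s) n u =
    \sum_(0 <= k < n) \sum_(0 <= j < k.+1) G j (k - j)%N.
  apply: eq_bigr => k _; rewrite (_ : 0 +i* (t + s) = (0 +i* t) + (0 +i* s)).
    rewrite exp_coeffD scaler_suml; apply: eq_big_nat => j /andP[_ jk].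
    by rewrite /G subnKC.
  by apply/eqP; rewrite eq_complex/= addr0 !eqxx.
rewrite sum_square_triangle addrAC subrr add0r.
pose g j l := exp_coeff (`|t| * M) j * exp_coeff (`|s| * M) l.
have -> : series (exp_coeff (`|t| * M)) n * series (exp_coeff (`|s| * M)) n =
    \sum_(0 <= j < n) \sum_(0 <= l < n) g j l.
  by rewrite mulr_suml; apply: eq_bigr => j _; rewrite mulr_sumr.
have -> : series (exp_coeff (`|t| * M + `|s| * M)) n =
    \sum_(0 <= k < n) \sum_(0 <= j < k.+1) g j (k - j)%N.
  by apply: eq_bigr => k _; rewrite /exp_coeff/= exp_coeffD.
rewrite sum_square_triangle addrAC subrr add0r mulr_suml.
apply: le_trans (rnorm_sum _ _ _) _; apply: ler_sum => j _.
rewrite mulr_suml.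
apply: le_trans (rnorm_sum _ _ _) _; apply: ler_sum => l _.
rewrite /G /g ell2_rnormZ normcM !normc_expcoef /exp_coeff/= !exprMn.
apply: le_trans (ler_wpM2l _ (rnorm_iter (j + l) u)) _.
  by rewrite mulr_ge0// divr_ge0// exprn_ge0.
rewrite exprD le_eqVlt; apply/orP; left; apply/eqP; ring.
Qed.

Lemma U_add s t u : U t (U s u) = U (t + s) u.
Proof.
have h : tends \oo (fun n => expsum t n (expsum s n u)) (U (t + s) u).
  have h0 : tends \oo (fun n => expsum t n (expsum s n u) - expsum (t + s) n u) 0.
    apply: (tends_squeeze (g := fun n => (series (exp_coeff (`|t| * M)) n *
       series (exp_coeff (`|s| * M)) n -
       series (exp_coeff (`|t| * M + `|s| * M)) n) * rn u)).
      by apply: nearW => n; rewrite subr0 expsum_mul_dist.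
    rewrite -[X in _ --> X](mul0r (rn u)); apply: cvgM; last exact: cvg_cst.
    rewrite -[X in _ --> X](subrr (expR (`|t| * M + `|s| * M))).
    apply: cvgB; last exact: series_exp_cvg.
    by rewrite [X in _ --> X]expRD; apply: cvgM; exact: series_exp_cvg.
  rewrite -[U _ _]add0r; apply: eq_tends (tendsD h0 (expsum_tends (t + s) u)) => n.
  by rewrite subrK.
apply: (@tends_unique _ _ _ \oo _ _ _ _) h.
have h0 : tends \oo (fun n => expsum t n (expsum s n u - U s u)) 0.
  apply: (tends_squeeze (g := fun n => expR (`|t| * M) * rn (expsum s n u - U s u))).
    by apply: nearW => n; rewrite subr0 rnorm_expsum.
  rewrite -[X in _ --> X](mulr0 (expR (`|t| * M))); apply: cvgM; first exact: cvg_cst.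
  apply/cvgrPdist_le => e /(expsum_tends s u); apply: filterS => n.
  by rewrite sub0r normrN ger0_norm ?ell2_rnorm_ge0.
rewrite -[U t _]add0r; apply: eq_tends (tendsD h0 (expsum_tends t (U s u))) => n.
by rewrite (blinB (blin_expsum t n)) subrK.
Qed.

Lemma U0 u : U 0 u = u.
Proof.
apply: (@tends_unique _ _ _ \oo _ _ _ _) (expsum_tends 0 u) _ => e e0.
exists 1%N => //= n /= n0; rewrite /expsum big_ltn// big1_seq ?addr0.
  by rewrite expr0 fact0 divr1 scale1r subrr rnorm0 ltW.
move=> k /andP[_]; rewrite mem_index_iota => /andP[k0 _].
by rewrite (_ : 0 +i* 0 = 0)// expr0n -[_ == _]negbK -lt0n k0 mul0r scale0r.
Qed.

Lemma UK t u : U t (U (- t) u) = u.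
Proof. by rewrite U_add subrr U0. Qed.

Lemma NUK t u : U (- t) (U t u) = u.
Proof. by rewrite U_add addNr U0. Qed.

Hypothesis Jsym : forall u v, inner (J u) v = inner u (J v).

Lemma inner_tends (T : Type) (F : set_system T) {FF : ProperFilter F}
  (f g : T -> H) l l' u v : tends F f l -> tends F g l' ->
  (\forall t \near F, inner (f t) v = inner u (g t)) -> inner l v = inner u l'.
Proof.
move=> fl gl fg; apply/eqP; rewrite -subr_eq0; apply/eqP/eq0_normc/eqP.
rewrite eq_le normc_ge0 andbT; apply/ler_addgt0Pl => e e0; rewrite addr0.
have p0 : 0 < rn u + rn v + 1 by rewrite ltr_pwDr// addr_ge0 ?ell2_rnorm_ge0.
have d0 := divr_gt0 e0 p0.
have [t [[ht ht'] hE]] := filter_ex (filterI (filterI (fl _ d0) (gl _ d0)) fg).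
have -> : inner l v - inner u l' = inner u (g t - l') - inner (f t - l) v.
  by rewrite innerBr innerBl hE opprB [RHS]addrC addrA subrK.
apply: le_trans (le_normcD _ _) _; rewrite normcN.
apply: (@le_trans _ _ ((rn u + rn v + 1) * (e / (rn u + rn v + 1)))); last first.
  by rewrite mulrCA divff ?mulr1// gt_eqF.
rewrite !mulrDl mul1r -[leLHS]addr0; apply: lerD; last exact: ltW.
apply: lerD.
  by apply: le_trans (Cauchy_Schwarz _ _) _; rewrite ler_wpM2l ?ell2_rnorm_ge0.
by apply: le_trans (Cauchy_Schwarz _ _) _; rewrite mulrC ler_wpM2l ?ell2_rnorm_ge0.
Qed.

Lemma U_adjoint t u v : inner (U t u) v = inner u (U (- t) v).
Proof.
apply: (inner_tends (F := \oo)) (expsum_tends t u) (expsum_tends (- t) v) _.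
apply: nearW => n; rewrite /expsum.
rewrite inner_suml inner_sumr; apply: eq_bigr => k _.
rewrite innerZl innerZr; congr (_ * _).
  by rewrite rmorphM rmorphXn fmorphV /= conjC_nat; congr (_ ^+ _ / _).
by elim: k v => //= k IH v; rewrite Jsym IH -iterSr.
Qed.

Lemma rnorm_U t u : rn (U t u) = rn u.
Proof.
apply/eqP; rewrite -(@eqrXn2 _ 2)// ?ell2_rnorm_ge0//.
apply/eqP; have := inner_self (U t u).
by rewrite U_adjoint NUK inner_self => -[].
Qed.

End operator_exponential.

(** * The asymptotic velocity of a multiplication operator *)

Section bounded_extension.
Variables (R : realType) (I : choiceType).
Local Notation H := (ell2 R I).
Local Notation C := R[i].
Local Notation rn := (@ell2_rnorm R I).
Implicit Types (u v w : H).

Variables (D : set H) (T : H -> H) (K : R).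
Hypothesis K0 : 0 <= K.
Hypothesis D0 : D 0.
Hypothesis Dlin : forall a u v, D u -> D v -> D (a *: u + v).
Hypothesis Ddelta : forall x, D (delta x).
Hypothesis Tlin : forall a u v, D u -> D v -> T (a *: u + v) = a *: T u + T v.
Hypothesis TK : forall u, D u -> rn (T u) <= K * rn u.

Local Notation approx u := (fun A : {fset I} => \sum_(x <- A) u x *: delta x).
Local Notation tot := (@summability.totally I).

Lemma dom_approx u A : D (approx u A).
Proof.
rewrite /=; elim/big_rec: _ => [|x v _ Dv]; first exact: D0.
exact: Dlin.
Qed.

Lemma dom_sub u v : D u -> D v -> D (u - v).
Proof. by move=> Du Dv; rewrite addrC -scaleN1r; exact: Dlin. Qed.

Lemma T_sub u v : D u -> D v -> T (u - v) = T u - T v.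
Proof. by move=> Du Dv; rewrite addrC -scaleN1r Tlin// scaleN1r addrC. Qed.

Lemma T_tends u v : D v -> tends tot (approx u) v ->
  tends tot (fun A => T (approx u A)) (T v).
Proof.
move=> Dv h e e0; have FF := @summability.totally_filter I.
have K1 : 0 < K + 1 by rewrite ltr_pwDr.
apply: filterS (h _ (divr_gt0 e0 K1)) => A; rewrite ler_pdivlMr// => hA.
rewrite -T_sub//; last exact: dom_approx.
apply: le_trans (TK (dom_sub (dom_approx u A) Dv)) _.
by apply: le_trans hA; rewrite mulrC ler_wpM2l ?ell2_rnorm_ge0// lerDl.
Qed.

(** The finite truncations of [u] lie in [D] and tend to [u], so [Q u] can be
    defined as the limit of the values of [T] on them. *)
Lemma bounded_extension : exists Q : H -> H, blin Q /\ forall u, D u -> Q u = T u.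
Proof.
have FF := @summability.totally_filter I.
have K1 : 0 < K + 1 by rewrite ltr_pwDr.
have ex u : exists l, tends tot (fun A => T (approx u A)) l.
  apply: ell2_complete => e e0.
  have e2 : 0 < e / (K + 1) / 2 by rewrite !divr_gt0.
  have hu := delta_expansion u e2.
  have [B hB] := filter_ex hu.
  exists (T (approx u B)); apply: filterS hu => A hA.
  rewrite -T_sub; try exact: dom_approx.
  apply: le_trans (TK (dom_sub (dom_approx u A) (dom_approx u B))) _.
  apply: (@le_trans _ _ ((K + 1) * (e / (K + 1)))); last first.
    by rewrite mulrCA divff ?mulr1// gt_eqF.
  apply: ler_pM => //; [exact: ell2_rnorm_ge0|by rewrite lerDl|].
  apply: le_trans (rnorm_dist_triangle u _ _) _.
  rewrite [leRHS](splitr (e / (K + 1))); apply: lerD; first exact: hA.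
  by rewrite rnorm_distC; exact: hB.
have [Q hQ] := choice ex; exists Q; split; last first.
  move=> u Du; apply: tends_unique (hQ u) _.
  by apply: T_tends => //; exact: delta_expansion.
split=> [a u v|].
  apply: tends_unique (hQ _) _.
  apply: eq_tends (tendsD (tendsZ a (hQ u)) (hQ v)) => A.
  rewrite -Tlin; try exact: dom_approx.
  congr T; rewrite scaler_sumr -big_split; apply: eq_bigr => x _.
  by rewrite [RHS](_ : _ = (a * u x + v x) *: delta x)// scalerDl scalerA.
exists K; split=> // u.
apply/ler_addgt0Pr => e e0.
apply: tends_rnorm_le (hQ u) _.
apply: filterS (delta_expansion u (divr_gt0 e0 K1)) => A.
rewrite ler_pdivlMr// => hA; apply: le_trans (TK (dom_approx u A)) _.
rewrite -lerBlDl -mulrBr; apply: le_trans hA.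
rewrite mulrC; apply: (@le_trans _ _ (rn (approx u A - u) * K)).
  rewrite ler_wpM2r// lerBlDr; apply: le_trans (ell2_rnormD _ _).
  by rewrite subrK.
by rewrite ler_wpM2l ?ell2_rnorm_ge0// lerDl.
Qed.

End bounded_extension.

Section position_evolution.
Variables (R : realType) (I : choiceType).
Local Notation H := (ell2 R I).
Local Notation C := R[i].
Local Notation rn := (@ell2_rnorm R I).
Implicit Types (u v w : H) (s t : R).

Variable m : I -> C.
Hypothesis mreal : forall x, (m x)^*%R = m x.

Definition mulfun (u : I -> C) x := m x * u x.
Definition dom : set H := [set u : H | mulfun u \in square_summable].
Definition X (u : H) : H := insubd 0 (mulfun u).

Lemma XE u x : dom u -> X u x = m x * u x.
Proof. by move=> du; rewrite -[LHS]/(val (insubd 0 _) x) insubdK. Qed.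

Lemma dom_lin a u v : dom u -> dom v -> dom (a *: u + v).
Proof.
rewrite /dom/= => du dv; have := rpredD (rpredZ a du) dv.
rewrite (_ : mulfun (a *: u + v) = a *: mulfun u + mulfun v)//.
by apply/funext => x; rewrite /mulfun ell2D ell2Z mulrDr mulrCA.
Qed.

Lemma X_lin a u v : dom u -> dom v -> X (a *: u + v) = a *: X u + X v.
Proof.
move=> du dv; apply: ell2_inj => x.
rewrite XE; last exact: dom_lin.
by rewrite !ell2D !ell2Z !XE// mulrDr mulrCA.
Qed.

Lemma dom0 : dom 0.
Proof.
rewrite /dom/= (_ : mulfun _ = (0 : H))//; first exact: ell2P.
by apply/funext => x; rewrite /mulfun !ell20 mulr0.
Qed.

Lemma X0 : X 0 = 0.
Proof. by apply: ell2_inj => x; rewrite XE ?ell20 ?mulr0//; exact: dom0. Qed.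

Lemma domD u v : dom u -> dom v -> dom (u + v).
Proof. by move=> du dv; have := dom_lin 1 du dv; rewrite scale1r. Qed.

Lemma domZ a u : dom u -> dom (a *: u).
Proof. by move=> du; rewrite -[_ *: _]addr0; exact: dom_lin du dom0. Qed.

Lemma domB u v : dom u -> dom v -> dom (u - v).
Proof. by move=> du dv; have := dom_lin (-1) dv du; rewrite scaleN1r addrC. Qed.

Lemma XD u v : dom u -> dom v -> X (u + v) = X u + X v.
Proof. by move=> du dv; have := X_lin 1 du dv; rewrite !scale1r. Qed.

Lemma XZ a u : dom u -> X (a *: u) = a *: X u.
Proof. by move=> du; have := X_lin a du dom0; rewrite X0 !addr0. Qed.

Lemma dom_sum (T : Type) (s : seq T) (P : pred T) (f : T -> H) :
  (forall k, P k -> dom (f k)) -> dom (\sum_(k <- s | P k) f k).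
Proof.
move=> df; elim: s => [|k s IH]; first by rewrite big_nil; exact: dom0.
rewrite big_cons; case: ifPn => // Pk; apply: domD => //; exact: df.
Qed.

Lemma X_sum (T : Type) (s : seq T) (P : pred T) (f : T -> H) :
  (forall k, P k -> dom (f k)) ->
  X (\sum_(k <- s | P k) f k) = \sum_(k <- s | P k) X (f k).
Proof.
move=> df; elim: s => [|k s IH]; first by rewrite !big_nil X0.
rewrite !big_cons; case: ifPn => // Pk.
by rewrite XD ?IH//; [exact: df|exact: dom_sum].
Qed.

Lemma dom_delta x : dom (delta x).
Proof.
rewrite /dom/= (_ : mulfun _ = (m x *: delta x : H)); first exact: ell2P.
apply/funext => y; rewrite ell2Z /mulfun deltaE.
by case: eqP => [->|]; rewrite ?mulr0.
Qed.

Lemma X_sym u v : dom u -> dom v -> inner (X u) v = inner u (X v).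
Proof.
move=> du dv; rewrite /inner; congr summability.sum; apply/funext => x.
by rewrite !XE// rmorphM/= mreal mulrCA mulrA.
Qed.

(** A norm limit is a limit in each coordinate [x], where multiplication by [m x]
    is continuous. Closedness is what carries [X] through the exponential series. *)
Lemma X_closed (T : Type) (F : set_system T) {FF : ProperFilter F}
    (f : T -> H) u w : (forall j, dom (f j)) -> tends F f u ->
  tends F (fun j => X (f j)) w -> dom u /\ X u = w.
Proof.
move=> df fu fw.
have E x : m x * u x = w x.
  apply/eqP; rewrite -subr_eq0; apply/eqP/eq0_normc/eqP.
  rewrite eq_le normc_ge0 andbT; apply/ler_addgt0Pl => e e0; rewrite addr0.
  have m1 : 0 < normc (m x) + 1 by rewrite ltr_pwDr// normc_ge0.
  have d0 : (0 : R) < e / (normc (m x) + 1) := divr_gt0 e0 m1.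
  have [t [ht ht']] := filter_ex (filterI (fu (e / (normc (m x) + 1)) d0)
    (fw (e / (normc (m x) + 1)) d0)).
  have -> : m x * u x - w x = (X (f t) - w) x - m x * (f t - u) x.
    by rewrite !ell2B XE//; ring.
  apply: le_trans (le_normcD _ _) _; rewrite normcN normcM.
  have h1 := le_trans (normc_le_ell2_rnorm _ x) ht.
  have h2 := le_trans (normc_le_ell2_rnorm _ x) ht'.
  have h3 : (normc (m x) + 1) * (e / (normc (m x) + 1)) = e.
    by rewrite mulrCA divff ?mulr1// gt_eqF.
  rewrite -[leRHS]h3 mulrDl mul1r addrC; apply: lerD => //.
  by rewrite ler_wpM2l ?normc_ge0.
have du : dom u.
  by rewrite /dom/= (_ : mulfun u = w); [exact: ell2P|exact/funext].
by split => //; apply: ell2_inj => x; rewrite XE.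
Qed.

Variables (J Cm : H -> H).
Hypothesis bJ : blin J.
Variable M : R.
Hypothesis M1 : 1 <= M.
Hypothesis JM : forall u, rn (J u) <= M * rn u.
Hypothesis Jsym : forall u v, inner (J u) v = inner u (J v).
Hypothesis dom_J : forall u, dom u -> dom (J u).
Hypothesis XJ : forall u, dom u -> X (J u) = J (X u) - Cm u.

Let M0 : 0 <= M. Proof. exact: le_trans M1. Qed.
Local Notation U := (unitary_group J).
Local Notation S := (expsum J).

Variable c : R.
Hypothesis c0 : 0 <= c.
Hypothesis Cc : forall u, rn (Cm u) <= c * rn u.

Lemma dom_iter n u : dom u -> dom (iter n J u).
Proof. by move=> du; elim: n => //= n; exact: dom_J. Qed.

(** The commutator of [X] with the [n]-th power of [J] is a sum of [n] products
    in which one factor [J] is replaced by [Cm]. *)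
Lemma rnorm_X_iter n u : dom u ->
  rn (X (iter n J u) - iter n J (X u)) <= n%:R * (M ^+ n * (c * rn u)).
Proof.
move=> du; elim: n => [|n IH]; first by rewrite subrr rnorm0 mul0r.
rewrite !iterS XJ; last exact: dom_iter.
rewrite addrAC -(blinB bJ); apply: le_trans (rnormB _ _) _.
rewrite -natr1 mulrDl mul1r; apply: lerD.
  apply: le_trans (JM _) _; rewrite exprS -mulrA mulrCA ler_wpM2l//.
apply: le_trans (Cc _) _; rewrite mulrCA ler_wpM2l//.
apply: le_trans (rnorm_iter M1 JM n u) _; rewrite ler_wpM2r ?ell2_rnorm_ge0//.
by rewrite exprS ler_peMl// exprn_ge0.
Qed.

Lemma dom_expsum t n u : dom u -> dom (S t n u).
Proof. by move=> du; apply: dom_sum => k _; apply: domZ; exact: dom_iter. Qed.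

Lemma X_expsum t n u : dom u -> X (S t n u) =
  \sum_(0 <= k < n) ((0 +i* t) ^+ k / k`!%:R) *: X (iter k J u).
Proof.
move=> du; rewrite X_sum => [|k _]; last by apply: domZ; exact: dom_iter.
by apply: eq_bigr => k _; rewrite XZ//; exact: dom_iter.
Qed.

Lemma X_expsum_tends t u : dom u -> exists w, tends \oo (fun n => X (S t n u)) w.
Proof.
move=> du.
(* Doubling the argument of the exponential absorbs the factor [n <= 2 ^ n] of
   [rnorm_X_iter]. *)
have [|||w hw] := @series_tends _ _
    (fun k => ((0 +i* t) ^+ k / k`!%:R) *: X (iter k J u))
    (rn (X u) + c * rn u) (2 * (`|t| * M)).
- by rewrite !mulr_ge0.
- by rewrite addr_ge0 ?mulr_ge0 ?ell2_rnorm_ge0.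
- move=> k; rewrite ell2_rnormZ normc_expcoef /exp_coeff/= !exprMn.
  have h : rn (X (iter k J u)) <= 2 ^+ k * (M ^+ k * (rn (X u) + c * rn u)).
    rewrite -[X in rn X](subrK (iter k J (X u))).
    apply: le_trans (ell2_rnormD _ _) _; rewrite addrC !mulrDr; apply: lerD.
      apply: le_trans (rnorm_iter M1 JM _ _) _; rewrite ler_peMl//.
        by rewrite mulr_ge0 ?exprn_ge0 ?ell2_rnorm_ge0.
      by rewrite exprn_ege1// ler1n.
    apply: le_trans (rnorm_X_iter _ du) _; rewrite ler_wpM2r//.
      by rewrite !mulr_ge0 ?exprn_ge0 ?ell2_rnorm_ge0.
    by rewrite -natrX ler_nat ltnW// ltn_expl.
  apply: le_trans (ler_wpM2l _ h) _; first by rewrite divr_ge0// exprn_ge0.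
  by rewrite le_eqVlt; apply/orP; left; apply/eqP; ring.
exists w; apply: eq_tends hw => n.
by rewrite X_expsum.
Qed.

Lemma dom_U_tends t u : dom u ->
  dom (U t u) /\ tends \oo (fun n => X (S t n u)) (X (U t u)).
Proof.
move=> du; have [w hw] := X_expsum_tends t du.
have dS n : dom (S t n u) by exact: dom_expsum.
have [d E] := X_closed dS (expsum_tends bJ M1 JM t u) hw.
by split=> //; rewrite E.
Qed.

Lemma dom_U t u : dom u -> dom (U t u).
Proof. by case/(dom_U_tends t). Qed.

Lemma sum_expcoef_le (y : R) n : 0 <= y ->
  \sum_(0 <= k < n) k%:R * exp_coeff y k <= y * expR y.
Proof.
move=> y0; case: n => [|n]; first by rewrite big_geq// mulr_ge0// expR_ge0.
rewrite big_nat_recl// mul0r add0r.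
apply: le_trans (ler_wpM2l y0 (series_exp_le n y0)); rewrite /series/= mulr_sumr.
apply: ler_sum => k _; rewrite le_eqVlt; apply/orP; left; apply/eqP.
rewrite /exp_coeff/= exprS factS natrM; field.
by rewrite nat1r !pnatr_eq0 -lt0n fact_gt0.
Qed.

Lemma rnorm_XU_exp t u : dom u -> rn (X (U t u) - U t (X u)) <=
  `|t| * M * expR (`|t| * M) * (c * rn u).
Proof.
move=> du; have [_ h] := dom_U_tends t du.
apply: tends_rnorm_le (tendsB h (expsum_tends bJ M1 JM t (X u))) _.
apply: nearW => n; rewrite X_expsum// /expsum -sumrB.
apply: le_trans (rnorm_sum _ _ _) _.
have tM : 0 <= `|t| * M by rewrite mulr_ge0.
apply: (@le_trans _ _ ((\sum_(0 <= k < n) k%:R * exp_coeff (`|t| * M) k) * (c * rn u))).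
  rewrite mulr_suml; apply: ler_sum => k _.
  rewrite -scalerBr ell2_rnormZ normc_expcoef.
  apply: le_trans (ler_wpM2l _ (rnorm_X_iter k du)) _.
    by rewrite divr_ge0// exprn_ge0.
  rewrite /exp_coeff/= exprMn le_eqVlt; apply/orP; left; apply/eqP; ring.
by rewrite ler_wpM2r ?mulr_ge0 ?ell2_rnorm_ge0// sum_expcoef_le.
Qed.

Local Notation K := (M * expR M * c).

Lemma speed_ge0 : 0 <= K.
Proof. by rewrite !mulr_ge0// expR_ge0. Qed.

(** The time evolution moves the position at most linearly in time: the series
    gives this for [|t| <= 1], and the cocycle identity propagates it. *)
Lemma rnorm_XU t u : dom u -> rn (X (U t u) - U t (X u)) <= `|t| * K * rn u.
Proof.
move=> du.
have step n s : rn (X (U (n%:R * s) u) - U (n%:R * s) (X u)) <=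
    n%:R * (`|s| * M * expR (`|s| * M) * (c * rn u)).
  elim: n => [|n IH].
    by rewrite !mul0r !(U0 bJ M1 JM) subrr rnorm0.
  rewrite -natr1 mulrDl mul1r [_ * s + s]addrC -!(U_add bJ M1 JM).
  set v := U (n%:R * s) u.
  rewrite -(subrK (U s (X v)) (X (U s v))) -addrA -(blinB (blin_U bJ M1 JM s)).
  apply: le_trans (ell2_rnormD _ _) _; rewrite mulrDl mul1r addrC; apply: lerD.
    by rewrite (rnorm_U bJ M1 JM Jsym).
  apply: le_trans (rnorm_XU_exp s (dom_U _ du)) _.
  by rewrite (rnorm_U bJ M1 JM Jsym).
pose n := (Num.trunc `|t|).+1.
have n0 : 0 < n%:R :> R by rewrite ltr0n.
have nt : `|t| <= n%:R by apply/ltW; rewrite truncnS_gt.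
have := step n (t / n%:R); rewrite mulrCA divff ?gt_eqF// mulr1 => /le_trans; apply.
rewrite normrM normfV (gtr0_norm n0).
rewrite (_ : n%:R * _ = `|t| * (M * expR (`|t| / n%:R * M) * c) * rn u); last first.
  by field; rewrite gt_eqF.
rewrite ler_wpM2r ?ell2_rnorm_ge0// ler_wpM2l// ler_wpM2r// ler_wpM2l//.
by rewrite ler_expR ler_piMl// ler_pdivrMr// mul1r.
Qed.

Definition heis t u : H := U t (X (U (- t) u)).

Lemma heis_lin t a u v : dom u -> dom v -> heis t (a *: u + v) = a *: heis t u + heis t v.
Proof.
move=> du dv; rewrite /heis; have [lU _] := blin_U bJ M1 JM (- t).
have [lU' _] := blin_U bJ M1 JM t.
by rewrite lU X_lin ?lU'//; exact: dom_U.
Qed.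

Lemma heis_sym t u v : dom u -> dom v -> inner (heis t u) v = inner u (heis t v).
Proof.
move=> du dv; rewrite /heis (U_adjoint bJ M1 JM Jsym) X_sym; try exact: dom_U.
by rewrite (U_adjoint bJ M1 JM Jsym) opprK.
Qed.

Lemma rnorm_heis t u : dom u -> rn (heis t u) <= rn (X u) + `|t| * K * rn u.
Proof.
move=> du; rewrite -[heis t u](subrK (X u)) [leRHS]addrC.
apply: le_trans (ell2_rnormD _ _) _; rewrite lerD2r.
rewrite -[X in _ - X](UK bJ M1 JM t) /heis -(blinB (blin_U bJ M1 JM t)).
rewrite (rnorm_U bJ M1 JM Jsym); apply: le_trans (rnorm_XU (- t) du) _.
by rewrite normrN.
Qed.

(** The operator [Y = r X + W] satisfies [J Y - Y J = A] with [A] commuting with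
    [J], so that [exp(itJ) Y exp(-itJ) = Y + i t A]: the conjugate of [Y] grows
    exactly linearly in [t]. As [W] is bounded, so does [r X(t)] up to a bounded
    error, which disappears after division by [t]. *)
Variables (r A W rC : H -> H).
Hypotheses (br : blin r) (bA : blin A) (bW : blin W) (brC : blin rC).
Hypothesis rJ : forall u, r (J u) = J (r u).
Hypothesis dom_r : forall u, dom u -> dom (r u).
Hypothesis Xr : forall u, dom u -> X (r u) = r (X u) + rC u.
Hypothesis AJ : forall u, A (J u) = J (A u).
Hypothesis JY : forall u, dom u ->
  J (r (X u) + W u) = r (X (J u)) + W (J u) + A u.
Hypothesis r_dense : forall u e, 0 < e -> exists g, dom g /\ rn (u - r g) <= e.

Let Y u := r (X u) + W u.

Lemma iter_Y n u : dom u ->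
  iter n J (Y u) = Y (iter n J u) + n%:R *: A (iter n.-1 J u).
Proof.
move=> du; elim: n => [|n IH]; first by rewrite scale0r addr0.
rewrite iterS IH (blinD bJ) (blinZ bJ) /Y JY; last exact: dom_iter.
rewrite iterS -!addrA; congr (_ + (_ + _)).
rewrite -AJ -natr1 scalerDl scale1r addrC; congr (_ + _).
by case: n {IH} => [|n]; rewrite ?scale0r.
Qed.

Lemma expsum_Y t n u : dom u ->
  S t n.+1 (Y u) = Y (S t n.+1 u) + (0 +i* t) *: A (S t n u).
Proof.
move=> du; rewrite {1}/expsum.
transitivity (\sum_(0 <= k < n.+1) (((0 +i* t) ^+ k / k`!%:R) *: Y (iter k J u) +
    ((0 +i* t) ^+ k / k`!%:R) *: (k%:R *: A (iter k.-1 J u)))).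
  by apply: eq_bigr => k _; rewrite iter_Y// scalerDr.
rewrite big_split /=; congr (_ + _).
  rewrite /Y X_expsum// (blin_sum _ _ _ br) (blin_sum _ _ _ bW) -big_split /=.
  by apply: eq_bigr => k _; rewrite (blinZ br) (blinZ bW) scalerDr.
rewrite big_nat_recl// scale0r scaler0 add0r (blin_sum _ _ _ bA) scaler_sumr.
apply: eq_bigr => k _; rewrite (blinZ bA) !scalerA; congr (_ *: _).
rewrite exprS factS natrM; field.
by rewrite nat1r !pnatr_eq0 -lt0n fact_gt0.
Qed.

(** The commutator of the [n]-th power of [J] with [Y] is [n] times [A] times the
    power [n - 1] of [J] ([iter_Y]); summing the exponential series turns this
    into the derivative of the exponential. *)
Lemma U_Y t u : dom u -> U t (Y u) = Y (U t u) + (0 +i* t) *: A (U t u).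
Proof.
move=> du.
have h1 := tends_shiftS (f := fun n => S t n (Y u)) (expsum_tends bJ M1 JM t (Y u)).
apply: (tends_unique h1); rewrite /Y.
have [_ hX] := dom_U_tends t du; have hS := expsum_tends bJ M1 JM t u.
have PF : ProperFilter \oo := eventually_filter.
have hrX := blin_tends (FF := PF) br (tends_shiftS (f := fun n => X (S t n u)) hX).
have hW := blin_tends (FF := PF) bW (tends_shiftS (f := fun n => S t n u) hS).
have hA := tendsZ (FF := PF) (0 +i* t) (blin_tends (FF := PF) bA hS).
have h2 := tendsD (FF := PF) (tendsD (FF := PF) hrX hW) hA.
by apply: (eq_tends _ h2) => n /=; rewrite expsum_Y.
Qed.

Lemma r_heis t u : dom u ->
  r (heis t u) = Y u + (0 +i* t) *: A u - U t (W (U (- t) u)).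
Proof.
move=> du; have E := U_Y t (dom_U (- t) du).
rewrite (UK bJ M1 JM) in E.
by rewrite -E /Y (blinD (blin_U bJ M1 JM t)) addrK /heis (U_comm bJ M1 JM t _ br rJ).
Qed.

(** The commutator [rC] of [X] and [r] is bounded, so [heis t] converges on the
    range of [r] as soon as [r (heis t)] does. *)
Lemma heis_r t u : dom u -> heis t (r u) = r (heis t u) + U t (rC (U (- t) u)).
Proof.
move=> du; rewrite /heis -(U_comm bJ M1 JM (- t) u br rJ) Xr; last exact: dom_U.
by rewrite (blinD (blin_U bJ M1 JM t)) (U_comm bJ M1 JM _ _ br rJ).
Qed.

Lemma tends_scaled (f : R -> H) (l : H) (B : R) :
  (forall t, rn (f t - (0 +i* t) *: l) <= B) ->
  tends (pinfty_nbhs R) (fun t => t^-1%:C *: f t) ((0 +i* 1) *: l).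
Proof.
move=> fB e e0; exists (`|B| / e); split; first exact: num_real.
move=> t Bt; have t0 : 0 < t by apply: le_lt_trans Bt; rewrite divr_ge0// ltW.
have <- : t^-1%:C * (0 +i* t) = 0 +i* 1 :> C.
  by apply/eqP; rewrite eq_complex/=; apply/andP; split; apply/eqP;
    field; rewrite gt_eqF.
rewrite -scalerA -scalerBr.
rewrite ell2_rnormZ {1}/normc/= expr0n addr0 sqrtr_sqr gtr0_norm ?invr_gt0//.
rewrite mulrC ler_pdivrMr//; apply: le_trans (fB t) _.
by rewrite mulrC; apply: le_trans (ler_norm _) _; rewrite -ler_pdivrMr// ltW.
Qed.

Lemma r_heis_tends u : dom u ->
  tends (pinfty_nbhs R) (fun t => t^-1%:C *: r (heis t u)) ((0 +i* 1) *: A u).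
Proof.
move=> du; have [_ [w [w0 hw]]] := bW.
apply: (tends_scaled (B := rn (Y u) + w * rn u)) => t.
rewrite r_heis// [X in rn X](_ : _ = Y u - U t (W (U (- t) u))).
  apply: le_trans (rnormB _ _) _; rewrite lerD2l (rnorm_U bJ M1 JM Jsym).
  by apply: le_trans (hw _) _; rewrite (rnorm_U bJ M1 JM Jsym).
by rewrite addrAC addrK.
Qed.

Lemma heis_r_tends u : dom u ->
  tends (pinfty_nbhs R) (fun t => t^-1%:C *: heis t (r u)) ((0 +i* 1) *: A u).
Proof.
move=> du; have [_ [w [w0 hw]]] := bW; have [_ [q [q0 hq]]] := brC.
apply: (tends_scaled (B := rn (Y u) + w * rn u + q * rn u)) => t.
rewrite heis_r// r_heis//.
rewrite [X in rn X](_ : _ = Y u - U t (W (U (- t) u)) + U t (rC (U (- t) u))).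
  apply: le_trans (ell2_rnormD _ _) _; apply: lerD.
    apply: le_trans (rnormB _ _) _; rewrite lerD2l (rnorm_U bJ M1 JM Jsym).
    by apply: le_trans (hw _) _; rewrite (rnorm_U bJ M1 JM Jsym).
  rewrite (rnorm_U bJ M1 JM Jsym).
  by apply: le_trans (hq _) _; rewrite (rnorm_U bJ M1 JM Jsym).
by rewrite [LHS]addrAC [X in X + _ = _]addrAC addrK.
Qed.

Lemma rnorm_scaled_heis t u : dom u -> 0 < t ->
  rn (t^-1%:C *: heis t u) <= t^-1 * rn (X u) + K * rn u.
Proof.
move=> du t0; rewrite ell2_rnormZ {1}/normc/= expr0n addr0 sqrtr_sqr.
rewrite gtr0_norm ?invr_gt0//.
apply: le_trans (ler_wpM2l _ (rnorm_heis t du)) _; first by rewrite invr_ge0 ltW.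
rewrite gtr0_norm// le_eqVlt; apply/orP; left; apply/eqP; field.
by rewrite gt_eqF.
Qed.

Lemma rnorm_scaled_heis_near u (e : R) : dom u -> 0 < e ->
  \forall t \near pinfty_nbhs R, rn (t^-1%:C *: heis t u) <= K * rn u + e.
Proof.
move=> du e0; exists (rn (X u) / e); split; first exact: num_real.
move=> t Bt; have t0 : 0 < t.
  by apply: le_lt_trans Bt; rewrite divr_ge0 ?ell2_rnorm_ge0// ltW.
apply: le_trans (rnorm_scaled_heis du t0) _; rewrite addrC lerD2l.
by rewrite mulrC ler_pdivrMr// mulrC -ler_pdivrMr// ltW.
Qed.

(** Convergence is known on the range of [r], which is dense, and the remainder
    contributes little for large [t] by [rnorm_scaled_heis_near]. *)
Lemma heis_tends u : dom u ->
  exists l, tends (pinfty_nbhs R) (fun t => t^-1%:C *: heis t u) l.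
Proof.
move=> du; apply: ell2_complete => e e0.
have K1 : 0 < K + 1 by rewrite ltr_pwDr// speed_ge0.
have e3 : 0 < e / 3 by rewrite divr_gt0.
have [g [dg hg]] := r_dense u (divr_gt0 e3 K1).
exists ((0 +i* 1) *: A g).
apply: filterS2 (heis_r_tends dg e3)
  (rnorm_scaled_heis_near (domB du (dom_r dg)) e3) => t h1 h2.
have -> : heis t u = heis t (u - r g) + heis t (r g).
  rewrite -[u - _]addrC -scaleN1r heis_lin//; last exact: dom_r.
  by rewrite scaleN1r addrAC addNr add0r.
rewrite scalerDr -addrA; apply: le_trans (ell2_rnormD _ _) _.
move: hg; rewrite ler_pdivlMr// => hg.
have : K * rn (u - r g) <= e / 3.
  by apply: le_trans hg; rewrite mulrC ler_wpM2l ?ell2_rnorm_ge0// lerDl.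
by move: h1 h2; lra.
Qed.

(** The limit is bounded on the domain of [X], so it extends to the whole space;
    symmetry and [r Q = i A] hold on basis vectors and extend by continuity. *)
Theorem asymptotic_velocity : exists Q : H -> H,
  [/\ blin Q, forall u v, inner (Q u) v = inner u (Q v),
      forall u, dom u -> tends (pinfty_nbhs R) (fun t => t^-1%:C *: heis t u) (Q u) &
      forall u, r (Q u) = (0 +i* 1) *: A u].
Proof.
have ex u : exists l, dom u -> tends (pinfty_nbhs R) (fun t => t^-1%:C *: heis t u) l.
  by have [/heis_tends[l hl]|nd] := pselect (dom u); [exists l|exists 0].
have [T hT] := choice ex.
have [||||||Q [bQ QT]] := @bounded_extension R I dom T K.
- exact: speed_ge0.
- exact: dom0.
- exact: dom_lin.
- exact: dom_delta.
- move=> a u v du dv; apply: (tends_unique (hT _ (dom_lin a du dv))).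
  apply: eq_tends (tendsD (tendsZ a (hT u du)) (hT v dv)) => t.
  by rewrite heis_lin// scalerDr !scalerA mulrC.
- move=> u du; apply/ler_addgt0Pr => e e0.
  by apply: tends_rnorm_le (hT u du) _; exact: rnorm_scaled_heis_near.
have Q_tends u : dom u -> tends (pinfty_nbhs R) (fun t => t^-1%:C *: heis t u) (Q u).
  by move=> du; rewrite QT//; exact: hT.
exists Q; split=> //.
- apply: (adjoint_entries bQ bQ) => x y.
  have h : inner (Q (delta x)) (delta y) = inner (delta x) (Q (delta y)).
    apply: (inner_tends (Q_tends _ (dom_delta x)) (Q_tends _ (dom_delta y))).
    apply: nearW => t; rewrite innerZl innerZr conj_real heis_sym//; exact: dom_delta.
  by rewrite -inner_delta -h innerC inner_delta.
- move=> u; apply: (blin_ext (blin_comp br bQ) (blin_scale _ bA)) => x.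
  have dx := dom_delta x.
  apply: (tends_unique (blin_tends br (Q_tends _ dx))).
  by apply: eq_tends (r_heis_tends dx) => t; rewrite (blinZ br).
Qed.

End position_evolution.

(** * Translations and the density of the range of a polynomial in them *)

Section hat_matrix.
Variable R : realType.
Local Notation C := R[i].

Definition adjmx (m n : nat) (A : 'M[C]_(m, n)) : 'M[C]_(n, m) :=
  map_mx Num.conj A^T.

Lemma adjmxM m n p (A : 'M[C]_(m, n)) (B : 'M[C]_(n, p)) :
  adjmx (A *m B) = adjmx B *m adjmx A.
Proof. by rewrite /adjmx trmx_mul map_mxM. Qed.

Lemma adjmxK m n (A : 'M[C]_(m, n)) : adjmx (adjmx A) = A.
Proof. by apply/matrixP => i j; rewrite !mxE conjCK. Qed.

Lemma mulmx_adj_diag m n (A : 'M[C]_(m, n)) i :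
  (A *m adjmx A) i i = (\sum_j normc (A i j) ^+ 2)%:C.
Proof.
rewrite mxE (rmorph_sum (real_complex R)); apply: eq_bigr => j _.
by rewrite !mxE [RHS]rmorphXn -sqr_normc.
Qed.

Lemma gram_unit r n (G : 'M[C]_(r, n)) : row_free G -> G *m adjmx G \in unitmx.
Proof.
move=> Gfree; rewrite -row_free_unit -kermx_eq0; apply/eqP/row_matrixP => i.
rewrite row0; set u := row i _.
have uK : u *m (G *m adjmx G) = 0 by apply/sub_kermxP; rewrite row_sub.
have : (u *m G) *m adjmx (u *m G) = 0.
  by rewrite adjmxM mulmxA -(mulmxA u) uK mul0mx.
move=> /matrixP/(_ 0 0); rewrite mulmx_adj_diag mxE => -[] /eqP.
rewrite psumr_eq0 => [/allP h|j _]; last exact: sqr_ge0.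
apply: (row_free_inj Gfree); rewrite mul0mx; apply/rowP => j; rewrite [RHS]mxE.
have := h j (mem_index_enum j); rewrite expf_eq0/= => /eqP.
exact: eq0_normc.
Qed.

(** The orthogonal projection onto the row space of [G] has trace [r], so the
    diagonal entries of the complementary projection sum to [n - r], and one of
    them is at most [(n - r) / n]. It is the squared distance of a basis vector
    to the row space. *)
Lemma close_to_row_space r n (G : 'M[C]_(r, n)) : row_free G -> (0 < n)%N ->
  exists (b : 'I_n) (w : 'rV[C]_r),
    \sum_j normc ((delta_mx 0 b - w *m G) 0 j) ^+ 2 <= (n%:R - r%:R) / n%:R :> R.
Proof.
move=> Gfree n0; have Ku := gram_unit Gfree.
set K := G *m adjmx G in Ku.
have Kadj : adjmx K = K by rewrite /K adjmxM adjmxK.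
have iKadj : adjmx (invmx K) = invmx K.
  by rewrite /adjmx trmx_inv map_invmx -/(adjmx K) Kadj.
pose P := adjmx G *m invmx K *m G.
have Padj : adjmx P = P by rewrite /P !adjmxM adjmxK iKadj mulmxA.
have PP : P *m P = P.
  rewrite /P -!mulmxA (mulmxA G) -/K (mulmxA K) mulmxV// mul1mx.
  by rewrite mulmxA.
pose E := 1%:M - P.
have EE : E *m adjmx E = E.
  have -> : adjmx E = E.
    by rewrite /E /adjmx linearB/= map_mxB trmx1 map_mx1 -/(adjmx P) Padj.
  by rewrite /E mulmxBr mulmx1 mulmxBl mul1mx PP subrr subr0.
have trE : \tr E = n%:R - r%:R.
  by rewrite /E linearB/= mxtrace1 /P mxtrace_mulC mulmxA -/K mulmxV// mxtrace1.
pose f b := \sum_j normc (E b j) ^+ 2.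
have fE b : E b b = (f b)%:C by rewrite -[in LHS]EE mulmx_adj_diag.
have sumf : \sum_b f b = n%:R - r%:R.
  apply: (@complexI R); rewrite rmorphB/= !rmorph_nat -trE rmorph_sum.
  by apply: eq_bigr => b _; rewrite fE.
have [b hb] : exists b, f b <= (n%:R - r%:R) / n%:R.
  apply/existsP; apply: contraT; rewrite negb_exists => /forallP h.
  suff : n%:R - r%:R < \sum_b f b by rewrite sumf ltxx.
  have -> : n%:R - r%:R = \sum_(b < n) (n%:R - r%:R) / n%:R :> R.
    rewrite sumr_const card_ord -[RHS]mulr_natr divfK//.
    by rewrite pnatr_eq0 -lt0n.
  apply: ltr_sum => [|b _]; last by rewrite ltNge h.
  by apply/hasP; exists (Ordinal n0); rewrite ?mem_index_enum.
exists b, (row b (adjmx G *m invmx K)).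
rewrite (eq_bigr (fun j => normc (E b j) ^+ 2))// => j _.
by rewrite -row_mul !mxE eqxx /= eq_sym.
Qed.

End hat_matrix.

Section lattice_action.
Variables (R : realType) (d : nat).
Local Notation Zd := 'rV[int]_d.
Local Notation C := R[i].
Local Notation H := (ell2 R Zd).
Local Notation rn := (@ell2_rnorm R Zd).
Implicit Types (u v : H) (x y l : Zd).

Definition shift l u : H := Ell2 (square_summable_shift (- l) (ell2P u)).

Lemma shiftE l u x : shift l u x = u (x - l). Proof. by []. Qed.

Lemma shift_add l l' u : shift l (shift l' u) = shift (l + l') u.
Proof. by apply: ell2_inj => x; rewrite !shiftE opprD addrA. Qed.

Lemma shift0 u : shift 0 u = u.
Proof. by apply: ell2_inj => x; rewrite shiftE subr0. Qed.

Lemma shift_delta l x : shift l (delta x) = delta (l + x).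
Proof.
by apply: ell2_inj => y; rewrite shiftE !deltaE subr_eq [x + l]addrC.
Qed.

Lemma rnorm_shift l u : rn (shift l u) = rn u.
Proof.
rewrite /ell2_rnorm; congr (Num.sqrt (fine _)).
rewrite /sqsum [RHS](@reindex_esum _ _ _ setT setT (fun x : Zd => x - l))//.
split => // [x y _ _ /addIr//|x _]; exists (x + l) => //; exact: addrK.
Qed.

Lemma blin_shift l : blin (shift l).
Proof.
split=> [a u v|]; first by apply: ell2_inj => x; rewrite ell2D ell2Z.
by exists 1; split=> // u; rewrite rnorm_shift mul1r.
Qed.

Lemma shift_adjoint l u v : inner (shift l u) v = inner u (shift (- l) v).
Proof.
apply: (adjoint_entries (blin_shift l) (blin_shift (- l))) => x y.
rewrite !shift_delta !deltaE conjC_nat.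
by rewrite eq_sym -(inj_eq (addrI (- l))) addKr.
Qed.

(** Reflection combined with complex conjugation turns the operators [act c] below
    into their adjoints ([actadjE]), so that a density statement about ranges
    gives one about kernels. *)
Lemma sqsum_refl (u : Zd -> C) : sqsum (fun x => (u (- x))^*%R) = sqsum u.
Proof.
rewrite /sqsum [RHS](@reindex_esum _ _ _ setT setT (fun x : Zd => - x)).
  by apply: eq_esum => x _; rewrite normc_conj.
by split => // [x y _ _ /oppr_inj//|x _]; exists (- x) => //; rewrite opprK.
Qed.

Lemma refl_subproof u : (fun x => (u (- x))^*%R) \in square_summable.
Proof.
by apply/square_summableP; rewrite sqsum_refl; apply/square_summableP/ell2P.
Qed.

Definition refl u : H := Ell2 (refl_subproof u).

Lemma reflE u x : refl u x = (u (- x))^*%R. Proof. by []. Qed.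

Lemma reflK u : refl (refl u) = u.
Proof. by apply: ell2_inj => x; rewrite !reflE conjCK opprK. Qed.

Lemma refl_sub u v : refl (u - v) = refl u - refl v.
Proof. by apply: ell2_inj => x; rewrite !(reflE, ell2B) rmorphB. Qed.

Lemma rnorm_refl u : rn (refl u) = rn u.
Proof. by rewrite /ell2_rnorm sqsum_refl. Qed.

Variable N : nat.
Hypothesis N0 : (0 < N)%N.

Local Notation Rg := (mpoly d C).

Definition mono (m : multinom d) : Zd := \row_k (N * m k)%:Z.

Lemma mono_add m m' : mono (mnm_add m m') = mono m + mono m'.
Proof. by apply/rowP => k; rewrite !mxE mnmDE mulnDr PoszD. Qed.

Lemma mono0 : mono (@mnm0 d) = 0.
Proof. by apply/rowP => k; rewrite !mxE mnm0E muln0. Qed.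

Lemma mono_inj : injective mono.
Proof.
move=> m m' /rowP h; apply/mnmP => k; have := h k; rewrite !mxE => -[] /eqP.
by rewrite eqn_pmul2l// => /eqP.
Qed.

(** The polynomial [c], evaluated at the translations by [N] times the basis
    vectors of the lattice. *)
Definition act (c : Rg) u : H := \sum_(m <- msupp c) mcoeff m c *: shift (mono m) u.

Lemma act_wide (s : seq (multinom d)) (c : Rg) u : uniq s ->
  {subset msupp c <= s} ->
  act c u = \sum_(m <- s) mcoeff m c *: shift (mono m) u.
Proof.
move=> us cs; rewrite (bigID (mem (msupp c)))/= [X in _ = _ + X]big1 ?addr0.
  rewrite -[RHS]big_filter; apply: perm_big; apply: uniq_perm.
  - exact: msupp_uniq.
  - exact: filter_uniq.
  - move=> m; rewrite mem_filter; case: (boolP (m \in msupp c)) => //= mc.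
    by rewrite cs.
by move=> m mc; rewrite memN_msupp_eq0// scale0r.
Qed.

Lemma act_lin a (c c' : Rg) u : act (a *: c + c') u = a *: act c u + act c' u.
Proof.
pose s := undup (msupp (a *: c + c') ++ msupp c ++ msupp c').
rewrite !(@act_wide s) ?undup_uniq//; try by
  move=> m; rewrite mem_undup !mem_cat => ->; rewrite ?orbT.
rewrite scaler_sumr -big_split/=; apply: eq_bigr => m _.
by rewrite mcoeffD mcoeffZ scalerDl scalerA.
Qed.

Lemma act0 u : act 0 u = 0.
Proof. by rewrite /act msupp0 big_nil. Qed.

Lemma actD (c c' : Rg) u : act (c + c') u = act c u + act c' u.
Proof. by have := act_lin 1 c c' u; rewrite !scale1r. Qed.

Lemma actZ a (c : Rg) u : act (a *: c) u = a *: act c u.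
Proof. by have := act_lin a c 0 u; rewrite act0 !addr0. Qed.

Lemma actX m u : act (mpolyX C m) u = shift (mono m) u.
Proof. by rewrite /act msuppX big_seq1 mcoeffX eqxx scale1r. Qed.

Lemma act1 u : act 1 u = u.
Proof. by rewrite -mpolyX0 actX mono0 shift0. Qed.

Lemma blin_act c : blin (act c).
Proof. by apply: blin_bigsum => m _; apply: blin_scale; exact: blin_shift. Qed.

Lemma act_comm B c u : blin B ->
  (forall m v, B (shift (mono m) v) = shift (mono m) (B v)) ->
  B (act c u) = act c (B u).
Proof.
move=> bB hB; rewrite (blin_sum _ _ _ bB); apply: eq_bigr => m _.
by rewrite (blinZ bB) hB.
Qed.

Lemma actM (p q : Rg) u : act (p * q) u = act p (act q u).
Proof.
have actXM m : act (mpolyX C m * q) u = shift (mono m) (act q u).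
  elim/mpolyind: q => [|a m' q _ _ IH].
    by rewrite mulr0 act0 (blin0 (blin_shift _)).
  rewrite mulrDr -scalerAr -mpolyXD !act_lin IH !actX mono_add -shift_add.
  by have [-> _] := blin_shift (mono m).
elim/mpolyind: p => [|a m p _ _ IH]; first by rewrite mul0r !act0.
by rewrite mulrDl -scalerAl !act_lin IH actXM actX.
Qed.

Definition actadj (c : Rg) u : H :=
  \sum_(m <- msupp c) (mcoeff m c)^*%R *: shift (- mono m) u.

Lemma blin_actadj c : blin (actadj c).
Proof. by apply: blin_bigsum => m _; apply: blin_scale; exact: blin_shift. Qed.

Lemma act_adjoint c u v : inner (act c u) v = inner u (actadj c v).
Proof.
rewrite inner_suml inner_sumr; apply: eq_bigr => m _.
by rewrite innerZl innerZr shift_adjoint.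
Qed.

Lemma actadjE c u : actadj c u = refl (act c (refl u)).
Proof.
apply: ell2_inj => x; rewrite reflE !ell2_sumE rmorph_sum; apply: eq_bigr => m _.
by rewrite !ell2Z !shiftE reflE rmorphM /= conjCK opprD !opprK.
Qed.

Lemma shift_actadj l c u : shift l (actadj c u) = actadj c (shift l u).
Proof.
rewrite (blin_sum _ _ _ (blin_shift l)); apply: eq_bigr => m _.
by rewrite (blinZ (blin_shift l)) !shift_add addrC.
Qed.

Definition fsp u := exists s : seq Zd, forall x, x \notin s -> u x = 0.

Lemma fsp_delta x : fsp (delta x).
Proof. by exists [:: x] => y; rewrite inE deltaE => /negPf ->. Qed.

Lemma fsp0 : fsp 0. Proof. by exists [::]. Qed.

Lemma fspD u v : fsp u -> fsp v -> fsp (u + v).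
Proof.
move=> [s hs] [t ht]; exists (s ++ t) => x; rewrite mem_cat negb_or => /andP[xs xt].
by rewrite ell2D hs// ht// addr0.
Qed.

Lemma fspZ a u : fsp u -> fsp (a *: u).
Proof. by move=> [s hs]; exists s => x /hs ux; rewrite ell2Z ux mulr0. Qed.

Lemma fsp_shift l u : fsp u -> fsp (shift l u).
Proof.
move=> [s hs]; exists [seq y + l | y <- s] => x xs; rewrite shiftE hs//.
by apply: contra xs => xs; apply/mapP; exists (x - l) => //; rewrite subrK.
Qed.

Lemma fsp_sum (T : Type) (s : seq T) (P : pred T) (f : T -> H) :
  (forall k, P k -> fsp (f k)) -> fsp (\sum_(k <- s | P k) f k).
Proof.
move=> hf; elim: s => [|k s IH]; first by rewrite big_nil; exact: fsp0.
by rewrite big_cons; case: ifPn => // Pk; apply: fspD IH; exact: hf.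
Qed.

Lemma fsp_act c u : fsp u -> fsp (act c u).
Proof. by move=> hu; apply: fsp_sum => m _; apply: fspZ; exact: fsp_shift. Qed.

Lemma dom_fsp (m : Zd -> C) u : fsp u -> dom m u.
Proof.
move=> [s hs]; rewrite /dom/=.
apply: (square_summable_bounded (M := \sum_(x <- s) normc (m x)) (ell2P u)) => x.
rewrite /mulfun normcM; have [xs|xs] := boolP (x \in s); last first.
  by rewrite hs// normc0 !mulr0.
rewrite ler_wpM2r ?normc_ge0//.
rewrite (big_rem x xs)/= lerDl; apply: sumr_ge0 => y _; exact: normc_ge0.
Qed.

Lemma rnorm_delta_sum (J : finType) (y : J -> Zd) (a : J -> C) : injective y ->
  rn (\sum_j a j *: delta (y j)) ^+ 2 = \sum_j normc (a j) ^+ 2.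
Proof.
move=> yinj; apply: (@complexI R); rewrite -inner_self.
have Sy j : (\sum_j a j *: delta (y j) : H) (y j) = a j.
  rewrite ell2_sumE (bigD1 j)// ell2Z deltaE eqxx mulr1 big1.
    by rewrite /= addr0.
  by move=> k kj; rewrite ell2Z deltaE (inj_eq yinj) eq_sym (negPf kj) mulr0.
rewrite {1}inner_suml (rmorph_sum (real_complex R)); apply: eq_bigr => j _.
by rewrite innerZl inner_delta Sy mulrC [RHS]rmorphXn -sqr_normc.
Qed.

End lattice_action.
Arguments blin_shift {R d} l.
Arguments mono_inj {d N} N0.

Section density.
Variables (R : realType) (d : nat).
Local Notation Zd := 'rV[int]_d.
Local Notation C := R[i].
Local Notation H := (ell2 R Zd).
Local Notation rn := (@ell2_rnorm R Zd).
Local Notation Rg := (mpoly d C).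

Definition box_mnm (M : nat) (f : {ffun 'I_d -> 'I_M}) : multinom d :=
  Multinom (mktuple (fun i => f i : nat)).

Lemma box_mnmE M (f : {ffun 'I_d -> 'I_M}) k : box_mnm f k = f k.
Proof. exact: mnmE. Qed.

Lemma box_mnm_inj M : injective (@box_mnm M).
Proof.
move=> f g /mnmP h; apply/ffunP => k; apply: val_inj => /=.
by have := h k; rewrite !box_mnmE.
Qed.

Lemma box_mnm_onto M (m : multinom d) : (forall k, m k < M)%N ->
  exists f, m = @box_mnm M f.
Proof.
move=> mM; exists [ffun k => Ordinal (mM k)].
by apply/mnmP => k; rewrite box_mnmE ffunE.
Qed.

Lemma msupp_lt_msize (c : Rg) m k : m \in msupp c ->
  (m k < mmeasure (@mdeg d) c)%N.
Proof.
move=> /(@msize_mdeg_lt d C) h; apply: leq_trans h.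
by rewrite ltnS mdegE (bigD1 k)//= leq_addr.
Qed.

Section box.
Variables (c : Rg) (M : nat).
Hypothesis c0 : c != 0.
Local Notation s := (mmeasure (@mdeg d) c).
Local Notation B1 := {ffun 'I_d -> 'I_M}.
Local Notation B2 := {ffun 'I_d -> 'I_(M + s)}.

(** Row [i] lists the coefficients of the product of [c] with the [i]-th
    monomial of the small box. *)
Definition box_matrix : 'M[C]_(#|{: B1}|, #|{: B2}|) :=
  \matrix_(i, j) mcoeff (box_mnm (enum_val j)) (mpolyX C (box_mnm (enum_val i)) * c).

Definition box_poly (v : 'rV[C]_#|{: B1}|) : Rg :=
  \sum_i v 0 i *: mpolyX C (box_mnm (enum_val i)).

Lemma mcoeff_box_poly v j :
  mcoeff (box_mnm (enum_val j)) (box_poly v * c) = (v *m box_matrix) 0 j.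
Proof.
rewrite mxE /box_poly mulr_suml raddf_sum; apply: eq_bigr => i _.
by rewrite -scalerAl /= mcoeffZ !mxE.
Qed.

Lemma msupp_box_poly v m : mcoeff m (box_poly v * c) != 0 ->
  exists j : 'I_#|{: B2}|, m = box_mnm (enum_val j).
Proof.
rewrite /box_poly mulr_suml raddf_sum => h.
have [i hi] : exists i : 'I_#|{: B1}|,
    mcoeff m (mpolyX C (box_mnm (enum_val i)) * c) != 0.
  apply/existsP; apply: contraNT h; rewrite negb_exists => /forallP h.
  rewrite big1// => i _; rewrite -scalerAl /= mcoeffZ.
  by rewrite (eqP (negbNE (h i))) mulr0.
have [f ->] : exists f, m = @box_mnm (M + s) f.
  apply: box_mnm_onto => k.
  move: hi; rewrite mulrC -mcoeff_msupp (perm_mem (msuppMX _ _)) => /mapP[m' m'c ->].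
  by rewrite mnmDE box_mnmE -addSn leq_add// ltnW// msupp_lt_msize.
by exists (enum_rank f); rewrite enum_rankK.
Qed.

(** A product with [c] vanishes only if the other factor does. *)
Lemma box_matrix_free : row_free box_matrix.
Proof.
rewrite -kermx_eq0; apply/eqP/row_matrixP => i; rewrite row0.
set v := row i _.
have vG : v *m box_matrix = 0 by apply/sub_kermxP; rewrite row_sub.
have : box_poly v * c = 0.
  apply/mpolyP => m; rewrite mcoeff0; apply/eqP; apply: contraT => h.
  have [j mj] := msupp_box_poly h.
  by move: h; rewrite mj mcoeff_box_poly vG mxE eqxx.
move/eqP; rewrite mulf_eq0 (negPf c0) orbF => /eqP pv.
apply/rowP => j; rewrite mxE [in RHS]mxE.
have := congr1 (mcoeff (box_mnm (enum_val j))) pv.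
rewrite mcoeff0 raddf_sum (bigD1 j)//= big1.
  by rewrite addr0 mcoeffZ mcoeffX eqxx mulr1 mxE.
move=> k kj; rewrite mcoeffZ mcoeffX (inj_eq (@box_mnm_inj M)).
by rewrite (inj_eq enum_val_inj) (negPf kj) mulr0.
Qed.

Variable N : nat.
Hypothesis N0 : (0 < N)%N.

Lemma delta0_close_to_range : (0 < #|{: B2}|)%N -> exists g : H,
  fsp g /\ rn (delta 0 - act N c g) ^+ 2 <=
    (#|{: B2}|%:R - #|{: B1}|%:R) / #|{: B2}|%:R.
Proof.
move=> n0; have [b [w hw]] := close_to_row_space box_matrix_free n0.
pose mb := box_mnm (enum_val b).
pose q : Rg := mpolyX C mb - box_poly w * c.
have qE j : mcoeff (box_mnm (enum_val j)) q = (delta_mx 0 b - w *m box_matrix) 0 j.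
  rewrite /q mcoeffB mcoeff_box_poly mcoeffX [RHS]mxE.
  congr (_ + _); last by rewrite [RHS]mxE.
  by rewrite mxE eqxx /= (inj_eq (@box_mnm_inj _)) (inj_eq enum_val_inj) eq_sym.
have q_act : act N q (delta 0) =
    \sum_(j < #|{: B2}|) mcoeff (box_mnm (enum_val j)) q *:
      delta (mono N (box_mnm (enum_val j))) :> H.
  pose t := [seq box_mnm (enum_val j) | j <- index_enum 'I_#|{: B2}|].
  rewrite (@act_wide _ _ _ t); first last.
  - move=> m; rewrite mcoeff_msupp => mq.
    have [-> | mmb] := eqVneq m mb.
      by apply/mapP; exists b; rewrite ?mem_index_enum.
    have [|j ->] := @msupp_box_poly w m; last first.
      by apply/mapP; exists j; rewrite ?mem_index_enum.
    move: mq; rewrite /q mcoeffB mcoeffX (eq_sym mb) (negPf mmb) sub0r oppr_eq0.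
    by [].
  - rewrite map_inj_uniq ?index_enum_uniq// => i j /box_mnm_inj; exact: enum_val_inj.
  rewrite big_map; apply: eq_bigr => j _.
  by rewrite shift_delta addr0.
pose g : H := shift (- mono N mb) (act N (box_poly w) (delta 0)).
exists g; split; first by apply: fsp_shift; apply: fsp_act; exact: fsp_delta.
have -> : delta 0 - act N c g = shift (- mono N mb) (act N q (delta 0)).
  have qD : act N q (delta 0) = delta (mono N mb) - act N c (act N (box_poly w) (delta 0)).
    have E : q + c * box_poly w = mpolyX C mb by rewrite /q mulrC subrK.
    have := congr1 (fun p => act N p (delta 0 : H)) E.
    rewrite /= actD actM actX shift_delta addr0 => <-.
    by rewrite addrK.
  rewrite qD (blinB (blin_shift _)) shift_delta addNr; congr (_ - _).
  by rewrite (act_comm (B := shift (- mono N mb)) _ _ (blin_shift _))// => m v;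
    rewrite !shift_add addrC.
rewrite rnorm_shift q_act rnorm_delta_sum; last first.
  move=> i j /(mono_inj N0)/box_mnm_inj; exact: enum_val_inj.
by apply: le_trans hw; apply: ler_sum => j _; rewrite qE.
Qed.

End box.

Lemma Bernoulli_le (x : R) n : 0 <= x <= 1 -> 1 - n%:R * x <= (1 - x) ^+ n.
Proof.
move=> /andP[x0 x1]; elim: n => [|n IH]; first by rewrite mul0r subr0.
rewrite exprS; apply: le_trans (ler_wpM2l _ IH); last by rewrite subr_ge0.
rewrite -natr1; have : 0 <= n%:R * x * x by rewrite !mulr_ge0.
by lra.
Qed.

Variable N : nat.
Hypothesis N0 : (0 < N)%N.

(** The functions on a box of side [M + s] that are [c] times a function on the
    smaller box of side [M] form a subspace whose codimension is negligible with
    respect to the volume of the box; so by [close_to_row_space] some basis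
    vector is close to it, and by translation invariance so is [delta 0]. *)
Lemma delta0_range_dense (c : Rg) (e : R) : c != 0 -> 0 < e ->
  exists g : H, fsp g /\ rn (delta 0 - act N c g) <= e.
Proof.
move=> c0 e0; set s := mmeasure (@mdeg d) c.
have s0 : (0 < s)%N.
  rewrite lt0n; apply: contra c0 => /eqP; rewrite /s => /eqP.
  by rewrite mmeasure_poly_eq0.
(* By Bernoulli's inequality the codimension is at most the fraction
   [d s / (M + s)] of the volume; this [M] makes it at most [e ^ 2]. *)
pose M := (Num.trunc (d%:R * s%:R / e ^+ 2)).+1.
have M0 : (0 : R) < M%:R + s%:R by rewrite ltr_pwDr ?ltr0n.
have c2 : (#|{: {ffun 'I_d -> 'I_(M + s)}}|%:R : R) = (M%:R + s%:R) ^+ d.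
  by rewrite card_ffun !card_ord natrX natrD.
have c1 : (#|{: {ffun 'I_d -> 'I_M}}|%:R : R) = M%:R ^+ d.
  by rewrite card_ffun !card_ord natrX.
have [|g [fg hg]] := @delta0_close_to_range c M c0 N N0.
  by rewrite -(ltr0n R) c2 exprn_gt0.
exists g; split=> //; rewrite -(@ler_pXn2r _ 2)// ?nnegrE ?ell2_rnorm_ge0 ?(ltW e0)//.
apply: le_trans hg _; rewrite c1 c2.
rewrite mulrBl divff ?gt_eqF ?exprn_gt0// -expr_div_n.
have -> : M%:R / (M%:R + s%:R) = 1 - s%:R / (M%:R + s%:R) :> R.
  by field; rewrite gt_eqF.
have x01 : 0 <= (s%:R / (M%:R + s%:R) : R) <= 1.
  rewrite ler_pdivrMr// mul1r lerDr ler0n andbT.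
  by rewrite divr_ge0// ltW.
apply: le_trans (lerB (lexx 1) (Bernoulli_le d x01)) _.
rewrite subKr mulrA ler_pdivrMr// mulrDr.
apply: (@le_trans _ _ (e ^+ 2 * M%:R)); last by rewrite lerDl mulr_ge0 ?sqr_ge0.
rewrite [leRHS]mulrC -ler_pdivrMr ?exprn_gt0//.
by apply/ltW; exact: truncnS_gt.
Qed.

Lemma act_dense (c : Rg) (u : H) (e : R) : c != 0 -> 0 < e ->
  exists g, fsp g /\ rn (u - act N c g) <= e.
Proof.
move=> c0 e0; have e2 : 0 < e / 2 by rewrite divr_gt0.
have [s hs] := delta_dense u e2.
pose B := \sum_(x <- s) normc (u x).
have B0 : 0 < B + 1 by rewrite ltr_pwDr// sumr_ge0// => x _; exact: normc_ge0.
have [g [fg hg]] := delta0_range_dense c0 (divr_gt0 e2 B0).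
exists (\sum_(x <- s) u x *: shift x g); split.
  by apply: fsp_sum => x _; apply: fspZ; exact: fsp_shift.
apply: le_trans (rnorm_dist_triangle (\sum_(x <- s) u x *: delta x) _ _) _.
rewrite [leRHS](splitr e); apply: lerD => //.
rewrite (blin_sum _ _ _ (blin_act N c)) -sumrB.
apply: le_trans (rnorm_sum _ _ _) _.
apply: (@le_trans _ _ (B * (e / 2 / (B + 1)))).
  rewrite mulr_suml; apply: ler_sum => x _.
  rewrite (blinZ (blin_act N c)) -scalerBr ell2_rnormZ ler_wpM2l ?normc_ge0//.
  rewrite -(act_comm (B := shift x) c g (blin_shift x)); last first.
    by move=> m v; rewrite !shift_add addrC.
  have -> : delta x = shift x (delta 0) :> H by rewrite shift_delta addr0.
  by rewrite -(blinB (blin_shift x)) rnorm_shift.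
by rewrite mulrA ler_pdivrMr// mulrC ler_pM2l// lerDl.
Qed.

(** The adjoint of [act c] is its reflection, which has dense range because
    [act c] has, by [act_dense]. *)
Lemma act_inj (c : Rg) (u : H) : c != 0 -> act N c u = 0 -> u = 0.
Proof.
move=> c0 cu0; have orth g : inner u (refl (act N c g)) = 0.
  by rewrite -[g]reflK -actadjE -act_adjoint cu0 inner0l.
apply: inner_eq0; apply: eq0_normc; apply/eqP.
rewrite eq_le normc_ge0 andbT; apply/ler_addgt0Pl => e e0; rewrite addr0.
have u1 : 0 < rn u + 1 by rewrite ltr_pwDr// ell2_rnorm_ge0.
have [g [_ hg]] := act_dense (refl u) c0 (divr_gt0 e0 u1).
have -> : inner u u = inner u (u - refl (act N c g)).
  by rewrite innerBr orth subr0.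
apply: le_trans (Cauchy_Schwarz _ _) _.
rewrite -{2}[u]reflK -refl_sub rnorm_refl; move: hg; rewrite ler_pdivlMr// => hg.
by apply: le_trans hg; rewrite mulrC ler_wpM2l ?ell2_rnorm_ge0// lerDl.
Qed.

End density.

(** * Polynomials and derivations over an integral domain *)

Section idomain_polynomials.
Variable A : idomainType.
Implicit Types (c : A) (p q P Q : {poly A}).

Lemma scalep_eq0 c P : c != 0 -> c *: P = 0 -> P = 0.
Proof.
by move=> c0 /eqP; rewrite -mul_polyC mulf_eq0 polyC_eq0 (negPf c0) => /eqP.
Qed.

(** Over an integral domain divisibility and Bezout identities hold up to a nonzero
    scalar; [act_inj] allows dividing by such scalars. *)
Lemma dvdpW P Q : P %| Q -> exists c S, c != 0 /\ c *: Q = S * P.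
Proof. by move=> /Pdiv.Idomain.dvdpP[[c S] /= c0 E]; exists c, S. Qed.

Lemma coprimepW P Q : coprimep P Q ->
  exists u v c, c != 0 /\ u * P + v * Q = c%:P.
Proof.
move=> /Pdiv.Idomain.Bezout_coprimepP[[u v] /= /eqpP[[c1 c2] /= /andP[c10 c20] E]].
exists (c1 *: u), (c1 *: v), c2; split=> //.
by rewrite -!scalerAl -scalerDr E alg_polyC.
Qed.

(** If [P = P1 g] and [Q = Q1 g] with a nonconstant [g], then [P1 Q1 g] has
    smaller degree than [p = P1 Q1 g ^ 2], and its square is [P1 Q1 p], up to
    scalars. *)
Lemma smaller_square_root p P Q c : p != 0 -> c != 0 -> c *: p = P * Q ->
  ~~ coprimep P Q ->
  exists S B : {poly A}, [/\ S != 0, (size S < size p)%N & S * S = B * p].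
Proof.
move=> p0 c0 E; have PQ0 : P * Q != 0.
  by rewrite -E; apply: contra_neq p0; exact: scalep_eq0.
have [P0 Q0] : P != 0 /\ Q != 0 by move: PQ0; rewrite mulf_eq0 negb_or => /andP[].
set g := gcdp P Q; rewrite coprimep_def -/g => sg.
have g0 : g != 0 by rewrite gcdp_eq0 negb_and P0.
have [c1 [P1 [c10 E1]]] := dvdpW (dvdp_gcdl P Q).
have [c2 [Q1 [c20 E2]]] := dvdpW (dvdp_gcdr P Q).
rewrite -/g in E1 E2.
pose S := P1 * Q1 * g.
have SE : (c1 * c2 * c) *: p = S * g.
  rewrite -scalerA E -scalerA [c2 *: _]scalerAr scalerAl E1 E2 /S.
  ring.
have cc0 : c1 * c2 * c != 0 by rewrite !mulf_neq0.
have S0 : S != 0.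
  by apply: contra_neq p0 => S0; move: SE; rewrite S0 mul0r; exact: scalep_eq0.
exists S, ((c1 * c2 * c) *: (P1 * Q1)); split=> //.
  have := congr1 (fun P : {poly A} => size P) SE.
  rewrite size_scale// size_mul// => ->.
  have : (0 < size S)%N by rewrite lt0n size_poly_eq0.
  have : (0 < size g)%N by rewrite lt0n size_poly_eq0.
  by move: sg; clear; move: (size g) (size S) => x y; lia.
by rewrite -scalerAl scalerAr SE /S; ring.
Qed.

(** If [p = s q], then [D p = D s q + s D q], so [q] divides [s D q], and [s] is
    coprime to [q]. *)
Lemma derivation_dvd (D : {poly A} -> {poly A}) p q :
  (forall c P Q, c != 0 -> c *: p = P * Q -> coprimep P Q) ->
  (forall P Q, D (P * Q) = D P * Q + P * D Q) ->
  q %| p -> q %| D p -> q %| D q.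
Proof.
move=> sqfree DM qp qDp; have [c [s [c0 E]]] := dvdpW qp.
have : q %| D (c *: p).
  by rewrite -mul_polyC DM dvdp_add// dvdp_mull.
rewrite E DM => h.
have : q %| s * D q.
  by rewrite -(dvdp_addr _ (dvdp_mull (D s) (dvdpp q))).
rewrite Gauss_dvdpr// coprimep_sym.
exact: (sqfree c).
Qed.

(** By [derivation_dvd] the gcd of [p] and [p'] divides its own derivative, which
    has smaller degree and thus vanishes; then it is constant, in characteristic
    zero. *)
Lemma squarefree_separable p : (forall n : nat, (n.+1%:R : A) != 0) -> p != 0 ->
  (forall c P Q, c != 0 -> c *: p = P * Q -> coprimep P Q) -> coprimep p p^`().
Proof.
move=> char0 p0 sqfree; rewrite coprimep_def; set q := gcdp p p^`().
have q0 : q != 0 by rewrite gcdp_eq0 negb_and p0.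
have qq : q %| q^`().
  apply: (derivation_dvd (D := fun P => P^`()) sqfree (@derivM A)).
  - exact: dvdp_gcdl.
  - exact: dvdp_gcdr.
have q'0 : q^`() = 0.
  apply/eqP; apply: contraT => h.
  have := dvdp_leq h qq; rewrite leqNgt => /negP[].
  exact: lt_size_deriv.
case E: (size q) => [|[|n]]//.
  by move/eqP: E; rewrite size_poly_eq0 (negPf q0).
have := congr1 (fun P : {poly A} => P`_n) q'0.
rewrite coef_deriv coef0 -mulr_natr => /eqP; rewrite mulf_eq0 (negPf (char0 n)).
rewrite orbF; have : lead_coef q != 0 by rewrite lead_coef_eq0.
by rewrite /lead_coef E /= => /negPf ->.
Qed.

Lemma dvdp_proportional P q : q != 0 -> q %| P -> (size P <= size q)%N ->
  exists e b, e != 0 /\ e *: P = b *: q.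
Proof.
move=> q0 qP sP; have [e [w [e0 E]]] := dvdpW qP; exists e.
suff [b wb] : exists b, w = b%:P by exists b; rewrite E wb mul_polyC.
have [w0|w0] := eqVneq w 0; first by exists 0; rewrite w0.
have : (size (e *: P) <= size q)%N by rewrite (leq_trans (size_scale_leq _ _)).
rewrite E size_mul// => sz.
have /size1_polyC -> : (size w <= 1)%N.
  have : (0 < size q)%N by rewrite lt0n size_poly_eq0.
  by move: sz; move: (size w) (size q) => x y; lia.
by exists w`_0.
Qed.

Lemma proportional_cross (e b x y x' y' : A) : e != 0 ->
  e * x' = b * x -> e * y' = b * y -> y * x' = x * y'.
Proof.
move=> e0 Ex Ey; apply: (mulfI e0).
by rewrite mulrCA Ex [RHS]mulrCA Ey; ring.
Qed.

End idomain_polynomials.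

Section grading.
Variables (F : fieldType) (d : nat) (k : 'I_d).
Hypothesis char0 : forall n : nat, (n.+1%:R : F) != 0.
Local Notation Rg := (mpoly d F).
Implicit Types (c : Rg) (m : multinom d).

Lemma natrS_mpoly_neq0 n : (n.+1%:R : Rg) != 0.
Proof. by rewrite -mpolyC_nat mpolyC_eq0 char0. Qed.

(** The derivation [z_k d/dz_k], which multiplies each monomial by its degree in
    the [k]-th variable [z_k]. *)
Definition euler c : Rg := mpolyX F (mnm1 k) * mderiv k c.

Lemma eulerD c c' : euler (c + c') = euler c + euler c'.
Proof. by rewrite /euler mderivD mulrDr. Qed.

Lemma eulerM c c' : euler (c * c') = euler c * c' + c * euler c'.
Proof. by rewrite /euler mderivM mulrDr !mulrA [c * mpolyX _ _]mulrC. Qed.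

Lemma euler_lin a c c' : euler (a *: c + c') = a *: euler c + euler c'.
Proof. by rewrite /euler mderivD mderivZ mulrDr -scalerAr. Qed.

Lemma eulerX m : euler (mpolyX F m) = (m k)%:R *: mpolyX F m.
Proof.
rewrite /euler mderivX -scalerAr -mpolyXD; case: (posnP (m k)) => [->|mk].
  by rewrite !scale0r.
congr (_ *: mpolyX F _); apply/mnmP => i.
rewrite mnmDE mnmBE mnm1E; case: eqP => [<-|_]; last by rewrite subn0.
by rewrite subnKC.
Qed.

(** The grading by the degree in the [k]-th variable, which becomes the degree
    in an auxiliary variable. *)
Definition grade : Rg -> {poly Rg} :=
  mmap (polyC \o @mpolyC d F) (fun i => (mpolyX F (mnm1 i))%:P * 'X^(i == k)).

Lemma gradeM c c' : grade (c * c') = grade c * grade c'.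
Proof. by have [h _] := mmap_is_multiplicative
  (fun i => (mpolyX F (mnm1 i))%:P * 'X^(i == k)) (polyC \o @mpolyC d F). Qed.

Lemma grade_lin a c c' : grade (a *: c + c') = (mpolyC d a) *: grade c + grade c'.
Proof. by rewrite /grade mmapD mmapZ /= mul_polyC. Qed.

Lemma grade0 : grade 0 = 0. Proof. exact: mmap0. Qed.

Lemma gradeX m : grade (mpolyX F m) = (mpolyX F m)%:P * 'X^(m k).
Proof.
rewrite /grade mmapX /mmap1 (eq_bigr (fun i =>
  ((mpolyX F (mnm1 i)) ^+ m i)%:P * 'X^((i == k) * m i))); last first.
  by move=> i _; rewrite exprMn rmorphXn exprM.
rewrite big_split/=.
have -> : \prod_(i < d) (mpolyX F (mnm1 i) ^+ m i)%:P = (mpolyX F m)%:P.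
  by rewrite -rmorph_prod /= -[in RHS](mmap1_id F m).
congr (_ * _); rewrite (bigD1 k)//= eqxx mul1n big1 ?mulr1// => i /negPf ->.
by rewrite mul0n expr0.
Qed.

Lemma grade_coef c m j : mcoeff m (grade c)`_j =
  if m k == j then mcoeff m c else 0.
Proof.
elim/mpolyind: c => [|a m' c _ _ IH].
  by rewrite grade0 coef0 !mcoeff0 if_same.
rewrite grade_lin gradeX coefD coefZ mul_polyC coefZ coefXn mcoeffD IH.
have E : mcoeff m (mpolyX F m' * (j == m' k)%:R) = ((m' == m) && (m k == j))%:R.
  case: eqP => [->|jm]; first by rewrite mulr1 mcoeffX; case: eqP => // ->; rewrite eqxx.
  rewrite mulr0 mcoeff0; case: eqP => //= mm; case: eqP => // mj.
  by case: jm; rewrite -mj mm.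
rewrite mcoeffCM E mcoeffD mcoeffZ mcoeffX.
by case: eqP => _; case: eqP => _; rewrite /= ?mulr0 ?addr0 ?add0r.
Qed.

Lemma grade_inj c : grade c = 0 -> c = 0.
Proof.
move=> c0; apply/mpolyP => m; have := grade_coef c m (m k).
by rewrite eqxx c0 coef0.
Qed.

Lemma grade_size c m : m \in msupp c -> (m k < size (grade c))%N.
Proof.
rewrite mcoeff_msupp; apply: contraNT; rewrite -leqNgt => h.
by have := grade_coef c m (m k); rewrite eqxx nth_default// mcoeff0 => <-.
Qed.

Lemma grade_euler c : grade (euler c) = 'X * (grade c)^`().
Proof.
elim/mpolyind: c => [|a m c _ _ IH].
  by rewrite /euler mderiv0 mulr0 grade0 deriv0 mulr0.
rewrite euler_lin !grade_lin derivD derivZ mulrDr -IH -scalerAr; congr (_ *: _ + _).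
rewrite eulerX -[_ *: mpolyX _ _]addr0 grade_lin grade0 addr0 gradeX.
rewrite derivM derivC mul0r add0r derivXn mulrCA; case: (m k) => [|n].
  by rewrite mulr0n !mulr0 mpolyC0 scale0r.
rewrite mulrnAr -exprS /= mulrnAr -scaler_nat; congr (_ *: _).
by rewrite mpolyC_nat.
Qed.

(** The coefficient of top degree on each side is the product of the leading
    coefficients, times the degree of the differentiated polynomial; so the
    degrees agree in characteristic zero. *)
Lemma wronskian0_size (p q : {poly Rg}) : p != 0 -> q != 0 ->
  p * ('X * q^`()) = q * ('X * p^`()) -> size p = size q.
Proof.
move=> p0 q0 /(congr1 (fun r : {poly Rg} => r`_((size p).-1 + (size q).-1)%N)).
have top (f g : {poly Rg}) : f != 0 -> g != 0 ->
    (f * ('X * g^`()))`_((size f).-1 + (size g).-1) =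
    lead_coef f * lead_coef g *+ (size g).-1.
  move=> f0 g0; rewrite coefM.
  have lt : ((size f).-1 < ((size f).-1 + (size g).-1).+1)%N by rewrite ltnS leq_addr.
  rewrite (bigD1 (Ordinal lt))//= addKn big1 ?addr0.
    rewrite coefXM; case E: (size g).-1 => [|n]/=; first by rewrite mulr0 mulr0n.
    by rewrite coef_deriv -mulrnAr /lead_coef E.
  move=> [i /= ilt] /eqP ni; have [iM|iM] := ltnP (size f).-1 i.
    rewrite nth_default ?mul0r//; move: iM; case: (size f) => //.
  have {}iM : (i < (size f).-1)%N.
    rewrite ltn_neqAle iM andbT; apply/eqP => E; apply: ni; exact: val_inj.
  rewrite coefXM; case: ifP => _; first by rewrite mulr0.
  have z j : (size g <= j)%N -> g`_j = 0 by move=> ?; rewrite nth_default.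
  rewrite coef_deriv z ?mul0rn ?mulr0//.
  have g1 : (0 < size g)%N by rewrite lt0n size_poly_eq0.
  by move: iM g1; move: (size f) (size g) => x y; lia.
rewrite /= top// addnC top// [lead_coef q * _]mulrC => /eqP.
rewrite -subr_eq0 => E.
have l0 : lead_coef p * lead_coef q != 0 by rewrite mulf_neq0 ?lead_coef_eq0.
have szp : (0 < size p)%N by rewrite lt0n size_poly_eq0.
have szq : (0 < size q)%N by rewrite lt0n size_poly_eq0.
suff : ((size q).-1 = (size p).-1)%N by move: szp szq; move: (size p) (size q) => x y; lia.
move: E; set x := (size q).-1; set y := (size p).-1.
have [xy|yx|//] := ltngtP x y.
  rewrite -opprB oppr_eq0 -mulrnBr ?(ltnW xy)// -mulr_natr mulf_eq0 (negPf l0)/=.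
  by rewrite -[(y - x)%N]prednK ?subn_gt0// (negPf (natrS_mpoly_neq0 _)).
rewrite -mulrnBr ?(ltnW yx)// -mulr_natr mulf_eq0 (negPf l0)/=.
by rewrite -[(x - y)%N]prednK ?subn_gt0// (negPf (natrS_mpoly_neq0 _)).
Qed.

Lemma grade_neq0 c : c != 0 -> grade c != 0.
Proof. by apply: contraNneq => /grade_inj ->. Qed.

Lemma grade_wronskian c c' : c * euler c' = c' * euler c ->
  grade c * ('X * (grade c')^`()) = grade c' * ('X * (grade c)^`()).
Proof.
move=> E; have := congr1 grade E.
by rewrite (gradeM c) (gradeM c') !grade_euler.
Qed.

(** The hypothesis says that [c] and [c'] have the same logarithmic derivative with
    respect to the [k]-th variable. *)
Lemma euler_proportional_size c c' : c != 0 -> c' != 0 ->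
  c * euler c' = c' * euler c -> size (grade c) = size (grade c').
Proof.
move=> c0 c'0 E; apply: wronskian0_size; [exact: grade_neq0|exact: grade_neq0|].
exact: grade_wronskian.
Qed.

Definition eulerp (P : {poly Rg}) : {poly Rg} := \poly_(i < size P) euler P`_i.

Lemma euler0 : euler 0 = 0.
Proof. by rewrite /euler mderiv0 mulr0. Qed.

Lemma coef_eulerp P i : (eulerp P)`_i = euler P`_i.
Proof.
rewrite coef_poly; case: ltnP => // h.
by rewrite nth_default// euler0.
Qed.

Lemma eulerpD P Q : eulerp (P + Q) = eulerp P + eulerp Q.
Proof. by apply/polyP => i; rewrite coefD !coef_eulerp coefD eulerD. Qed.

Lemma euler_sum (I : Type) (s : seq I) (P : pred I) (f : I -> Rg) :
  euler (\sum_(i <- s | P i) f i) = \sum_(i <- s | P i) euler (f i).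
Proof. by elim/big_rec2: _ => [|i y1 y2 _ <-]; rewrite ?euler0 ?eulerD. Qed.

Lemma eulerpM P Q : eulerp (P * Q) = eulerp P * Q + P * eulerp Q.
Proof.
apply/polyP => i; rewrite coefD !coef_eulerp !coefM euler_sum -big_split/=.
by apply: eq_bigr => j _; rewrite eulerM !coef_eulerp.
Qed.

Lemma eulerp0 : eulerp 0 = 0.
Proof. by apply/polyP => i; rewrite coef_eulerp coef0 euler0. Qed.

Lemma euler1 : euler 1 = 0.
Proof. by rewrite -mpolyX0 eulerX mnm0E scale0r. Qed.

Lemma eulerpX : eulerp 'X = 0.
Proof.
apply/polyP => i; rewrite coef_eulerp coefX [RHS]coef0.
by case: (i == 1%N); rewrite ?euler0 ?euler1.
Qed.

Lemma eulerpC c : eulerp c%:P = (euler c)%:P.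
Proof.
apply/polyP => i; rewrite coef_eulerp.
apply: etrans (congr1 euler (coefC c i)) (etrans _ (esym (coefC (euler c) i))).
by case: (i == 0%N); rewrite ?euler0.
Qed.

Lemma eulerp_MXaddC P c : eulerp (P * 'X + c%:P) = eulerp P * 'X + (euler c)%:P.
Proof. by rewrite eulerpD eulerpM eulerpX mulr0 addr0 eulerpC. Qed.

Lemma mcoeff_euler c m : mcoeff m (euler c) = (m k)%:R * mcoeff m c.
Proof.
elim/mpolyind: c => [|a m' c _ _ IH].
  by rewrite euler0 mcoeff0 mulr0.
rewrite euler_lin eulerX !mcoeffD !mcoeffZ mcoeffX IH mulrDr; congr (_ + _).
by case: eqP => [->|_]; rewrite ?mulr0// !mulr1 mulrC.
Qed.

Lemma size_eulerp P : (size (eulerp P) <= size P)%N.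
Proof. exact: size_poly. Qed.

End grading.

(** * Polynomials in the translations and the operator *)

Section polynomial_calculus.
Variables (R : realType) (d : nat).
Local Notation Zd := 'rV[int]_d.
Local Notation C := R[i].
Local Notation H := (ell2 R Zd).
Local Notation rn := (@ell2_rnorm R Zd).
Local Notation Rg := (mpoly d C).
Implicit Types (u v : H) (c : Rg) (P Q : {poly Rg}).

Variable N : nat.
Hypothesis N0 : (0 < N)%N.
Variable J : H -> H.
Hypothesis bJ : blin J.
Hypothesis Jsym : forall u v, inner (J u) v = inner u (J v).
Hypothesis Jshift : forall m u, J (shift (mono N m) u) = shift (mono N m) (J u).

Local Notation act := (act N).
Local Notation actadj := (actadj N).

Lemma Jact c u : J (act c u) = act c (J u).
Proof. by apply: act_comm => //; exact: bJ. Qed.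

(** The value of [P] at the translations and at [J]. *)
Definition ev P u : H := \sum_(i < size P) act P`_i (iter i J u).

Lemma ev_wide n P u : (size P <= n)%N -> ev P u = \sum_(i < n) act P`_i (iter i J u).
Proof.
move=> Pn; rewrite /ev (big_ord_widen _ (fun i => act P`_i (iter i J u)) Pn).
rewrite big_mkcond; apply: eq_bigr => i _; case: ltnP => // h.
by rewrite nth_default// act0.
Qed.

Lemma blin_ev P : blin (ev P).
Proof.
by apply: blin_bigsum => i _; apply: blin_comp; [exact: blin_act|exact: blin_iter].
Qed.

Lemma ev0 u : ev 0 u = 0.
Proof. by rewrite /ev size_poly0 big_ord0. Qed.

Lemma evD P Q u : ev (P + Q) u = ev P u + ev Q u.
Proof.
pose n := maxn (size P) (size Q).
rewrite (@ev_wide n P) ?leq_maxl// (@ev_wide n Q) ?leq_maxr//.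
rewrite (@ev_wide n (P + Q)) ?size_polyD// -big_split; apply: eq_bigr => i _.
by rewrite coefD actD.
Qed.

Lemma evZ c P u : ev (c *: P) u = act c (ev P u).
Proof.
rewrite (@ev_wide (size P)) ?size_scale_leq// (blin_sum _ _ _ (blin_act N c)).
by apply: eq_bigr => i _; rewrite coefZ actM.
Qed.

Lemma evC c u : ev c%:P u = act c u.
Proof. by rewrite (@ev_wide 1) ?size_polyC_leq1// big_ord1 coefC. Qed.

Lemma evMX P u : ev (P * 'X) u = ev P (J u).
Proof.
rewrite (@ev_wide (size P).+1); last first.
  by rewrite (leq_trans (size_polyMleq _ _))// size_polyX addn2.
rewrite big_ord_recl coefMX /= act0 add0r; apply: eq_bigr => i _.
by rewrite coefMX /= -iterSr.
Qed.

Lemma ev_comm B P u : blin B ->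
  (forall m v, B (shift (mono N m) v) = shift (mono N m) (B v)) ->
  (forall v, B (J v) = J (B v)) -> B (ev P u) = ev P (B u).
Proof.
move=> bB Bs BJ; rewrite (blin_sum _ _ _ bB); apply: eq_bigr => i _.
rewrite (act_comm _ _ bB)//; congr (act _ _).
by elim: (i : nat) => //= n IH; rewrite BJ IH.
Qed.

Lemma evJ P u : J (ev P u) = ev P (J u).
Proof. by apply: ev_comm. Qed.

Lemma evM P Q u : ev (P * Q) u = ev P (ev Q u).
Proof.
elim/poly_ind: P Q u => [|P c IH] Q u; first by rewrite mul0r !ev0.
rewrite mulrDl -mulrA evD IH [RHS]evD evMX evC mul_polyC evZ.
by rewrite -commr_polyX evMX evJ.
Qed.

Lemma evC_comm P Q u : ev P (ev Q u) = ev Q (ev P u).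
Proof. by rewrite -!evM mulrC. Qed.

Lemma ev_shift m P u : shift (mono N m) (ev P u) = ev P (shift (mono N m) u).
Proof.
apply: ev_comm => [|m' v|v]; first exact: blin_shift.
  by rewrite !shift_add addrC.
by rewrite Jshift.
Qed.

(** The adjoint of [ev P]; it commutes with [ev P], which is thus normal. *)
Definition evadj P u : H := \sum_(i < size P) actadj P`_i (iter i J u).

Lemma Jactadj c u : J (actadj c u) = actadj c (J u).
Proof.
apply: ell2_inj => x; rewrite -!inner_delta.
by rewrite -Jsym -act_adjoint -Jact Jsym act_adjoint.
Qed.

Lemma ev_adjoint P u v : inner (ev P u) v = inner u (evadj P v).
Proof.
rewrite inner_suml inner_sumr; apply: eq_bigr => i _.
rewrite act_adjoint; move: (P`_i) => c.
elim: (i : nat) v => //= n IH v.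
by rewrite Jsym Jactadj IH -iterSr.
Qed.

Lemma blin_evadj P : blin (evadj P).
Proof.
by apply: blin_bigsum => i _; apply: blin_comp; [exact: blin_actadj|exact: blin_iter].
Qed.

Lemma evadj_comm P Q u : evadj P (ev Q u) = ev Q (evadj P u).
Proof.
apply: ev_comm => [|m v|v]; first exact: blin_evadj.
- rewrite (blin_sum _ _ _ (blin_shift _)); apply: eq_bigr => i _.
  rewrite shift_actadj; congr (actadj _ _).
  by elim: (i : nat) => //= n IH; rewrite IH Jshift.
- rewrite (blin_sum _ _ _ bJ); apply: eq_bigr => i _.
  by rewrite Jactadj -iterS iterSr.
Qed.

(** As [ev P] is normal, [evadj P] vanishes where [ev P] does; and the squared norm of
    [ev P u] is the inner product of [u] with [evadj P (ev P u)]. *)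
Lemma ev_semisimple P u : ev P (ev P u) = 0 -> ev P u = 0.
Proof.
move=> h; have BA : evadj P (ev P u) = 0.
  apply: inner_eq0; rewrite -ev_adjoint -evadj_comm h.
  by rewrite (blin0 (blin_evadj P)) inner0l.
by apply: inner_eq0; rewrite ev_adjoint BA innerC inner0l rmorph0.
Qed.

Definition ann P := forall u, ev P u = 0.

Lemma ann_delta P : (forall x, ev P (delta x) = 0) -> ann P.
Proof. by move=> h u; exact: (blin_ext (blin_ev P) (@blin_zero _ _) h u). Qed.

Lemma annM P Q : ann Q -> ann (P * Q).
Proof. by move=> h u; rewrite evM h (blin0 (blin_ev P)). Qed.

Variable p : {poly Rg}.
Hypothesis p0 : p != 0.
Hypothesis annp : ann p.
Hypothesis pmin : forall P, P != 0 -> ann P -> (size p <= size P)%N.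

(** [p] is squarefree because the operators [ev P] are normal. *)
Lemma minpoly_squarefree c P Q : c != 0 -> c *: p = P * Q -> coprimep P Q.
Proof.
move=> c0 E; apply: contraT => nc.
have [S [B [S0 sS SS]]] := smaller_square_root p0 c0 E nc.
have annS : ann S by move=> u; apply: ev_semisimple; rewrite -evM SS annM.
by move: sS; rewrite ltnNge pmin.
Qed.

Lemma char0_C (n : nat) : (n.+1%:R : C) != 0.
Proof. by rewrite pnatr_eq0. Qed.

Lemma minpoly_separable : coprimep p p^`().
Proof.
exact: squarefree_separable (natrS_mpoly_neq0 d char0_C) p0 minpoly_squarefree.
Qed.

Variable k : 'I_d.

Definition below (h : int) u := forall x : Zd, (h < x 0 k)%R -> u x = 0.
Definition slice (h : int) : H -> H := restr (fun x : Zd => x 0 k == h).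

Hypothesis J_below : forall h u, below h u -> below (h + 1) (J u).
Hypothesis fsp_J : forall u, fsp u -> fsp (J u).
Hypothesis J_top : forall h u, below h u -> slice (h + 1) (J u) = 0 -> slice h u = 0.

Lemma blin_slice h : blin (slice h). Proof. exact: blin_restr. Qed.

Lemma fsp_iter n u : fsp u -> fsp (iter n J u).
Proof. by move=> fu; elim: n => //= n; exact: fsp_J. Qed.

Lemma slice_shift h m u :
  slice h (shift (mono N m) u) = shift (mono N m) (slice (h - (N * m k)%N%:Z) u).
Proof.
apply: ell2_inj => x; rewrite shiftE !restrE shiftE !mxE.
by rewrite (inj_eq (addIr _)).
Qed.

Lemma slice_below h h' u : below h u -> h < h' -> slice h' u = 0.
Proof.
by move=> hu hh; apply: ell2_inj => x; rewrite restrE; case: eqP => // xh; rewrite hu// xh.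
Qed.

Lemma below_act h (a : nat) c u : below h u ->
  (forall m, m \in msupp c -> (m k <= a)%N) -> below (h + (N * a)%N%:Z) (act c u).
Proof.
move=> hu ca x hx; rewrite ell2_sumE big1_seq// => m /andP[_ mc].
rewrite ell2Z shiftE hu ?mulr0// !mxE.
have : (N * m k <= N * a)%N by rewrite leq_mul2l ca// orbT.
by move: hx; move: (x 0 k) (N * m k)%N (N * a)%N => w y z; lia.
Qed.

Lemma below_iter n h u : below h u -> below (h + n%:Z) (iter n J u).
Proof.
move=> hu; elim: n => [|n IH]; first by rewrite addr0.
by rewrite iterS -addn1 PoszD addrA; exact: J_below.
Qed.

Lemma slice_act_top h (a : nat) c u : below h u ->
  (forall m, m \in msupp c -> (m k <= a)%N) ->
  slice (h + (N * a)%N%:Z) (act c u) = act (grade k c)`_a (slice h u).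
Proof.
move=> hu ca; have supp : {subset msupp (grade k c)`_a <= msupp c}.
  move=> m; rewrite !mcoeff_msupp (grade_coef k c m a).
  by case: ifP => // _; rewrite eqxx.
rewrite (act_wide N _ (msupp_uniq c) supp) (blin_sum _ _ _ (blin_slice _)).
apply: eq_big_seq => m mc; rewrite (blinZ (blin_slice _)).
rewrite (slice_shift _ m u) (grade_coef k c m a).
have [->|ma] := eqVneq (m k) a; first by rewrite addrK.
rewrite scale0r (@slice_below h _ _ hu) ?(blin0 (blin_shift _)) ?scaler0//.
have ma' : (m k < a)%N by rewrite ltn_neqAle ma ca.
have : (N * m k < N * a)%N by rewrite ltn_mul2l N0.
by move: (N * m k)%N (N * a)%N => y z; lia.
Qed.

Lemma slice_iter_top n h u : below h u -> slice (h + n%:Z) (iter n J u) = 0 ->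
  slice h u = 0.
Proof.
move=> hu; elim: n => [|n IH]; first by rewrite addr0.
rewrite iterS -[n.+1]addn1 PoszD addrA => /(@J_top _ _ (@below_iter n h u hu)).
exact: IH.
Qed.

Lemma below_fsp u : fsp u -> u != 0 -> exists h, below h u /\ slice h u != 0.
Proof.
move=> [s hs] u0.
have [x ux] : exists x, u x != 0.
  apply/not_existsP => h; move/eqP: u0; apply; apply: ell2_inj => x.
  by apply/eqP; apply: contraT => /h.
pose t := [seq y <- s | u y != 0].
have tE y : (y \in t) = (u y != 0).
  rewrite mem_filter; case: eqVneq => //= uy; apply: contraT => /hs uy0.
  by move: uy; rewrite uy0 eqxx.
have xt : x \in t by rewrite tE.
have [y yt ymax] : exists2 y, y \in t & forall z, z \in t -> z 0 k <= y 0 k.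
  have : t != [::] by case: (t) xt.
  elim: (t) => [//|a t' IH] _; case: (t' =P [::]) => [->|/eqP/IH [y yt ym]].
    by exists a => [|z]; rewrite mem_seq1 ?eqxx// => /eqP ->.
  have [ya|ya] := lerP (a 0 k) (y 0 k).
    exists y => [|z]; rewrite inE ?yt ?orbT// => /orP[/eqP ->//|]; exact: ym.
  exists a => [|z]; rewrite inE ?eqxx// => /orP[/eqP ->//|/ym zy].
  exact: le_trans zy (ltW ya).
exists (y 0 k); split=> [z hz|].
  apply/eqP; apply: contraLR hz => uz; rewrite -leNgt; apply: ymax.
  by rewrite tE.
apply/eqP => /(congr1 (fun v : H => v y)); rewrite restrE eqxx ell20.
by move/eqP; rewrite tE in yt; rewrite (negPf yt).
Qed.

(** By [euler_proportional_size] the nonzero coefficients of [q] have the same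
    degree [a] in the [k]-th variable. So the topmost layer of [ev q u] in direction [k]
    comes from the highest power [n] of [J] alone: it is the coefficient of
    degree [a] of the leading coefficient of [q], applied to the topmost layer of
    the [n]-th iterate of [u] under [J], which is not zero. *)
Lemma ev_eulerp_inj (q : {poly Rg}) u : q != 0 -> q %| eulerp k q -> fsp u ->
  ev q u = 0 -> u = 0.
Proof.
move=> q0 qDq fu qu; apply/eqP; apply: contraT => u0.
have [h [hu hs]] := below_fsp fu u0.
have [e [b [e0 E]]] := dvdp_proportional q0 qDq (size_eulerp k q).
have l0 : lead_coef q != 0 by rewrite lead_coef_eq0.
set l := lead_coef q in l0.
have Ei j : e * euler k q`_j = b * q`_j.
  by have := congr1 (fun P : {poly Rg} => P`_j) E; rewrite !coefZ coef_eulerp.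
have prop i : l * euler k q`_i = q`_i * euler k l.
  exact: (proportional_cross e0 (Ei i) (Ei (size q).-1)).
pose n := (size q).-1; pose a := (size (grade k l)).-1.
have al : (0 < size (grade k l))%N.
  by rewrite lt0n size_poly_eq0 grade_neq0//; exact: char0_C.
have deg i m : m \in msupp q`_i -> (m k <= a)%N.
  move=> mq; have qi0 : q`_i != 0.
    by apply: contraTneq mq => ->; rewrite msupp0.
  have := grade_size k mq; rewrite -(euler_proportional_size char0_C l0 qi0 (prop i)).
  by rewrite -(prednK al) ltnS.
have sq : size q = n.+1.
  by rewrite /n prednK// lt0n size_poly_eq0.
have top : slice (h + n%:Z + (N * a)%N%:Z) (ev q u) =
    act (grade k l)`_a (slice (h + n%:Z) (iter n J u)).
  rewrite /ev sq big_ord_recr/= (blinD (blin_slice _)) (blin_sum _ _ _ (blin_slice _)).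
  rewrite big1 ?add0r; last first.
    move=> [i /= ilt] _.
    apply: (@slice_below _ _ _ (@below_act _ a q`_i _ (@below_iter i h u hu) (deg i))).
    by move: (N * a)%N => y; lia.
  exact: (@slice_act_top _ a q`_n _ (@below_iter n h u hu) (deg n)).
have lead0 : (grade k l)`_a != 0.
  by rewrite -/(lead_coef _) lead_coef_eq0 grade_neq0//; exact: char0_C.
move: top; rewrite qu (blin0 (blin_slice _)) => /esym/(act_inj N0 lead0).
by move=> /(@slice_iter_top n h u hu) /eqP; rewrite (negPf hs).
Qed.

(** The gcd [q] of [p] and [eulerp k p] divides [eulerp k q], so [ev q] is
    injective on finitely supported vectors. The cofactor of [q] in [p] therefore
    annihilates the basis vectors, and [q] is constant by minimality of [p]. *)
Lemma minpoly_euler_coprime : coprimep p (eulerp k p).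
Proof.
rewrite coprimep_def; set q := gcdp p (eulerp k p).
have q0 : q != 0 by rewrite gcdp_eq0 negb_and p0.
have qq : q %| eulerp k q.
  apply: (derivation_dvd minpoly_squarefree (@eulerpM _ _ k)).
  - exact: dvdp_gcdl.
  - exact: dvdp_gcdr.
have [c [s [c0 E]]] := dvdpW (dvdp_gcdl p (eulerp k p)); rewrite -/q in E.
have s0 : s != 0.
  apply: contra_neq p0 => s0; move: E; rewrite s0 mul0r.
  exact: scalep_eq0.
have anns : ann s.
  apply: ann_delta => x; apply: (ev_eulerp_inj q0 qq).
    by apply: fsp_sum => i _; apply: fsp_act; apply: fsp_iter; exact: fsp_delta.
  by rewrite evC_comm -evM -E evZ annp (blin0 (blin_act N c)).
have := pmin s0 anns.
have := congr1 (fun P : {poly Rg} => size P) E.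
rewrite size_scale// size_mul// => ->.
have : (0 < size q)%N by rewrite lt0n size_poly_eq0.
have : (0 < size s)%N by rewrite lt0n size_poly_eq0.
by move: (size q) (size s) => x y; lia.
Qed.

End polynomial_calculus.

(** * Periodic Jacobi operators *)

Section period.
Variables (R : realType) (d : nat).
Local Notation Zd := 'rV[int]_d.
Local Notation C := R[i].

(** The subgroup contains the rows of a matrix [M] of nonzero determinant, and the
    adjugate of [M] writes [\det M] times any vector as a combination of them. *)
Lemma full_rank_period (L : set Zd) : full_rank_subgroup L ->
  exists N : nat, (0 < N)%N /\ forall m : multinom d, L (mono N m).
Proof.
move=> [L0 LB [M [LM rkM]]].
have LN x : L x -> L (- x) by move=> Lx; rewrite -sub0r; exact: LB.
have LD x y : L x -> L y -> L (x + y).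
  by move=> Lx Ly; rewrite -[y]opprK; apply: LB => //; exact: LN.
have LMn x n : L x -> L (x *+ n).
  by move=> Lx; elim: n => [|n IH]; rewrite ?mulr0n// mulrS; exact: LD.
have LZ (z : int) x : L x -> L (z *: x).
  move=> Lx; case: (intP z) => [|n|n]; first by rewrite scale0r.
    by rewrite -[_%:Z]/(n.+1%:Z) -natz scaler_nat; exact: LMn.
  by rewrite scaleNr -natz scaler_nat; apply: LN; exact: LMn.
have Lsum (f : 'I_d -> Zd) : (forall i, L (f i)) -> L (\sum_i f i).
  by move=> Lf; elim/big_ind: _.
have Lmul (v : Zd) : L (v *m M).
  by rewrite mulmx_sum_row; apply: Lsum => i; exact: LZ.
have detM : \det M != 0.
  have : \det (map_mx intr M : 'M[rat]_d) != 0.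
    by rewrite -unitfE -unitmxE -row_free_unit /row_free rkM.
  by rewrite det_map_mx intr_eq0.
exists `|\det M|%N; split; first by rewrite absz_gt0.
move=> m; pose v : Zd := \row_k (m k)%:Z.
have -> : mono `|\det M|%N m = (`|\det M|%N)%:Z *: v.
  by apply/rowP => k; rewrite !mxE PoszM.
have -> : (`|\det M|%N)%:Z = Num.sg (\det M) * \det M by rewrite abszE normrEsg.
rewrite -scalerA; apply: LZ.
have -> : \det M *: v = (v *m \adj M) *m M by rewrite -mulmxA mul_adj_mx mul_mx_scalar.
exact: Lmul.
Qed.

End period.

Section jacobi_operator.
Variables (R : realType) (d : nat).
Local Notation Zd := 'rV[int]_d.
Local Notation C := R[i].
Local Notation H := (ell2 R Zd).
Local Notation rn := (@ell2_rnorm R Zd).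
Implicit Types (u v : H) (x y e : Zd).

(** Meant for bounded weights [w], for which it is everywhere defined. *)
Definition wmul (w : Zd -> C) u : H := X w u.

Lemma dom_bounded (w : Zd -> C) (B : R) u : (forall x, normc (w x) <= B) -> dom w u.
Proof.
move=> wB; apply: (square_summable_bounded (M := B) (ell2P u)) => x.
by rewrite /mulfun normcM ler_wpM2r ?normc_ge0.
Qed.

Lemma wmulE (w : Zd -> C) (B : R) u x : (forall x, normc (w x) <= B) ->
  wmul w u x = w x * u x.
Proof. by move=> /dom_bounded wB; rewrite /wmul XE//; exact: wB. Qed.

Lemma blin_wmul (w : Zd -> C) (B : R) : (forall x, normc (w x) <= B) -> blin (wmul w).
Proof.
move=> wB; have dw u : dom w u := dom_bounded u wB.
split=> [a u v|]; first by rewrite /wmul X_lin.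
exists `|B|; split=> // u; apply: ell2_rnorm_le => [|F finF].
  by rewrite mulr_ge0 ?ell2_rnorm_ge0.
rewrite exprMn; apply: le_trans (ler_wpM2l (sqr_ge0 _) (ell2_rnorm_fset u finF)).
rewrite mulr_sumr; apply: ler_sum => x _; rewrite (wmulE _ _ wB) normcM exprMn.
rewrite ler_wpM2r ?sqr_ge0// lerXn2r ?nnegrE ?normc_ge0//.
by rewrite (le_trans (wB x))// ler_norm.
Qed.

Lemma fsp_wmul (w : Zd -> C) (B : R) u : (forall x, normc (w x) <= B) ->
  fsp u -> fsp (wmul w u).
Proof. by move=> wB [s hs]; exists s => x /hs ux; rewrite (wmulE _ _ wB) ux mulr0. Qed.

Variables (a : Zd -> Zd -> C) (b : Zd -> R).
Hypothesis hJ : jacobi_coeffs a b.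

Local Notation J := (jacobi hJ).
Local Notation steps := (fset_set (@unit_steps d)).

Lemma mem_steps e : (e \in steps) = (l1norm e == 1).
Proof.
rewrite in_fset_set; last exact: finite_unit_steps.
by apply/idP/eqP; rewrite inE.
Qed.

Lemma adjacent_step x e : e \in steps -> Defs.adjacent x (x + e).
Proof. by rewrite mem_steps /Defs.adjacent opprD addNKr l1normN => /eqP. Qed.

Lemma jacobiE u x : J u x =
  \sum_(e <- steps) a x (x + e) * u (x + e) + (b x)%:C * u x.
Proof. exact: jacobi_funE. Qed.

(** The off-diagonal part of [J] with each step [e] weighted by [g e]; the current
    below is another instance. *)
Definition hop (g : Zd -> C) u : H :=
  \sum_(e <- steps | e \in steps) wmul (fun x => g e * a x (x + e)) (shift (- e) u).

Lemma hop_bound (g : Zd -> C) e : e \in steps ->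
  exists B, forall x, normc (g e * a x (x + e)) <= B.
Proof.
move=> es; have [Ma aM] := jacobi_a_bounded hJ; exists (normc (g e) * Ma) => x.
by rewrite normcM ler_wpM2l ?normc_ge0// aM//; exact: adjacent_step.
Qed.

Lemma hopE g u x : hop g u x = \sum_(e <- steps) g e * a x (x + e) * u (x + e).
Proof.
rewrite ell2_sumE [RHS]big_seq; apply: eq_bigr => e es.
have [B hB] := hop_bound g es.
by rewrite (wmulE _ _ hB) shiftE opprK.
Qed.

Lemma blin_hop g : blin (hop g).
Proof.
apply: blin_bigsum => e es; have [B hB] := hop_bound g es.
exact: blin_comp (blin_wmul hB) (blin_shift _).
Qed.

Lemma fsp_hop g u : fsp u -> fsp (hop g u).
Proof.
move=> fu; apply: fsp_sum => e es; have [B hB] := hop_bound g es.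
by apply: (fsp_wmul hB); exact: fsp_shift.
Qed.

Lemma b_bound : exists B, forall x, normc ((b x)%:C : C) <= B.
Proof.
have [B hB] := jacobi_b_bounded hJ; exists B => x.
by rewrite /normc/= expr0n addr0 sqrtr_sqr.
Qed.

Lemma jacobi_hop u : J u = hop (fun=> 1) u + wmul (fun x => (b x)%:C) u.
Proof.
have [B hB] := b_bound; apply: ell2_inj => x; rewrite ell2D hopE jacobiE (wmulE _ _ hB).
by congr (_ + _); apply: eq_bigr => e _; rewrite mul1r.
Qed.

Lemma blin_jacobi : blin J.
Proof.
have [B hB] := b_bound.
have := blin_add (blin_hop (fun=> 1)) (blin_wmul hB).
by have -> : J = (fun u => hop (fun=> 1) u + wmul (fun x => (b x)%:C) u)
  by apply/funext => u; exact: jacobi_hop.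
Qed.

Lemma fsp_jacobi u : fsp u -> fsp (J u).
Proof.
have [B hB] := b_bound.
by move=> fu; rewrite jacobi_hop; apply: fspD; [exact: fsp_hop|exact: (fsp_wmul hB)].
Qed.

Lemma adjacentC x y : Defs.adjacent x y -> Defs.adjacent y x.
Proof. by rewrite /Defs.adjacent -opprB l1normN. Qed.

Lemma jacobi_delta x y : J (delta y) x =
  (if l1norm (x - y) == 1 then a x y else 0) + (b x)%:C * (x == y)%:R.
Proof.
rewrite jacobiE deltaE; congr (_ + _).
have xyE : l1norm (x - y) = l1norm (y - x) by rewrite -l1normN opprB.
rewrite xyE -mem_steps; case: ifPn => ys.
  rewrite (bigD1_seq (y - x) ys (fset_uniq _)) subrKC deltaE eqxx mulr1 big1.
    by rewrite /= addr0.
  move=> e ey; rewrite deltaE; case: eqP => [xe|_]; last by rewrite mulr0.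
  by move: ey; rewrite -xe [x + e]addrC addrK eqxx.
rewrite big1_seq// => e /andP[_ es]; rewrite deltaE.
case: eqP => [xe|_]; last by rewrite mulr0.
by move: ys; rewrite -xe [x + e]addrC addrK es.
Qed.

Lemma jacobi_sym u v : inner (J u) v = inner u (J v).
Proof.
apply: (adjoint_entries blin_jacobi blin_jacobi) => x y.
rewrite !jacobi_delta rmorphD rmorphM /= conj_real conjC_nat.
have -> : l1norm (y - x) = l1norm (x - y) by rewrite -l1normN opprB.
congr (_ + _); last by rewrite eq_sym; case: eqP => [->|]; rewrite ?mulr0.
case: eqP => xy; last by rewrite rmorph0.
by rewrite (jacobi_a_herm hJ (adjacentC xy)).
Qed.

Lemma jacobi_shift l u :
  (forall x y, Defs.adjacent x y -> a (x + l) (y + l) = a x y) ->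
  (forall x, b (x + l) = b x) -> J (shift l u) = shift l (J u).
Proof.
move=> al bl; apply: ell2_inj => x; rewrite shiftE !jacobiE shiftE.
have -> : b x = b (x - l) by rewrite -(bl (x - l)) subrK.
congr (_ + _); rewrite big_seq [RHS]big_seq; apply: eq_bigr => e es.
have -> : a x (x + e) = a (x - l) (x - l + e).
  rewrite -(al (x - l)); last exact: adjacent_step.
  by rewrite subrK [x - l + e + l]addrAC subrK.
by rewrite shiftE [x + e - l]addrAC.
Qed.

Lemma step_coord e k : e \in steps -> `|e 0 k| <= 1.
Proof. by rewrite mem_steps => /eqP <-; exact: l1norm_ge. Qed.

Variable k : 'I_d.

Lemma jacobi_below h u : below k h u -> below k (h + 1) (J u).
Proof.
move=> hu x hx; rewrite jacobiE hu ?mulr0 ?addr0; last by lia.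
rewrite big1_seq// => e /andP[_ /(step_coord k) es]; rewrite hu ?mulr0// !mxE.
by move: es hx; move: (x 0 k) (e 0 k) => y z; lia.
Qed.

Definition ek : Zd := \row_i (i == k)%:Z.

Lemma l1norm_ek : l1norm ek = 1.
Proof.
rewrite /l1norm (bigD1 k)//= mxE eqxx big1 ?addr0// => i /negPf ik.
by rewrite mxE ik.
Qed.

Lemma step_down e : e \in steps -> e 0 k < 0 -> e = - ek.
Proof.
rewrite mem_steps => /eqP e1 ek0; move: (e1); rewrite /l1norm (bigD1 k)//= => E.
have S0 : 0 <= \sum_(i < d | i != k) `|e 0 i| by exact: sumr_ge0.
have {}E : e 0 k = -1 /\ \sum_(i < d | i != k) `|e 0 i| = 0.
  by move: ek0 E S0; move: (e 0 k) (\sum_(i < d | _) _) => y z; lia.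
case: E => e_k /eqP; rewrite psumr_eq0// => /allP h.
apply/rowP => i; rewrite !mxE; have [->|ik] := eqVneq i k; first by rewrite e_k.
by have := h i (mem_index_enum i); rewrite ik normr_eq0 => /eqP.
Qed.

(** A unique continuation step: the only way to reach height [h + 1] from the support
    of [u] is a step up from its topmost layer, and the amplitudes of these steps
    do not vanish. *)
Lemma jacobi_top h u : below k h u -> slice k (h + 1) (J u) = 0 -> slice k h u = 0.
Proof.
move=> hu hs; apply: ell2_inj => y; rewrite restrE ell20; case: eqP => // yh.
have xk : (y + ek) 0 k = h + 1 by rewrite !mxE eqxx yh.
have := congr1 (fun v : H => v (y + ek)) hs.
rewrite restrE xk eqxx ell20 jacobiE [u (y + ek)]hu ?mulr0 ?addr0; last first.
  by rewrite xk; lia.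
have ms : - ek \in steps by rewrite mem_steps l1normN l1norm_ek.
rewrite (bigD1_seq (- ek) ms (fset_uniq _)) big1_seq; last first.
  move=> e /andP[eek es]; rewrite hu ?mulr0// mxE xk.
  have [e0|e0] := ltP (e 0 k) 0; last by move: e0; move: (e 0 k) => z; lia.
  by move: eek; rewrite (step_down es e0) eqxx.
rewrite /= addr0 addrK => /eqP; rewrite mulf_eq0 => /orP[|/eqP//].
have adj : Defs.adjacent (y + ek) y by rewrite /Defs.adjacent addrAC subrr add0r l1norm_ek.
by rewrite (negPf (jacobi_a_neq0 hJ adj)).
Qed.

(** The function whose multiplication operator is the [k]-th position. *)
Definition mpos : Zd -> C := fun x => (x 0 k)%:~R.

Lemma mpos_real x : (mpos x)^*%R = mpos x.
Proof. by rewrite /mpos rmorph_int. Qed.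

(** The commutator of [J] and the position; see [position_jacobi]. *)
Definition current : H -> H := hop (fun e => (e 0 k)%:~R).

Lemma blin_current : blin current. Proof. exact: blin_hop. Qed.

Lemma dom_hop g u : dom mpos u -> dom mpos (hop g u).
Proof.
move=> du; rewrite /dom/=.
have -> : mulfun mpos (hop g u) =
    hop g (X mpos u) - hop (fun e => (e 0 k)%:~R * g e) u :> (Zd -> C).
  apply/funext => x; rewrite /mulfun ell2B !hopE mulr_sumr -sumrB; apply: eq_bigr => e _.
  rewrite XE// /mpos !mxE intrD; ring.
exact: ell2P.
Qed.

Lemma dom_jacobi u : dom mpos u -> dom mpos (J u).
Proof.
have [B hB] := b_bound; move=> du; rewrite jacobi_hop; apply: domD; first exact: dom_hop.
rewrite /dom/=.
have -> : mulfun mpos (wmul (fun x => (b x)%:C) u) =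
    wmul (fun x => (b x)%:C) (X mpos u) :> (Zd -> C).
  apply/funext => x.
  by rewrite /mulfun (wmulE u x hB) (wmulE (X mpos u) x hB) (XE x du) mulrCA.
exact: ell2P.
Qed.

Lemma position_jacobi u : dom mpos u -> X mpos (J u) = J (X mpos u) - current u.
Proof.
move=> du; apply: ell2_inj => x; rewrite XE; last exact: dom_jacobi.
rewrite ell2B !jacobiE hopE XE// mulrDr mulr_sumr [RHS]addrAC -sumrB mulrCA.
congr (_ + _); apply: eq_bigr => e _.
rewrite XE// /mpos !mxE intrD; ring.
Qed.

End jacobi_operator.

(** * Existence of an annihilating polynomial *)

Section annihilating_polynomial.
Variables (R : realType) (d : nat).
Local Notation Zd := 'rV[int]_d.
Local Notation C := R[i].
Local Notation H := (ell2 R Zd).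
Local Notation Rg := (mpoly d C).
Implicit Types (u v : H) (x y e : Zd).

Variable N : nat.
Hypothesis N0 : (0 < N)%N.
Variable J : H -> H.
Hypothesis bJ : blin J.
Hypothesis Jshift : forall m u, J (shift (mono N m) u) = shift (mono N m) (J u).
Hypothesis fsp_J : forall u, fsp u -> fsp (J u).
Hypothesis J_near : forall x y, J (delta y) x != 0 -> l1norm (x - y) <= 1.

Local Notation act := (act N).
Local Notation ev := (ev N J).
Local Notation B := {ffun 'I_d -> 'I_N}.
Local Notation n := #|{: B}|.

(** The points of the cube of side [N], which represent the orbits of the
    translations by multiples of [N]. *)
Definition cell_pt (i : 'I_n) : Zd := \row_k (enum_val i k : nat)%:Z.

Definition cell_span u :=
  exists v : 'I_n -> Rg, u = \sum_i act (v i) (delta (cell_pt i)).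

Lemma cell_span_delta x : (forall k, 0 <= x 0 k) -> cell_span (delta x).
Proof.
move=> x0; pose m : multinom d := Multinom (mktuple (fun k => (`|x 0%R k|%N %/ N)%N)).
have fN k : (`|x 0%R k|%N %% N < N)%N by rewrite ltn_mod.
pose f : B := [ffun k => Ordinal (fN k)].
exists (fun i => if i == enum_rank f then mpolyX C m else 0).
rewrite (bigD1 (enum_rank f))//= eqxx big1 ?addr0; last first.
  by move=> i /negPf ->; rewrite act0.
rewrite actX shift_delta; congr delta; apply/rowP => k.
rewrite !mxE enum_rankK ffunE mnmE -PoszD mulnC -divn_eq.
by rewrite -[LHS]gez0_abs.
Qed.

Lemma cell_spanD u v : cell_span u -> cell_span v -> cell_span (u + v).
Proof.
move=> [f ->] [g ->]; exists (fun i => f i + g i); rewrite -big_split/=.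
by apply: eq_bigr => i _; rewrite actD.
Qed.

Lemma cell_spanZ c u : cell_span u -> cell_span (c *: u).
Proof.
move=> [f ->]; exists (fun i => c *: f i); rewrite scaler_sumr.
by apply: eq_bigr => i _; rewrite actZ.
Qed.

Lemma cell_span0 : cell_span 0.
Proof. by exists (fun=> 0); rewrite big1// => i _; rewrite act0. Qed.

Lemma cell_span_fsp u : fsp u -> (forall x, u x != 0 -> forall k, 0 <= x 0 k) ->
  cell_span u.
Proof.
move=> [s hs] u0.
have -> : u = \sum_(x <- undup s) u x *: delta x.
  apply: ell2_inj => x; rewrite ell2_sumE.
  have [xs|xs] := boolP (x \in undup s).
    rewrite (bigD1_seq x xs (undup_uniq s)) ell2Z deltaE eqxx mulr1 big1.
      by rewrite /= addr0.
    by move=> y yx; rewrite ell2Z deltaE eq_sym (negPf yx) mulr0.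
  have xs' : x \notin s by rewrite -mem_undup.
  rewrite (hs x xs') big1_seq; first by [].
  move=> y /andP[_ ys].
  rewrite ell2Z deltaE; case: eqP => [xy|_]; last by rewrite mulr0.
  by move: xs; rewrite xy ys.
elim: (undup s) => [|x t IH]; first by rewrite big_nil; exact: cell_span0.
rewrite big_cons; apply: cell_spanD => //.
have [->|ux] := eqVneq (u x) 0; first by rewrite scale0r; exact: cell_span0.
by apply: cell_spanZ; apply: cell_span_delta; exact: u0.
Qed.

Definition mnm_all (j : nat) : multinom d := Multinom (mktuple (fun=> j)).

(** One period in every direction brings the neighbours of the fundamental cell
    into the positive cone. *)
Lemma cell_span_J i : cell_span (act (mpolyX C (mnm_all 1)) (J (delta (cell_pt i)))).
Proof.
rewrite actX; apply: cell_span_fsp.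
  by apply: fsp_shift; apply: fsp_J; exact: fsp_delta.
move=> x; rewrite shiftE => /J_near h k.
have := le_trans (l1norm_ge _ k) h; rewrite !mxE mnmE muln1.
move: N0; move: (x 0 k) (N) (nat_of_ord _) => z y w; lia.
Qed.

(** The Cayley-Hamilton theorem. The operator [J] followed by the translation [z1]
    maps the basis vectors of the cell to combinations of themselves, with a
    matrix [Hm] of polynomials in the translations. Its characteristic
    polynomial, evaluated at [z1] times the variable, annihilates the cell, hence
    also its translates. *)
Lemma exists_annihilator : exists P : {poly Rg}, P != 0 /\ ann N J P.
Proof.
have [h hE] := choice cell_span_J.
pose z1 : Rg := mpolyX C (mnm_all 1).
pose Hm : 'M[Rg]_n := \matrix_(i, j) h i j.
pose Mx : 'M[{poly Rg}]_n := map_mx (comp_poly (z1 *: 'X)) (char_poly_mx Hm).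
have z10 : z1 != 0 by rewrite /z1 -msupp_eq0 msuppX.
exists (\det Mx); split.
  rewrite /Mx det_map_mx -/(char_poly Hm) comp_poly_eq0 ?size_scale ?size_polyX//.
  exact/monic_neq0/char_poly_monic.
have MxE i j : Mx i j = (z1 *: 'X) *+ (i == j) - (h i j)%:P.
  by rewrite !mxE rmorphB rmorphMn /= comp_polyX comp_polyC.
have Mx0 i : \sum_j ev (Mx i j) (delta (cell_pt j)) = 0.
  rewrite (eq_bigr (fun j => ev ((z1 *: 'X) *+ (i == j)) (delta (cell_pt j)) -
    act (h i j) (delta (cell_pt j)))); last first.
    move=> j _; rewrite MxE -(evC N J) -[RHS]addrC.
    apply/eqP; rewrite eq_sym addrC subr_eq; apply/eqP.
    by rewrite -(evD N J) subrK.
  rewrite sumrB -hE (bigD1 i)//= eqxx mulr1n big1 ?addr0; last first.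
    by move=> j; rewrite eq_sym => /negPf ->; rewrite mulr0n ev0.
  have -> : ev (z1 *: 'X) (delta (cell_pt i)) = act z1 (J (delta (cell_pt i))).
    by rewrite (evZ N J) -[X in ev X]mul1r (evMX) -[1]/(1%:P) evC act1.
  by rewrite subrr.
have det_cell j : ev (\det Mx) (delta (cell_pt j)) = 0.
  have E l : (\adj Mx *m Mx) j l = (\det Mx) *+ (j == l) by rewrite mul_adj_mx mxE.
  transitivity (\sum_l ev ((\adj Mx *m Mx) j l) (delta (cell_pt l))).
    rewrite (bigD1 j)// E eqxx mulr1n big1; first by rewrite /= addr0.
    by move=> l lj; rewrite E eq_sym (negPf lj) mulr0n ev0.
  transitivity (\sum_l \sum_i ev (\adj Mx j i) (ev (Mx i l) (delta (cell_pt l)))).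
    apply: eq_bigr => l _; rewrite mxE.
    elim/big_rec2: _ => [|i y1 y2 _ <-]; first by rewrite ev0.
    by rewrite (evD N J) (evM bJ Jshift).
  rewrite exchange_big big1// => i _.
  by rewrite -(blin_sum _ _ _ (blin_ev N bJ _)) Mx0 (blin0 (blin_ev N bJ _)).
apply: (ann_delta bJ) => x.
(* [mono N m] moves [x] into the positive cone, which the translates of the cell
   cover. *)
pose m : multinom d := Multinom (mktuple (fun k => `|x 0%R k|%N)).
have : ev (\det Mx) (delta (mono N m + x)) = 0.
  have [|v ->] := @cell_span_delta (mono N m + x).
    move=> k; rewrite !mxE mnmE; move: (x 0 k) => z.
    have : (`|z|%N <= N * `|z|%N)%N by rewrite leq_pmull.
    by move: (N * `|z|%N)%N => w; lia.
  rewrite (blin_sum _ _ _ (blin_ev N bJ _)) big1// => i _.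
  rewrite -(evC N J) -(evM bJ Jshift) mulrC (evM bJ Jshift) det_cell.
  by rewrite (blin0 (blin_ev N bJ _)).
rewrite -shift_delta -(ev_shift Jshift) => h0.
by apply: ell2_rnorm_eq0; rewrite -(rnorm_shift (mono N m)) h0 rnorm0.
Qed.

End annihilating_polynomial.

(** * The velocity of a periodic Jacobi operator *)

Section velocity_commutator.
Variables (R : realType) (d : nat).
Local Notation Zd := 'rV[int]_d.
Local Notation C := R[i].
Local Notation H := (ell2 R Zd).
Local Notation Rg := (mpoly d C).
Implicit Types (u v : H) (x y : Zd) (c : Rg) (P : {poly Rg}).

Variable N : nat.
Variable k : 'I_d.
Local Notation act := (act N).
Local Notation mpos := (@mpos R d k).
Local Notation dom := (dom mpos).
Local Notation X := (X mpos).

Lemma dom_X_shift l u : dom u -> dom (shift l u) /\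
  X (shift l u) = shift l (X u) + (l 0 k)%:~R *: shift l u.
Proof.
move=> du.
have E x : mpos x * shift l u x = (shift l (X u) + (l 0 k)%:~R *: shift l u) x.
  rewrite ell2D ell2Z !shiftE (XE _ du) -mulrDl; congr (_ * _).
  by rewrite /mpos !mxE -intrD subrK.
have ds : dom (shift l u).
  rewrite /dom/= (_ : mulfun mpos (shift l u) =
    (shift l (X u) + (l 0 k)%:~R *: shift l u : H)); first exact: ell2P.
  by apply/funext => x; exact: E.
by split => //; apply: ell2_inj => x; rewrite (XE _ ds) E.
Qed.

Lemma dom_act c u : dom u -> dom (act c u).
Proof.
move=> du; apply: dom_sum => m _.
by apply: domZ; case: (dom_X_shift (mono N m) du).
Qed.

Lemma X_act c u : dom u -> X (act c u) = act c (X u) + N%:R *: act (euler k c) u.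
Proof.
move=> du.
have supp : {subset msupp (euler k c) <= msupp c}.
  move=> m; rewrite !mcoeff_msupp mcoeff_euler; apply: contra_neq => ->.
  by rewrite mulr0.
rewrite X_sum => [|m _]; last first.
  by apply: domZ; case: (dom_X_shift (mono N m) du).
rewrite (act_wide N u (msupp_uniq c) supp) scaler_sumr -big_split.
apply: eq_bigr => m _; have [ds Xs] := dom_X_shift (mono N m) du.
rewrite (XZ _ ds) Xs scalerDr !scalerA mcoeff_euler; congr (_ + _ *: _).
rewrite mxE PoszM intrM mulrC !mulrA; congr (_ * _).
Qed.

Variables (J Cm : H -> H).
Hypotheses (bJ : blin J) (bC : blin Cm).
Hypothesis Jshift : forall m u, J (shift (mono N m) u) = shift (mono N m) (J u).
Hypothesis dom_J : forall u, dom u -> dom (J u).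
Hypothesis XJ : forall u, dom u -> X (J u) = J (X u) - Cm u.
Local Notation ev := (ev N J).

Lemma dom_ev P u : dom u -> dom (ev P u).
Proof. by move=> du; apply: dom_sum => i _; apply: dom_act; exact: dom_iter. Qed.

Lemma ev_MXaddC P c u : ev (P * 'X + c%:P) u = ev P (J u) + act c u.
Proof. by rewrite (evD N J (P * 'X)) (evMX N J P) (evC N J c). Qed.

Lemma ev_deriv_MXaddC P c u :
  ev (P * 'X + c%:P)^`() u = ev P^`() (J u) + ev P u.
Proof.
have -> : (P * 'X + c%:P)^`() = P^`() * 'X + P.
  by rewrite derivD derivM derivX derivC addr0 mulr1.
by rewrite (evD N J (P^`() * 'X)) (evMX N J P^`()).
Qed.

(** Taking the commutator with the position is a derivation. On the translations
    it is [- N] times the Euler derivation, and on [J] it is the current; since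
    the latter does not commute with [J], its occurrences are moved to the right
    at the cost of commutators of [J] with a bounded operator [W]. *)
Lemma ev_commutator P : exists W, blin W /\ forall u, dom u ->
  ev P (X u) - X (ev P u) =
  - (N%:R *: ev (eulerp k P) u) + ev P^`() (Cm u) + (J (W u) - W (J u)).
Proof.
elim/poly_ind: P => [|P c [W [bW IH]]].
  exists (fun=> 0); split=> [|u du]; first exact: blin_zero.
  by rewrite eulerp0 deriv0 !ev0 X0 (blin0 bJ) scaler0 oppr0 !addr0.
exists (fun u => W (J u) - ev P^`() (Cm u)); split=> [|u du].
  by apply: blin_sub; apply: blin_comp => //; exact: blin_ev.
have dPJ : dom (ev P (J u)) by apply: dom_ev; exact: dom_J.
have dc : dom (act c u) by exact: dom_act.
have E := IH (J u) (dom_J du).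
have XJ' : J (X u) = X (J u) + Cm u by rewrite XJ// subrK.
have key : ev P (J (X u)) + act c (X u) - X (ev P (J u) + act c u) =
    - (N%:R *: (ev (eulerp k P) (J u) + act (euler k c) u)) +
    (ev P^`() (J (Cm u)) + ev P (Cm u)) +
    (J (W (J u) - ev P^`() (Cm u)) - (W (J (J u)) - ev P^`() (Cm (J u)))).
  rewrite (XD dPJ dc) (X_act c du) XJ' (blinD (blin_ev N bJ P)).
  rewrite (blinB bJ) (evJ bJ Jshift).
  have -> : ev P (X (J u)) = X (ev P (J u)) + (- (N%:R *: ev (eulerp k P) (J u)) +
      ev P^`() (Cm (J u)) + (J (W (J u)) - W (J (J u)))) by rewrite -E addrC subrK.
  rewrite scalerDr.
  move: (N%:R *: ev (eulerp k P) (J u)) (N%:R *: act (euler k c) u) => B3 B9.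
  move: (X (ev P (J u))) (ev P^`() (Cm (J u))) (J (W (J u))) => a2 a4 a5.
  move: (W (J (J u))) (ev P (Cm u)) (act c (X u)) (ev P^`() (J (Cm u))) => a6 a7 a8 a10.
  by apply: ell2_inj => x; rewrite !(ell2D, ell2B, ell2N); ring.
have L := congr2 (fun v w => v - X w) (ev_MXaddC P c (X u)) (ev_MXaddC P c u).
have D := etrans (congr1 (fun Q => ev Q u) (eulerp_MXaddC k P c))
  (ev_MXaddC (eulerp k P) (euler k c) u).
exact: etrans L (etrans key (esym (congr2 (fun v w => - (N%:R *: v) + w +
  (J (W (J u) - ev P^`() (Cm u)) - (W (J (J u)) - ev P^`() (Cm (J u))))) D
  (ev_deriv_MXaddC P c (Cm u))))).
Qed.

End velocity_commutator.

Section jacobi_velocity.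
Variables (R : realType) (d : nat).
Local Notation Zd := 'rV[int]_d.
Local Notation C := R[i].
Local Notation H := (ell2 R Zd).
Local Notation rn := (@ell2_rnorm R Zd).
Local Notation Rg := (mpoly d C).
Implicit Types (u v : H).

Variables (a : Zd -> Zd -> C) (b : Zd -> R).
Hypothesis hJ : jacobi_coeffs a b.
Hypothesis hper : periodic_coeffs a b.
Local Notation J := (jacobi hJ).

Lemma jacobi_period : exists N : nat, (0 < N)%N /\
  forall m u, J (shift (mono N m) u) = shift (mono N m) (J u).
Proof.
have [L [/full_rank_period[N [N0 LN]] hL]] := hper; exists N; split=> // m u.
have [ha hb] := hL _ (LN m).
by apply: jacobi_shift.
Qed.

Lemma jacobi_near (x y : Zd) : J (delta y) x != 0 -> l1norm (x - y) <= 1.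
Proof.
rewrite jacobi_delta; have [->//|_] := eqVneq (l1norm (x - y)) 1.
have [->|_] := eqVneq x y; last by rewrite mulr0 addr0 eqxx.
by rewrite subrr /l1norm big1// => k _; rewrite mxE normr0.
Qed.

Lemma exists_minpoly (N : nat) : (0 < N)%N ->
  (forall m u, J (shift (mono N m) u) = shift (mono N m) (J u)) ->
  exists p : {poly Rg}, [/\ p != 0, ann N J p &
    forall P, P != 0 -> ann N J P -> (size p <= size P)%N].
Proof.
move=> N0 Jshift.
have [P [P0 aP]] := exists_annihilator N0 (blin_jacobi hJ) Jshift
  (@fsp_jacobi _ _ _ _ hJ) jacobi_near.
have ex : exists n, `[< exists p : {poly Rg}, [/\ p != 0, ann N J p & size p = n] >].
  by exists (size P); apply/asboolP; exists P.
case: (ex_minnP ex) => n /asboolP[p [p0 ap <-]] nmin; exists p; split=> // Q Q0 aQ.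
by apply: nmin; apply/asboolP; exists Q.
Qed.

Variable k : 'I_d.
Local Notation mpos := (@mpos R d k).
Local Notation dom := (dom mpos).
Local Notation X := (X mpos).
Local Notation Cm := (current a k).

(** As [ev p = 0], [ev_commutator] says that [p'] applied to the current is
    [N * eulerp k p] up to a commutator with [J]. Multiplying by the Bezout
    coefficient [v1] of [p'] gives the same for [r] applied to the current, with
    [A = N * v1 * eulerp k p]; this is the hypothesis of [asymptotic_velocity].
    If [Q u = 0] then [A u = 0], so [eulerp k p] annihilates [u], as does [p],
    and the Bezout identity for these two gives [u = 0]. *)
Theorem jacobi_velocity : exists Q : H -> H,
  [/\ blin Q, forall u v, inner (Q u) v = inner u (Q v),
      forall u, dom u -> (forall t, dom (unitary_group J t u)) /\
        tends (pinfty_nbhs R) (fun t => t^-1%:C *: heis mpos J t u) (Q u) &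
      forall u, Q u = 0 -> u = 0].
Proof.
have [N [N0 Jshift]] := jacobi_period.
have bJ := blin_jacobi hJ; have Jsym := @jacobi_sym _ _ _ _ hJ.
have bC : blin Cm := blin_current hJ k.
have domJ := @dom_jacobi _ _ _ _ hJ k; have XJ := @position_jacobi _ _ _ _ hJ k.
have [p [p0 ap pmin]] := exists_minpoly N0 Jshift.
have psep := minpoly_separable bJ Jsym Jshift p0 ap pmin.
have peul := minpoly_euler_coprime N0 bJ Jsym Jshift p0 ap pmin
  (@jacobi_below _ _ _ _ hJ k) (@fsp_jacobi _ _ _ _ hJ) (@jacobi_top _ _ _ _ hJ k).
have [u1 [v1 [r [r0 E1]]]] := coprimepW psep.
have [u2 [v2 [r2 [r20 E2]]]] := coprimepW peul.
have evp' w : ev N J v1 (ev N J p^`() w) = act N r w.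
  rewrite -(evC N J r w) -E1 (evD N J) !(evM bJ Jshift) ap.
  by rewrite (blin0 (blin_ev N bJ _)) add0r.
have [W0 [bW0 hW0]] := ev_commutator bJ bC Jshift domJ XJ p.
pose A u : H := N%:R *: ev N J v1 (ev N J (eulerp k p) u).
pose W u : H := ev N J v1 (W0 u).
have bA : blin A by apply: blin_scale; apply: blin_comp; exact: blin_ev.
have bW : blin W by apply: blin_comp bW0; exact: blin_ev.
have [_ [M [M0 JM]]] := bJ; have [_ [c [c0 Cc]]] := bC.
have M1 : 1 <= M + 1 by rewrite lerDr.
have JM1 u : rn (J u) <= (M + 1) * rn u.
  by apply: le_trans (JM u) _; rewrite ler_wpM2r ?ell2_rnorm_ge0// lerDl.
have rC u : dom u -> act N r (Cm u) = A u - (J (W u) - W (J u)).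
  move=> du; have := congr1 (ev N J v1) (hW0 u du).
  rewrite (ap (X u)) (ap u) X0 subrr (blin0 (blin_ev N bJ _)).
  rewrite !(blinD (blin_ev N bJ v1)) !(blinN (blin_ev N bJ v1)).
  rewrite (blinZ (blin_ev N bJ v1)) -(evJ bJ Jshift) evp'.
  rewrite -/(A u) -/(W u) -/(W (J u)) => E.
  apply/eqP; rewrite -subr_eq0 opprB addrC -addrA addrC -addrA; apply/eqP.
  by rewrite [RHS]E addrA [X in X + _]addrC.
have AJ u : A (J u) = J (A u).
  by rewrite /A (blinZ bJ) !(evJ bJ Jshift).
have JY u : dom u -> J (act N r (X u) + W u) = act N r (X (J u)) + W (J u) + A u.
  move=> du; rewrite (blinD bJ) XJ// (blinB (blin_act N r)) rC// (Jact bJ Jshift).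
  move: (act N r (J (X u))) (A u) (J (W u)) (W (J u)) => w1 w2 w3 w4.
  by apply: ell2_inj => x; rewrite !(ell2D, ell2N); ring.
have rdense u e : 0 < e -> exists g, dom g /\ rn (u - act N r g) <= e.
  move=> e0; have [g [fg hg]] := act_dense N0 u r0 e0; exists g; split=> //.
  exact: dom_fsp.
have brC : blin (fun u => N%:R *: act N (euler k r) u).
  by apply: blin_scale; exact: blin_act.
have [Q [bQ Qsym Qlim rQ]] := asymptotic_velocity (@mpos_real R d k) bJ M1 JM1 Jsym
  domJ XJ c0 Cc (blin_act N r) bA bW brC
  (fun u => esym (Jact bJ Jshift r u)) (fun u (du : dom u) => dom_act N r du)
  (fun u (du : dom u) => X_act N r du)
  AJ JY rdense.
exists Q; split; [exact: bQ|exact: Qsym|move=> u du|move=> u Qu0].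
  split; last exact: Qlim.
  by move=> t; exact: (dom_U bJ M1 JM1 domJ XJ c0 Cc t du).
have Au0 : A u = 0.
  have := rQ u; rewrite Qu0 (blin0 (blin_act N r)) => /esym/eqP.
  rewrite scaler_eq0 => /orP[|/eqP//].
  by rewrite eq_complex/= oner_eq0 andbF.
have ev0 : ev N J v1 (ev N J (eulerp k p) u) = 0.
  move: Au0 => /eqP.
  by rewrite /A scaler_eq0 pnatr_eq0 -[_ == 0%N]negbK -lt0n N0/= => /eqP.
have evD0 : ev N J (eulerp k p) u = 0.
  apply: (act_inj N0 r0); rewrite -evp' (evC_comm bJ Jshift v1).
  by rewrite ev0 (blin0 (blin_ev N bJ _)).
apply: (act_inj N0 r20); rewrite -(evC N J r2 u) -E2 (evD N J) !(evM bJ Jshift) ap.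
by rewrite [ev N J (eulerp k p) u]evD0 !(blin0 (blin_ev N bJ _)) addr0.
Qed.

End jacobi_velocity.

Section heisenberg.
Variables (R : realType) (d : nat) (k : 'I_d).
Local Notation H := (ell2 R 'rV[int]_d).
Implicit Types (J : H -> H) (psi : H).

Lemma dom_positionE psi : dom_position k psi = dom (@mpos R d k) psi.
Proof. by []. Qed.

Lemma positionX psi : position k psi = X (@mpos R d k) psi.
Proof. by rewrite /position /X. Qed.

Lemma heisenbergE J t psi : heisenberg J k t psi = heis (@mpos R d k) J t psi.
Proof. by rewrite /heisenberg /heis positionX. Qed.

Lemma dom_heisenbergE J t psi :
  dom_heisenberg J k t psi = dom (@mpos R d k) (unitary_group J (- t) psi).
Proof. by rewrite -dom_positionE. Qed.

End heisenberg.

Section tensor_norm.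
Variables (R : realType) (d : nat).
Local Notation H := (ell2 R 'rV[int]_d).
Local Notation rn := (@ell2_rnorm R 'rV[int]_d).

Lemma tensor_norm_le (v : 'I_d -> H) : tensor_norm v <= \sum_k rn (v k).
Proof.
have S0 : 0 <= \sum_k rn (v k) by apply: sumr_ge0 => k _; exact: ell2_rnorm_ge0.
rewrite /tensor_norm -[leRHS]ger0_norm// -sqrtr_sqr ler_wsqrtr//.
have h (s : seq 'I_d) : 0 <= \sum_(k <- s) rn (v k) /\
    \sum_(k <- s) rn (v k) ^+ 2 <= (\sum_(k <- s) rn (v k)) ^+ 2.
  elim: s => [|k s [x0 IH]]; first by rewrite !big_nil expr0n.
  rewrite !big_cons; have v0 := ell2_rnorm_ge0 (v k).
  have xv : 0 <= rn (v k) * \sum_(k <- s) rn (v k) by rewrite mulr_ge0.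
  by split; [rewrite addr_ge0|rewrite sqrrD; lra].
exact: (h _).2.
Qed.

Lemma tensor_norm_cvg0 (T : Type) (F : set_system T) {FF : ProperFilter F}
    (f : T -> 'I_d -> H) (l : 'I_d -> H) :
  (forall k, tends F (fun t => f t k) (l k)) ->
  tensor_norm (f t - l) @[t --> F] --> (0 : R).
Proof.
move=> fl.
suff sum0 : \sum_k rn (f t k - l k) @[t --> F] --> (0 : R).
  apply: (squeeze_cvgr _ (cvg_cst 0) sum0); apply: nearW => t.
  by rewrite sqrtr_ge0 (tensor_norm_le (f t - l)).
have h (s : seq 'I_d) : \sum_(k <- s) rn (f t k - l k) @[t --> F] --> (0 : R).
  elim: s => [|k s IH].
    by under eq_fun do rewrite big_nil; exact: cvg_cst.
  have hk : rn (f t k - l k) @[t --> F] --> (0 : R).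
    apply/cvgrPdist_le => e e0; apply: filterS (fl k e e0) => t.
    by rewrite sub0r normrN ger0_norm ?ell2_rnorm_ge0.
  have -> : (fun t => \sum_(j <- k :: s) rn (f t j - l j)) =
      (fun t => rn (f t k - l k)) \+ (fun t => \sum_(j <- s) rn (f t j - l j)).
    by apply/funext => t; rewrite big_cons.
  have := cvgD hk IH; rewrite addr0; exact.
exact: h.
Qed.

End tensor_norm.

Theorem theorem1p1 (R : realType) (d : nat) (d_ge1 : (1 <= d)%N)
    (a : 'rV[int]_d -> 'rV[int]_d -> R[i]) (b : 'rV[int]_d -> R)
    (hJ : jacobi_coeffs a b) (hper : periodic_coeffs a b) :
  let J := jacobi hJ in
  exists Q : 'I_d -> ell2 R 'rV[int]_d -> ell2 R 'rV[int]_d,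
    let Qv := (fun psi k => Q k psi) : ell2 R 'rV[int]_d -> 'I_d -> ell2 R 'rV[int]_d in
    (forall k : 'I_d,
      [/\ bounded_selfadjoint (Q k),
          forall psi, dom_position k psi ->
            (forall t : R, dom_heisenberg J k t psi) /\
            (t^-1%:C *: heisenberg J k t psi @[t --> +oo%R] --> Q k psi) &
          Q k @^-1` [set 0] = [set 0]]) /\
    [/\ exists M : R, forall psi, tensor_norm (Qv psi) <= M * ell2_rnorm psi,
        forall psi, dom_vposition psi ->
          (forall t : R, dom_vheisenberg J t psi) /\
          (tensor_norm (t^-1%:C *: vheisenberg J t psi - Qv psi) @[t --> +oo%R] --> (0 : R)) &
        Qv @^-1` [set 0] = [set 0]].
Proof.
move=> J; have vel k := jacobi_velocity hJ hper k.
have [Q hQ] := choice vel.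
have bQ k : blin (Q k) by have [] := hQ k.
have Q0 k psi : Q k psi = 0 -> psi = 0 by have [_ _ _] := hQ k; exact.
have lim k psi : dom_position k psi -> (forall t : R, dom_heisenberg J k t psi) /\
    tends (pinfty_nbhs R) (fun t => t^-1%:C *: heisenberg J k t psi) (Q k psi).
  rewrite dom_positionE => dpsi; have [_ _ /(_ psi dpsi)[dt tQ] _] := hQ k.
  split=> [t|]; first by rewrite dom_heisenbergE; exact: dt.
  apply: eq_tends tQ => t; by rewrite heisenbergE.
exists Q => Qv; split=> [k|].
  have [bQk Qsym _ _] := hQ k; split.
  - split=> //.
      by move=> c u v; rewrite (blinD bQk) (blinZ bQk).
    have [_ [M [M0 QM]]] := bQk; exists M => u.
    by rewrite !ell2_normE -rmorphM lecR.
  - move=> psi dpsi; have [dt tQ] := lim k psi dpsi; split; first exact: dt.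
    by apply/tends_cvg; exact: tQ.
  - apply/seteqP; split=> psi /=; first exact: Q0.
    by move=> ->; exact: blin0.
split.
- have bd k : exists M : R, forall psi, ell2_rnorm (Q k psi) <= M * ell2_rnorm psi.
    by have [_ [M [_ QM]]] := bQ k; exists M.
  have [M hM] := choice bd.
  exists (\sum_k M k) => psi; apply: le_trans (tensor_norm_le _) _.
  by rewrite mulr_suml; apply: ler_sum => k _; exact: hM.
- move=> psi dpsi; split=> [t k|]; first exact: (lim k psi (dpsi k)).1.
  by apply: tensor_norm_cvg0 => k; exact: (lim k psi (dpsi k)).2.
- apply/seteqP; split=> psi /= Qpsi.
    apply: (Q0 (Ordinal d_ge1)).
    by have := congr1 (fun v => v (Ordinal d_ge1)) Qpsi.
  by rewrite Qpsi; apply/funext => k; exact: blin0.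
Qed.
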